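(* Let $f\in C^\infty(\mathbb{R}^3)$ be a real-valued function with a non-degenerate critical point at $p\in\mathbb{R}^3$ (that is, $df(p)=0$ and the Hessian matrix $d^2f(p)$ is non-singular). Assume that the Taylor series expansion of $f$ at $p$ takes the form $f=f_0+f_2+f_4+\mathcal{O}(6)$, where $f_k$ denotes the homogeneous term of degree $k$; that is, the homogeneous terms $f_3$ and $f_5$ of orders $3$ and $5$ of the Taylor expansion of $f$ at $p$ vanish. Then, for every connected open neighborhood $U$ of $p$, the unique smooth vector field $X$ on $U$ satisfying $\mathrm{curl}(X)=fX$ and $\mathrm{div}(X)=0$ on $U$ is $X\equiv 0$.
   Context: The operators $\mathrm{curl}$ and $\mathrm{div}$ are the usual Euclidean ones on $\mathbb{R}^3$. *)

(* Defs.v *)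
From HB Require Import structures.
From mathcomp Require Export all_boot all_order all_algebra.
From mathcomp Require Export all_classical all_reals all_analysis.
Export Order.TTheory GRing.Theory Num.Theory.
Export numFieldNormedType.Exports.

Set Implicit Arguments.
Unset Strict Implicit.
Unset Printing Implicit Defensive.

Local Open Scope classical_set_scope.
Local Open Scope ring_scope.

Section Defs.
Context {R : realType}.
Local Notation R3 := 'rV[R]_3.
Implicit Types (f : R3 -> R) (X : R3 -> R3) (U : set R3) (p x h : R3).

Definition partial (i : 'I_3) f : R3 -> R := 'D_(delta_mx 0 i) f.

(* iter_partial [:: i1; ...; ik] f is d_{i1} (... (d_{ik} f)). *)
Definition iter_partial (s : seq 'I_3) f : R3 -> R := foldr partial f s.

(* C^oo on an open set U: the partial derivatives of all orders exist and are
   continuous on U.  The derivative operators are total and local, so the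
   values of f outside the open set U play no role. *)
Definition smooth_on U f : Prop :=
  forall (s : seq 'I_3) x, U x ->
    {for x, continuous (iter_partial s f)} /\
    forall i : 'I_3, derivable (iter_partial s f) x (delta_mx 0 i).

Definition component X (j : 'I_3) : R3 -> R := fun x => X x 0 j.

Definition smooth_field_on U X : Prop :=
  forall j : 'I_3, smooth_on U (component X j).

(* Indices are added in 'I_3, hence modulo 3: the entries are
   d_1 X_2 - d_2 X_1,  d_2 X_0 - d_0 X_2,  d_0 X_1 - d_1 X_0. *)
Definition curl X : R3 -> R3 := fun x =>
  \row_(i < 3) (partial (i + 1) (component X (i + 2)) x -
                partial (i + 2) (component X (i + 1)) x).

Definition div X : R3 -> R := fun x =>
  \sum_(i < 3) partial i (component X i) x.

Definition hessian f p : 'M[R]_3 :=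
  \matrix_(i < 3, j < 3) partial i (partial j f) p.

Definition nondegenerate_critical_point f p : Prop :=
  (forall h, 'd f p h = 0) /\ hessian f p \in unitmx.

(* The homogeneous term of degree k of the Taylor expansion of f at p, as a
   function of the displacement h = x - p:
   f_k(h) = 1/k! sum_{i1,...,ik} (d_{i1} ... d_{ik} f)(p) h_{i1} ... h_{ik}. *)
Definition taylor_term f p (k : nat) h : R :=
  (k`!%:R)^-1 *
  \sum_(t : k.-tuple 'I_3) iter_partial t f p * \prod_(i <- t) h 0 i.

Definition divfree_beltrami_field U f X : Prop :=
  [/\ smooth_field_on U X,
      forall x, U x -> curl X x = f x *: X x &
      forall x, U x -> div X x = 0].

End Defs.

(* Main.v *)
From HB Require Import structures.
Require Import Defs.
From mathcomp Require Import ring lra zify.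
Set Implicit Arguments.
Unset Strict Implicit.
Unset Printing Implicit Defensive.
Local Open Scope classical_set_scope.
Local Open Scope ring_scope.

(** A field with [curl X = f X] and [div X = 0] vanishes for two reasons: its Taylor
series at [p] is zero, and a field of this kind whose Taylor series at one point is zero
vanishes on every connected open set containing the point.

The Taylor series. The divergence of [curl X = f X] gives a third equation, [grad f . X
= 0]. Take orthonormal coordinates in which the Hessian of [f] is diagonal
([diagonalize]), with eigenvalues [l_1, l_2, l_3], all nonzero. If [y] is the lowest
nonzero homogeneous term of [X], of degree [m], then [curl y = 0], [div y = 0] and
[sum_i l_i x_i y_i = 0]. So [y = grad u] with [u] harmonic, homogeneous of degree [m +
1], and killed by [sum_i l_i x_i d_i]: only the resonant monomials [x^b], those with
[sum_i l_i b_i = 0], occur in [u]. Together with harmonicity this leaves few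
possibilities ([distinct_support], [equal12_support]). They are excluded by the next
term [v] of [X] that sees [y]. If [f p <> 0], it has degree [m + 1] and [curl v = f(p)
y]. If [f p = 0], the term of degree [m + 1] vanishes, as two consecutive degrees cannot
both be resonant ([consecutive_levels]), and the term [v] of degree [m + 3] satisfies
[curl v = f_2 y]; it still satisfies [div v = 0] and [sum_i l_i x_i v_i = 0] because [f]
has no terms of degree three and five, and [f_4] meets the term of degree [m + 1] only.
The curl equation and [sum_i l_i x_i v_i = 0] determine, up to resonance, the
coefficients of [v] from those of [y], and then [div v = 0] forces [y = 0]
([level_zero], [component_vanish]).

Unique continuation. Put [rho = |x - p|^2] and let [E] be the radial derivative of the
field. An explicit flux, weighted by [(1 + 1/rho)^n], has a divergence that is a square
up to a zeroth-order term; for large [n] twice the divergence is at least [rho |X|^2]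
times the weight ([flux_divergence], [density_coef_ge]). As [X] vanishes to infinite
order at [p], the weighted flux is of class [C^1] even there ([flatC1_weight]), and
after multiplication by a cutoff function its divergence has integral [0] over a cube
([grid_compare], with Riemann sums for integrals). A nonzero value of [X] at distance
less than that of the support of the derivative of the cutoff contributes a term that
grows with [n] exponentially faster than the error due to the cutoff; so [X = 0] near
[p] ([beltrami_zero_near]). The set of zeros of infinite order of [X] is therefore open
in [U], and it is closed in [U] by continuity ([beltrami_zero_connected]). *)

(** * Calculus along coordinate lines *)

Section Line.
Context {R : realType} {V : normedModType R}.
Implicit Types (F G : V -> R) (v x y : V).

Lemma is_derive_line F v y t d :
  is_derive (y + t *: v) v F d -> is_derive t (1 : R) (fun s => F (y + s *: v)) d.
Proof.
move=> [dF <-]; have E : (fun h : R => h^-1 *: (F (h *: v + (y + t *: v)) - F (y + t *: v)))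
   = (fun h : R => h^-1 *: (F (y + (h *: (1:R) + t) *: v) - F (y + t *: v))).
  apply/funext => h; congr (_ *: (F _ - _)).
  by rewrite addrCA scalerDl [h *: 1]mulr1.
apply: DeriveDef.
  by move: dF; rewrite /derivable E.
by rewrite /derive /= E.
Qed.

Lemma mvt_line F v y (h : R) :
  (forall t : R, `|t| <= `|h| -> derivable F (y + t *: v) v) ->
  exists2 c : R, `|c| <= `|h| & F (y + h *: v) - F y = h * 'D_v F (y + c *: v).
Proof.
move=> dF; pose G (s : R) := F (y + s *: v); pose D (s : R) := 'D_v F (y + s *: v).
have H (t : R) : `|t| <= `|h| -> is_derive t (1:R) G (D t).
  by move=> th; apply/is_derive_line/derivableP/dF.
have MV (a b : R) : a <= b -> (forall t, t \in `[a, b]%R -> `|t| <= `|h|) ->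
    exists2 c, c \in `[a, b]%R & G b - G a = D c * (b - a).
  move=> ab bt; apply: MVT_segment => //.
    by move=> t th; apply: H; apply: bt; exact: subset_itv_oo_cc.
  by apply: derivable_within_continuous => t /bt /H [].
have [h0|h0] := leP 0 h.
- have bt t : t \in `[0, h]%R -> `|t| <= `|h|.
    by rewrite in_itv /= => /andP[t0 th]; rewrite !ger0_norm.
  have [c ch E] := MV _ _ h0 bt; exists c; first exact: bt.
  by move: E; rewrite /G /D scale0r addr0 subr0 mulrC.
- have bt t : t \in `[h, 0]%R -> `|t| <= `|h|.
    rewrite in_itv /= => /andP[t0 th]; rewrite !ler0_norm ?lerN2 //; exact: ltW.
  have [c ch E] := MV _ _ (ltW h0) bt; exists c; first exact: bt.
  move: E; rewrite /G /D scale0r addr0; move: ('D_v F _) => d; lra.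
Qed.

End Line.

Section Coordinates.
Context {R : realType}.
Local Notation R3 := 'rV[R]_3.
Implicit Types (x y z p : R3) (F G : R3 -> R).

Lemma ord3_ind (P : 'I_3 -> Prop) : P 0 -> P 1 -> P 2 -> forall i, P i.
Proof.
move=> P0 P1 P2 [[|[|[|//]]] Hi].
- by rewrite (_ : Ordinal Hi = 0) //; exact/val_inj.
- by rewrite (_ : Ordinal Hi = 1) //; exact/val_inj.
- by rewrite (_ : Ordinal Hi = 2) //; exact/val_inj.
Qed.

Lemma sum3 (M : nmodType) (a : 'I_3 -> M) : \sum_(i < 3) a i = a 0 + a 1 + a 2.
Proof.
rewrite !big_ord_recl big_ord0 addr0 addrA.
by congr (a _ + a _ + a _); exact/val_inj.
Qed.

Lemma norm_rV3_leP z (r : R) : 0 <= r -> reflect (forall i, `|z 0 i| <= r) (`|z| <= r).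
Proof.
move=> r0; rewrite [`|z|]mx_normrE; apply: (iffP (bigmax_leP _ _ _ _)) => [[_ H] i|H].
  exact: (H (0, i)).
by split=> // -[i j] _ /=; rewrite (ord1 i).
Qed.

Lemma coord_le_norm z i : `|z 0 i| <= `|z|.
Proof. exact/norm_rV3_leP. Qed.

(** The segment from [p] to [x] is replaced by a path made of three segments parallel to
the axes, so that only partial derivatives are needed; the path stays in the ball
because the norm is the sup norm. *)
Lemma mvt_coord F p x :
  (forall y, `|y - p| <= `|x - p| -> forall i, derivable F y (delta_mx 0 i)) ->
  exists2 xi : 'I_3 -> R3, (forall i, `|xi i - p| <= `|x - p|) &
    F x - F p = \sum_(i < 3) (x 0 i - p 0 i) * partial i F (xi i).
Proof.
move=> dF; pose h i := x 0 i - p 0 i.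
have hle i : `|h i| <= `|x - p| by have := coord_le_norm (x - p) i; rewrite !mxE.
pose e (i : 'I_3) : R3 := delta_mx 0 i.
have step y i : (forall t : R, `|t| <= `|h i| -> `|y + t *: e i - p| <= `|x - p|) ->
   exists2 xi, `|xi - p| <= `|x - p| & F (y + h i *: e i) - F y = h i * partial i F xi.
  move=> H; have [t th|c ch E] := @mvt_line _ _ F (e i) y (h i); first by apply: dF; exact: H.
  by exists (y + c *: e i); [exact: H|].
have nb (y : R3) : (forall i, `|y 0 i - p 0 i| <= `|x - p|) -> `|y - p| <= `|x - p|.
  by move=> H; apply/norm_rV3_leP => // i; rewrite !mxE.
have [x0 n0 E0] : exists2 xi, `|xi - p| <= `|x - p| &
    F (p + h 0 *: e 0) - F p = h 0 * partial 0 F xi.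
  apply: step => t th; apply: nb; apply: ord3_ind; rewrite !mxE /= ?mulr1 ?mulr0 ?addr0 ?subrr ?normr0 //.
  by rewrite addrAC subrr add0r (le_trans th).
have [x1 n1 E1] : exists2 xi, `|xi - p| <= `|x - p| &
    F (p + h 0 *: e 0 + h 1 *: e 1) - F (p + h 0 *: e 0) = h 1 * partial 1 F xi.
  apply: step => t th; apply: nb; apply: ord3_ind; rewrite !mxE /= ?mulr1 ?mulr0 ?addr0 ?subrr ?normr0 //.
  - by rewrite addrAC subrr add0r hle.
  - by rewrite addrAC subrr add0r (le_trans th).
have [x2 n2 E2] : exists2 xi, `|xi - p| <= `|x - p| &
    F (p + h 0 *: e 0 + h 1 *: e 1 + h 2 *: e 2) - F (p + h 0 *: e 0 + h 1 *: e 1) = h 2 * partial 2 F xi.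
  apply: step => t th; apply: nb; apply: ord3_ind; rewrite !mxE /= ?mulr1 ?mulr0 ?addr0 ?subrr ?normr0 //.
  - by rewrite addrAC subrr add0r hle.
  - by rewrite addrAC subrr add0r hle.
  - by rewrite addrAC subrr add0r (le_trans th).
have Ex : p + h 0 *: e 0 + h 1 *: e 1 + h 2 *: e 2 = x.
  apply/rowP; apply: ord3_ind; rewrite !mxE /= ?mulr1 ?mulr0 ?addr0 /h; ring.
exists (fun i => if i == 0 then x0 else if i == 1 then x1 else x2).
  by move=> i; case: ifP => // _; case: ifP.
by rewrite sum3 -{1}Ex /= -E0 -E1 -E2; ring.
Qed.

End Coordinates.

(** * Functions smooth on an open set *)

Section Smooth.
Context {R : realType}.
Local Notation R3 := 'rV[R]_3.
Implicit Types (x y z p : R3) (F G : R3 -> R) (U : set R3) (s : seq 'I_3).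

Lemma iter_partial_rcons s i F : iter_partial (rcons s i) F = iter_partial s (partial i F).
Proof. by rewrite /iter_partial foldr_rcons. Qed.

Lemma iter_partial_cat s1 s2 F :
  iter_partial (s1 ++ s2) F = iter_partial s1 (iter_partial s2 F).
Proof. by rewrite /iter_partial foldr_cat. Qed.

Lemma near_open U (P : R3 -> Prop) x : open U -> U x -> (forall y, U y -> P y) -> \near x, P x.
Proof. by move=> oU Ux H; move: (open_nbhs_nbhs (conj oU Ux)); apply: filterS. Qed.

Lemma near_eq_continuous F G x : {near x, F =1 G} -> {for x, continuous F} -> {for x, continuous G}.
Proof.
move=> FG cF; have E : F x = G x := nbhs_singleton FG.
rewrite /prop_for /continuous_at -E.
exact: cvg_trans (near_eq_cvg FG) cF.
Qed.

Lemma partial_eq_on U F G i : open U -> {in U, F =1 G} -> {in U, partial i F =1 partial i G}.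
Proof.
move=> oU FG x /set_mem Ux; apply: near_eq_derive.
by apply: (near_open oU Ux) => y Uy; apply: FG; exact: mem_set.
Qed.

Lemma iter_partial_eq_on U F G s : open U -> {in U, F =1 G} ->
  {in U, iter_partial s F =1 iter_partial s G}.
Proof. by move=> oU FG; elim: s => //= i s IH; exact: partial_eq_on. Qed.

Lemma smooth_on_partial U F i : smooth_on U F -> smooth_on U (partial i F).
Proof. by move=> sF s x Ux; rewrite -iter_partial_rcons; exact: sF. Qed.

Lemma smooth_on_iter U F s : smooth_on U F -> smooth_on U (iter_partial s F).
Proof. by move=> sF; elim: s => [|i s IH]; [exact: sF|exact: smooth_on_partial IH]. Qed.

Lemma smooth_on_sub U U' F : U' `<=` U -> smooth_on U F -> smooth_on U' F.
Proof. by move=> UU sF s x /UU; exact: sF. Qed.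

Lemma smooth_on_continuous U F x : smooth_on U F -> U x -> {for x, continuous F}.
Proof. by move=> sF /(sF [::])[]. Qed.

Lemma smooth_on_derivable U F x i : smooth_on U F -> U x -> derivable F x (delta_mx 0 i).
Proof. by move=> sF /(sF [::])[]. Qed.

(** [smooth_on] is the largest class of [C^1] functions stable under partial
derivatives: a class [P] of functions of class [C^1] whose partial derivatives agree on
[U] with members of [P] consists of smooth functions. *)
Lemma smooth_on_coind U (P : (R3 -> R) -> Prop) : open U ->
  (forall F x, P F -> U x -> {for x, continuous F} /\ forall i, derivable F x (delta_mx 0 i)) ->
  (forall F i, P F -> exists2 G, P G & {in U, partial i F =1 G}) ->
  forall F, P F -> smooth_on U F.
Proof.
move=> oU P0 P1 F PF s; elim/last_ind: s F PF => [|s i IH] F PF x Ux; first exact: P0.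
have [G PG FG] := P1 F i PF; rewrite iter_partial_rcons.
have eG : {near x, iter_partial s G =1 iter_partial s (partial i F)}.
  by apply: (near_open oU Ux) => y Uy; rewrite -(iter_partial_eq_on _ oU FG) // mem_set.
have [cG dG] := IH G PG x Ux; split=> [|j]; last exact: near_eq_derivable eG (dG j).
exact: near_eq_continuous eG cG.
Qed.

(** The Leibniz rule does not keep products inside the set of products, so the class to
which [smooth_on_coind] applies is the whole algebra generated by smooth functions. *)
Inductive smooth_alg U : (R3 -> R) -> Prop :=
| smooth_alg_leaf F : smooth_on U F -> smooth_alg U F
| smooth_alg_add F G : smooth_alg U F -> smooth_alg U G -> smooth_alg U (fun x => F x + G x)
| smooth_alg_mul F G : smooth_alg U F -> smooth_alg U G -> smooth_alg U (fun x => F x * G x).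

Lemma partialD F G x i : derivable F x (delta_mx 0 i) -> derivable G x (delta_mx 0 i) ->
  partial i (fun x => F x + G x) x = partial i F x + partial i G x.
Proof. exact: deriveD. Qed.

Lemma partialM F G x i : derivable F x (delta_mx 0 i) -> derivable G x (delta_mx 0 i) ->
  partial i (fun x => F x * G x) x = partial i F x * G x + F x * partial i G x.
Proof.
move=> dF dG; rewrite [LHS](deriveM dF dG) addrC; congr (_ + _); exact: mulrC.
Qed.

Lemma smooth_alg_on U F : open U -> smooth_alg U F -> smooth_on U F.
Proof.
move=> oU; apply: smooth_on_coind => // {}F.
  move=> x HF Ux; elim: HF => {F} [F sF|F G _ [cF dF] _ [cG dG]|F G _ [cF dF] _ [cG dG]].
  - exact: (sF [::]).
  - by split=> [|i]; [exact: continuousD|exact: derivableD].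
  - by split=> [|i]; [exact: continuousM|exact: derivableM].
move=> i HF.
have dA G : smooth_alg U G -> forall x, U x -> derivable G x (delta_mx 0 i).
  move=> HG x Ux; elim: HG => {G} [G sG|G H _ dG _ dH|G H _ dG _ dH].
  - exact: smooth_on_derivable sG Ux.
  - exact: derivableD.
  - exact: (derivableM dG dH).
elim: HF => {F} [F sF|F G aF [F' aF' EF] aG [G' aG' EG]|F G aF [F' aF' EF] aG [G' aG' EG]].
- by exists (partial i F) => //; apply: smooth_alg_leaf; exact: smooth_on_partial.
- exists (fun x => F' x + G' x); first exact: smooth_alg_add.
  by move=> x Ux; rewrite partialD ?EF ?EG //; apply: dA => //; exact: set_mem.
- exists (fun x => F' x * G x + F x * G' x).
    by apply: smooth_alg_add; apply: smooth_alg_mul.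
  by move=> x Ux; rewrite partialM ?EF ?EG //; apply: dA => //; exact: set_mem.
Qed.

Lemma smooth_onD U F G : open U -> smooth_on U F -> smooth_on U G ->
  smooth_on U (fun x => F x + G x).
Proof. by move=> oU sF sG; apply: smooth_alg_on => //; apply: smooth_alg_add; exact: smooth_alg_leaf. Qed.

Lemma smooth_onM U F G : open U -> smooth_on U F -> smooth_on U G ->
  smooth_on U (fun x => F x * G x).
Proof. by move=> oU sF sG; apply: smooth_alg_on => //; apply: smooth_alg_mul; exact: smooth_alg_leaf. Qed.

Lemma smooth_on_eq U F G : open U -> {in U, F =1 G} -> smooth_on U F -> smooth_on U G.
Proof.
move=> oU FG sF; pose P H := H = G \/ smooth_on U H.
apply: (@smooth_on_coind U P) => //; last by left.
  move=> H x [->|sH] Ux; last by split=> [|i]; [exact: smooth_on_continuous sH _|exact: smooth_on_derivable sH _].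
  have nFG : {near x, F =1 G} by apply: (near_open oU Ux) => y Uy; apply: FG; exact: mem_set.
  split=> [|i]; last by apply: near_eq_derivable nFG _; exact: smooth_on_derivable sF Ux.
  by apply: near_eq_continuous nFG _; exact: smooth_on_continuous sF Ux.
move=> H i [->|sH]; last by exists (partial i H) => //; right; exact: smooth_on_partial.
exists (partial i F); first by right; exact: smooth_on_partial.
by move=> x Ux; apply/esym; exact: partial_eq_on Ux.
Qed.

Lemma partial_cst (a : R) i : partial i (fun=> a) = (fun _ : R3 => 0).
Proof. by apply/funext => x; exact: derive_cst. Qed.

Lemma smooth_on_cst U (a : R) : open U -> smooth_on U (fun=> a).
Proof.
move=> oU; pose P F := exists a : R, F = (fun _ : R3 => a).
apply: (@smooth_on_coind U P) => //; last by exists a.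
  by move=> F x [b ->] _; split=> [|i]; [exact: cst_continuous|exact: derivable_cst].
by move=> F i [b ->]; exists (fun=> 0); [exists 0|rewrite partial_cst].
Qed.

Lemma is_derive_coord x v (i : 'I_3) : is_derive x v (fun y : R3 => y 0 i) (v 0 i).
Proof.
have E : (fun h : R => h^-1 *: ((h *: v + x) 0 i - x 0 i)) @ 0^' --> v 0 i.
  apply: cvg_near_cst; near=> h; rewrite !mxE addrK [LHS]mulKf //.
  by near: h; exact: nbhs_dnbhs_neq.
by apply: DeriveDef; [apply/cvg_ex; exists (v 0 i)|exact: cvg_lim E].
Unshelve. all: by end_near. Qed.

Lemma partial_coord (i j : 'I_3) : partial i (fun y : R3 => y 0 j) = fun=> (i == j)%:R.
Proof.
apply/funext => x; have [_] := is_derive_coord x (delta_mx 0 i) j.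
by rewrite /partial => ->; rewrite mxE eqxx eq_sym.
Qed.

Lemma smooth_on_coord U (i : 'I_3) : open U -> smooth_on U (fun y : R3 => y 0 i).
Proof.
move=> oU; pose P (F : R3 -> R) := F = (fun y : R3 => y 0 i) \/ smooth_on U F.
apply: (@smooth_on_coind U P) => //; last by left.
  move=> F x [->|sF] Ux; last by split=> [|j]; [exact: smooth_on_continuous sF _|exact: smooth_on_derivable sF _].
  by split=> [|j]; [exact: coord_continuous|case: (is_derive_coord x (delta_mx 0 j) i)].
move=> F j [->|sF]; last by exists (partial j F) => //; right; exact: smooth_on_partial.
by exists (fun=> (j == i)%:R); [right; exact: smooth_on_cst|rewrite partial_coord].
Qed.

Lemma smooth_onZ U (a : R) F : open U -> smooth_on U F -> smooth_on U (fun x => a * F x).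
Proof. by move=> oU; apply: smooth_onM oU (smooth_on_cst a oU). Qed.

Lemma smooth_on_sum U (I : Type) (r : seq I) (F : I -> R3 -> R) : open U ->
  (forall i, smooth_on U (F i)) -> smooth_on U (fun x => \sum_(i <- r) F i x).
Proof.
move=> oU sF; elim: r => [|i r IH].
  rewrite (_ : (fun x => _) = fun=> 0); last by apply/funext => x; rewrite big_nil.
  exact: smooth_on_cst.
rewrite (_ : (fun x => _) = fun x => F i x + \sum_(j <- r) F j x).
  by apply: smooth_onD oU (sF i) IH.
by apply/funext => x; rewrite big_cons.
Qed.

Lemma partialZ (a : R) F x i : derivable F x (delta_mx 0 i) ->
  partial i (fun x => a * F x) x = a * partial i F x.
Proof.
by move=> dF; rewrite (partialM (derivable_cst a x _) dF) partial_cst mul0r add0r.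
Qed.

Lemma partial_sum (I : Type) (r : seq I) (F : I -> R3 -> R) x i :
  (forall j, derivable (F j) x (delta_mx 0 i)) ->
  derivable (fun x => \sum_(j <- r) F j x) x (delta_mx 0 i) /\
  partial i (fun x => \sum_(j <- r) F j x) x = \sum_(j <- r) partial i (F j) x.
Proof.
move=> dF; elim: r => [|j r [dI IH]].
  rewrite (_ : (fun x => _) = fun=> 0); last by apply/funext => y; rewrite big_nil.
  by rewrite partial_cst big_nil; split=> //; exact: derivable_cst.
rewrite (_ : (fun x => _) = fun x => F j x + \sum_(j <- r) F j x); last first.
  by apply/funext => y; rewrite big_cons.
split; first exact: (derivableD (dF j) dI).
by rewrite big_cons (partialD (dF j) dI) IH.
Qed.

Lemma near_closed_ball x (P : R3 -> Prop) : (\forall y \near x, P y) ->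
  exists2 d : R, 0 < d & forall y, `|y - x| <= d -> P y.
Proof.
move=> /nbhs_normP[e /= e0 He]; exists (e / 2); first by rewrite divr_gt0.
move=> y yx; apply: He => /=; rewrite distrC (le_lt_trans yx) //.
by rewrite ltr_pdivrMr // mulr_natr mulr2n ltrDl.
Qed.

Lemma open_ball_norm U x : open U -> U x ->
  exists2 d : R, 0 < d & forall y, `|y - x| <= d -> U y.
Proof. by move=> oU Ux; apply: near_closed_ball; exact: (near_open oU Ux). Qed.

Lemma norm_delta i : `|delta_mx 0 i : R3| <= 1.
Proof. by apply/norm_rV3_leP => // j; rewrite mxE /=; case: eqP; rewrite ?normr1 ?normr0 ?ler01. Qed.

Lemma is_derive_shift_arg F v w x d : is_derive (x + w) v F d ->
  is_derive x v (fun y => F (y + w)) d.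
Proof.
move=> [dF <-]; have E : (fun h : R => h^-1 *: (F (h *: v + (x + w)) - F (x + w)))
   = (fun h : R => h^-1 *: (F (h *: v + x + w) - F (x + w))).
  by apply/funext => h; rewrite addrA.
apply: DeriveDef.
  by move: dF; rewrite /derivable E.
by rewrite /derive /= E.
Qed.

(** Two applications of the mean value theorem, first to the increment [F (y + h e_j) -
F y] along [e_i], then to [partial i F] along [e_j]. *)
Lemma second_difference F i j x (h : R) U : smooth_on U F ->
  (forall y, `|y - x| <= 2 * `|h| -> U y) ->
  exists2 y, `|y - x| <= 2 * `|h| &
    F (x + h *: delta_mx 0 i + h *: delta_mx 0 j) - F (x + h *: delta_mx 0 i)
      - (F (x + h *: delta_mx 0 j) - F x) = h * h * partial j (partial i F) y.
Proof.
move=> sF BU; pose ei : R3 := delta_mx 0 i; pose ej : R3 := delta_mx 0 j.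
have near2 (a b : R) : `|a| <= `|h| -> `|b| <= `|h| -> `|x + a *: ei + b *: ej - x| <= 2 * `|h|.
  move=> ah bh; rewrite addrAC [x + _]addrC addrK mulr2n mulrDl mul1r.
  rewrite (le_trans (ler_normD _ _)) // !normrZ lerD //.
    by rewrite (le_trans (ler_piMr _ (norm_delta _))).
  by rewrite (le_trans (ler_piMr _ (norm_delta _))).
have h0 : `|0 : R| <= `|h| by rewrite normr0.
pose A y := F (y + h *: ej) - F y.
have dA (t : R) : `|t| <= `|h| -> is_derive (x + t *: ei) ei A
   (partial i F (x + t *: ei + h *: ej) - partial i F (x + t *: ei)).
  move=> th; apply: is_deriveB.
    apply: is_derive_shift_arg; apply: derivableP.
    by apply: smooth_on_derivable sF _; apply: BU; exact: near2.
  apply: derivableP; apply: smooth_on_derivable sF _; apply: BU.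
  by have := near2 t 0 th h0; rewrite scale0r addr0.
have [t th|c ch E] := @mvt_line _ _ A ei x h; first by case: (dA t th).
have [_ EA] := dA c ch; rewrite EA in E.
have [t th|b bh E'] := @mvt_line _ _ (partial i F) ej (x + c *: ei) h.
  apply: smooth_on_derivable (smooth_on_partial i sF) _.
  by apply: BU; exact: near2.
exists (x + c *: ei + b *: ej); first exact: near2.
by rewrite -mulrA -E' -E.
Qed.

Lemma swap4 (a b c d : R) : a - b - (c - d) = a - c - (b - d).
Proof. by ring. Qed.

Lemma half_triangle (a b c e : R) : `|a - c| <= e / 2 -> `|b - c| <= e / 2 -> `|a - b| <= e.
Proof.
move=> ac bc; rewrite (splitr e) -[a - b](subrKA c) -[c - b]opprB.
by rewrite (le_trans (ler_normB _ _)) // lerD.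
Qed.

(** The second difference is symmetric in [i] and [j], so both mixed derivatives take a
common value at points arbitrarily close to [x]. *)
Lemma partialC U F i j : open U -> smooth_on U F ->
  {in U, partial i (partial j F) =1 partial j (partial i F)}.
Proof.
move=> oU sF x /set_mem Ux; apply/eqP; rewrite -subr_eq0 -normr_le0.
apply/ler_addgt0Pl => e e0; rewrite addr0.
have cont k l : {for x, continuous (partial k (partial l F))}.
  by apply: smooth_on_continuous Ux; do 2 apply: smooth_on_partial.
have e2 : 0 < e / 2 by rewrite divr_gt0.
have near1 k l : exists2 d : R, 0 < d & forall y, `|y - x| <= d ->
    `|partial k (partial l F) x - partial k (partial l F) y| <= e / 2.
  by have /cvgrPdist_le/(_ _ e2)/near_closed_ball := cont k l.
have [d d0 Bd] := open_ball_norm oU Ux.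
have [d1 d10 H1] := near1 i j; have [d2 d20 H2] := near1 j i.
pose m := Num.min d (Num.min d1 d2).
have m0 : 0 < m by rewrite !lt_min d0 d10 d20.
pose h := m / 2; have h0 : 0 < h by rewrite divr_gt0.
have hm : 2 * `|h| = m by rewrite gtr0_norm // /h mulrC divfK.
have BU y : `|y - x| <= 2 * `|h| -> U y.
  by rewrite hm => yx; apply: Bd; rewrite (le_trans yx) // ge_min lexx.
have [y yx Ey] := @second_difference F i j x h U sF BU.
have [z zx Ez] := @second_difference F j i x h U sF BU.
have Eyz : partial j (partial i F) y = partial i (partial j F) z.
  have hh : h * h != 0 by rewrite mulf_neq0 ?gt_eqF.
  apply: (mulfI hh); rewrite -[LHS]Ey -[RHS]Ez.
  rewrite (_ : x + h *: delta_mx 0 j + h *: delta_mx 0 i =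
               x + h *: delta_mx 0 i + h *: delta_mx 0 j); last by rewrite addrAC.
  exact: swap4.
have Hz := H1 z; have Hy := H2 y.
rewrite hm in yx zx; rewrite Eyz in Hy.
apply: (@half_triangle _ _ (partial i (partial j F) z)); [apply: Hz|apply: Hy].
  by apply: (le_trans zx); rewrite !ge_min lexx orbT.
by apply: (le_trans yx); rewrite !ge_min lexx !orbT.
Qed.

End Smooth.

(** * Vanishing of the derivatives of a given order *)

Section Taylor.
Context {R : realType}.
Local Notation R3 := 'rV[R]_3.
Implicit Types (x y z p : R3) (F G : R3 -> R) (U : set R3) (s : seq 'I_3).

Lemma big_tuple_cons (I : finType) k (a : seq I -> R) :
  \sum_(t : k.+1.-tuple I) a t = \sum_(i : I) \sum_(t : k.-tuple I) a (i :: t).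
Proof.
rewrite pair_big /=.
rewrite (reindex (fun q : I * k.-tuple I => [tuple of q.1 :: q.2])) //=.
exists (fun t : k.+1.-tuple I => (thead t, [tuple of behead t])).
  by move=> [i t] _ /=; congr (_, _); apply/val_inj.
by move=> t _; rewrite -tuple_eta.
Qed.

(** The polynomial [sum c(i_1,...,i_k) h_{i_1} ... h_{i_k}], in the nested form that
suits induction on the degree. *)
Fixpoint symform (k : nat) (c : seq 'I_3 -> R) (h : R3) : R :=
  if k is k'.+1 then \sum_(i < 3) h 0 i * symform k' (fun s => c (i :: s)) h else c [::].

Lemma symformE k c h :
  symform k c h = \sum_(t : k.-tuple 'I_3) c t * \prod_(i <- t) h 0 i.
Proof.
elim: k c => [|k IH] c /=.
  rewrite (big_pred1 [tuple]) /= ?big_nil ?mulr1 //.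
  by move=> t; rewrite [t]tuple0 [RHS]eqxx.
rewrite (big_tuple_cons k (fun t => c t * \prod_(i <- t) h 0 i)).
apply: eq_bigr => i _; rewrite IH big_distrr /=; apply: eq_bigr => t _.
by rewrite big_cons mulrCA.
Qed.

Definition swap_invariant (c : seq 'I_3 -> R) :=
  forall s1 i j s2, c (s1 ++ [:: i, j & s2]) = c (s1 ++ [:: j, i & s2]).

Lemma eq_symform k c c' h : c =1 c' -> symform k c h = symform k c' h.
Proof.
elim: k c c' => [|k IH] c c' E /=; first exact: E.
by apply: eq_bigr => i _; congr (_ * _); apply: IH => s; exact: E.
Qed.

Lemma is_derive_symform k c x j : swap_invariant c ->
  is_derive x (delta_mx 0 j : R3) (symform k.+1 c) (k.+1%:R * symform k (fun s => c (j :: s)) x).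
Proof.
elim: k c => [|k IH] c sc.
  have E : symform 1 c = \sum_(i < 3) (fun h : R3 => h 0 i * c [:: i]).
    by apply/funext => h; rewrite fct_sumE.
  rewrite E; apply: is_derive_eq.
    by apply: is_derive_sum => i; apply: is_deriveM; exact: is_derive_coord.
  rewrite /= (bigD1 j) //= big1 => [|i /negPf ij].
    by rewrite mxE !eqxx scaler0 add0r addr0 mul1r [_ *: _]mulr1.
  by rewrite mxE eqxx ij scaler0 add0r [_ *: _]mulr0.
have E : symform k.+2 c = \sum_(i < 3) (fun h : R3 => h 0 i * symform k.+1 (fun s => c (i :: s)) h).
  by apply/funext => h; rewrite fct_sumE.
rewrite E; apply: is_derive_eq.
  apply: is_derive_sum => i; apply: is_deriveM; first exact: is_derive_coord.
  by apply: IH => s1 a b s2; exact: (sc (i :: s1)).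
rewrite big_split /= addrC [X in X + _](bigD1 j) //= [X in _ + X + _]big1 => [|i /negPf ij]; last first.
  by rewrite mxE eqxx ij [_ *: _]mulr0.
rewrite mxE !eqxx addr0 [_ *: _]mulr1 -[k.+2]add1n natrD mulrDl mul1r; congr (_ + _).
rewrite mulr_sumr; apply: eq_bigr => i _ /=.
rewrite [_ *: _]mulrCA; congr (_ * (_ * _)).
by apply: eq_symform => s; exact: (sc [::]).
Qed.

(** Differentiating along [e_j] turns a form of degree [k.+1] with symmetric
coefficients into the form of degree [k] with coefficients [c (j :: s)], up to the
factor [k.+1]; hence a form that vanishes identically has no nonzero coefficient. *)
Lemma symform_eq0 k c : swap_invariant c -> (forall h, symform k c h = 0) ->
  forall s, size s = k -> c s = 0.
Proof.
elim: k c => [|k IH] c sc H s; first by move/size0nil => ->; exact: (H 0).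
case: s => // j s [sk].
apply: (IH (fun s => c (j :: s))) => // [s1 a b s2|h]; first exact: (sc (j :: s1)).
have [_] := is_derive_symform k h j sc.
have -> : symform k.+1 c = cst 0 by apply/funext => y; exact: H.
by rewrite derive_cst => /esym/eqP; rewrite mulf_eq0 pnatr_eq0 => /eqP.
Qed.

Definition vanish (k : nat) p F := forall s, size s = k -> iter_partial s F p = 0.

Lemma taylor_term_vanish k p F : smooth_on setT F ->
  (forall h, taylor_term F p k h = 0) -> vanish k p F.
Proof.
move=> sF H; apply: (@symform_eq0 k (fun s => iter_partial s F p)) => [s1 i j s2|h].
  rewrite !iter_partial_cat; apply: (iter_partial_eq_on _ openT) (in_setT p).
  exact: (partialC i j openT (smooth_on_iter s2 sF)).
rewrite symformE; have /eqP := H h; rewrite /taylor_term mulf_eq0 invr_eq0 pnatr_eq0.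
by rewrite eqn0Ngt fact_gt0 => /eqP.
Qed.

Lemma vanishS k p F : vanish k.+1 p F <-> forall i, vanish k p (partial i F).
Proof.
split=> [H i s sk|H s].
  by rewrite -iter_partial_rcons; apply: H; rewrite size_rcons sk.
case/lastP: s => // s i; rewrite size_rcons => -[sk].
by rewrite iter_partial_rcons; exact: H.
Qed.

Lemma vanish0 p F : vanish 0 p F <-> F p = 0.
Proof. by split=> [H|Fp [|//] _]; [exact: (H [::])|]. Qed.

Lemma vanish_eq_on U k p F G : open U -> U p -> {in U, F =1 G} -> vanish k p F -> vanish k p G.
Proof. by move=> oU Up E H s sk; rewrite -(iter_partial_eq_on _ oU E) ?H // mem_set. Qed.

Lemma vanishD U k p F G : open U -> U p -> smooth_on U F -> smooth_on U G ->
  vanish k p F -> vanish k p G -> vanish k p (fun x => F x + G x).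
Proof.
move=> oU Up; elim: k F G => [|k IH] F G sF sG.
  by move=> /vanish0 F0 /vanish0 G0; apply/vanish0; rewrite F0 G0 addr0.
move=> /vanishS HF /vanishS HG; apply/vanishS => i.
apply: (@vanish_eq_on U k p (fun x => partial i F x + partial i G x)) => //.
  move=> x /set_mem Ux; apply/esym/partialD; [exact: smooth_on_derivable sF Ux|exact: smooth_on_derivable sG Ux].
by apply: IH; [exact: smooth_on_partial|exact: smooth_on_partial|exact: HF|exact: HG].
Qed.

Lemma vanish_cst0 k p : vanish k p (fun=> 0).
Proof.
elim: k => [|k IH]; first exact/vanish0.
by apply/vanishS => i; rewrite partial_cst.
Qed.

(** By the Leibniz rule the derivatives of order [k] of the product are combinations of
products of a derivative of [F] of order [i] and one of [G] of order [j] with [i + j =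
k]. The hypothesis is stated for each pair, as gaps in the Taylor series (no terms of
degree three or five) matter later on. *)
Lemma vanishM U k p F G : open U -> U p -> smooth_on U F -> smooth_on U G ->
  (forall i j, (i + j = k)%N -> vanish i p F \/ vanish j p G) ->
  vanish k p (fun x => F x * G x).
Proof.
move=> oU Up; elim: k F G => [|k IH] F G sF sG H.
  apply/vanish0; case: (H 0 0)%N => // /vanish0 ->; rewrite ?mul0r ?mulr0 //.
apply/vanishS => i.
apply: (@vanish_eq_on U k p (fun x => partial i F x * G x + F x * partial i G x)) => //.
  move=> x /set_mem Ux; apply/esym/partialM; [exact: smooth_on_derivable sF Ux|exact: smooth_on_derivable sG Ux].
have sF' := smooth_on_partial i sF; have sG' := smooth_on_partial i sG.
apply: (vanishD oU Up); [exact: smooth_onM|exact: smooth_onM| |].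
- apply: IH => // a b ab; case: (H a.+1 b); first by rewrite addSn ab.
    by move/vanishS; left.
  by right.
- apply: IH => // a b ab; case: (H a b.+1); first by rewrite addnS ab.
    by left.
  by move/vanishS; right.
Qed.

Lemma vanishZ U k p a F : open U -> U p -> smooth_on U F ->
  vanish k p F -> vanish k p (fun x => a * F x).
Proof.
move=> oU Up sF H; apply: (vanishM oU Up (smooth_on_cst a oU) sF) => -[|i] j ij.
  by right; rewrite -ij in H.
by left; apply/vanishS => l; rewrite partial_cst; exact: vanish_cst0.
Qed.

Lemma vanish_sum U k p (I : Type) (r : seq I) (F : I -> R3 -> R) : open U -> U p ->
  (forall i, smooth_on U (F i)) -> (forall i, vanish k p (F i)) ->
  vanish k p (fun x => \sum_(i <- r) F i x).
Proof.
move=> oU Up sF vF; elim: r => [|i r IH].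
  rewrite (_ : (fun x => _) = fun=> 0); last by apply/funext => x; rewrite big_nil.
  exact: vanish_cst0.
rewrite (_ : (fun x => _) = fun x => F i x + \sum_(j <- r) F j x); last by apply/funext => x; rewrite big_cons.
exact: (vanishD oU Up (sF i) (smooth_on_sum r oU sF) (vF i) IH).
Qed.

Definition bigO p N F := exists C : R, exists2 d : R, 0 < d &
  0 <= C /\ forall x, `|x - p| <= d -> `|F x| <= C * `|x - p| ^+ N.

Lemma continuous_bigO p F : {for p, continuous F} -> bigO p 0 F.
Proof.
move=> /cvgrPdist_le/(_ 1 ltr01)/near_closed_ball[d d0 Hd].
exists (`|F p| + 1), d => //; split=> [|x xp]; first by rewrite addr_ge0.
by rewrite expr0 mulr1 -[F x](subKr (F p)) (le_trans (ler_normB _ _)) // lerD2l Hd.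
Qed.

(** Induction on [N]: by the mean value theorem [F x] is a combination of the
coordinates of [x - p] with coefficients the partial derivatives of [F] at nearby
points, and these are [O(N)] by induction. *)
Lemma vanish_bigO U p F N : open U -> U p -> smooth_on U F ->
  (forall k, (k < N)%N -> vanish k p F) -> bigO p N F.
Proof.
move=> oU Up; elim: N F => [|N IH] F sF vF.
  exact: (continuous_bigO (smooth_on_continuous sF Up)).
have H i : bigO p N (partial i F).
  by apply: IH; [exact: smooth_on_partial|move=> k kN; move: i; apply/vanishS; exact: vF].
have Fp : F p = 0 by apply/vanish0; exact: vF.
have [C0 [d0 d00 [C00 H0]]] := H 0; have [C1 [d1 d10 [C10 H1]]] := H 1.
have [C2 [d2 d20 [C20 H2]]] := H 2.
have [d d00' Bd] := open_ball_norm oU Up.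
exists (C0 + C1 + C2), (Num.min d (Num.min d0 (Num.min d1 d2))).
  by rewrite !lt_min d00' d00 d10 d20.
split; first by rewrite !addr_ge0.
move=> x; rewrite !le_min => /and4P[xd xd0 xd1 xd2].
have [y yx i|xi Hxi] := @mvt_coord R F p x.
  by apply: smooth_on_derivable sF _; apply: Bd; apply: le_trans xd.
rewrite Fp subr0 sum3 => ->.
have B (i : 'I_3) C dd : `|x - p| <= dd -> 0 <= C ->
    (forall x, `|x - p| <= dd -> `|partial i F x| <= C * `|x - p| ^+ N) ->
    `|(x 0 i - p 0 i) * partial i F (xi i)| <= C * `|x - p| ^+ N.+1.
  move=> xdd C0' HC; rewrite normrM exprS mulrCA ler_pM //.
    by have := coord_le_norm (x - p) i; rewrite !mxE.
  apply: le_trans (HC _ (le_trans (Hxi i) xdd)) _.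
  by rewrite ler_wpM2l // lerXn2r // nnegrE.
rewrite [leRHS]mulrDl [(C0 + C1) * _]mulrDl.
apply: le_trans (ler_normD _ _) _; apply: lerD; last exact: (B _ _ _ xd2 C20 H2).
apply: le_trans (ler_normD _ _) _; apply: lerD; [exact: (B _ _ _ xd0 C00 H0)|exact: (B _ _ _ xd1 C10 H1)].
Qed.

(** The term ['d F p] is a default value where [F] is not differentiable, so it has to
be shown first that a smooth function is differentiable, with differential the linear
form [L] built from the partial derivatives. *)
Lemma diff_eq0_partial F p i : smooth_on setT F -> (forall h, 'd F p h = 0) -> partial i F p = 0.
Proof.
move=> sF d0; pose L (h : R3) := \sum_(j < 3) h 0 j * partial j F p.
have linL : linear L.
  move=> a u v; rewrite /L /= scaler_sumr -big_split /=; apply: eq_bigr => j _.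
  by rewrite !mxE mulrDl -mulrA.
pose L' : {linear R3 -> R} := HB.pack L (GRing.isLinear.Build _ _ _ _ L linL).
have cL : continuous L.
  move=> x; apply: (smooth_on_continuous _ (I : setT x)).
  apply: (smooth_on_sum _ openT) => j; apply: (smooth_onM openT (smooth_on_coord j openT)).
  exact: (smooth_on_cst _ openT).
have : 'd F p = L' :> (R3 -> R).
  apply: diff_unique => //; apply/eqaddoP => e e0.
  have e3 : 0 < e / 3 by rewrite divr_gt0.
  have near1 j : exists2 d : R, 0 < d & forall y, `|y - p| <= d ->
      `|partial j F p - partial j F y| <= e / 3.
    by have /cvgrPdist_le/(_ _ e3)/near_closed_ball := smooth_on_continuous (smooth_on_partial j sF) (I : setT p).
  have [a a0 H0] := near1 0; have [b b0 H1] := near1 1; have [c c0 H2] := near1 2.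
  have nm : \forall h \near (0 : R3), `|h| <= Num.min a (Num.min b c).
    by apply: nbhs0_le; rewrite !lt_min a0 b0 c0.
  near=> h.
  have hm : `|h| <= Num.min a (Num.min b c).
    near: h; exact: nm.
  rewrite !le_min in hm; case/and3P: hm => ha hb hc.
  have [y _ j|xi Hxi E] := @mvt_coord R F p (h + p).
    exact: smooth_on_derivable sF I.
  rewrite addrK in Hxi.
  have B j d : `|h| <= d -> (forall y, `|y - p| <= d -> `|partial j F p - partial j F y| <= e / 3) ->
     `|h 0 j * partial j F (xi j) - h 0 j * partial j F p| <= e / 3 * `|h|.
    move=> hd H; rewrite -mulrBr normrM mulrC ler_pM // ?coord_le_norm //.
    by rewrite distrC H // (le_trans (Hxi j)).
  rewrite [X in `|X|](_ : _ = (F (h + p) - F p) - L h); last first.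
    by rewrite /= !fctE /= opprD addrA.
  rewrite E /L !sum3 !mxE !addrK.
  rewrite [X in `|X|](_ : _ = (h 0 0 * partial 0 F (xi 0) - h 0 0 * partial 0 F p) +
    (h 0 1 * partial 1 F (xi 1) - h 0 1 * partial 1 F p) +
    (h 0 2 * partial 2 F (xi 2) - h 0 2 * partial 2 F p)); last by ring.
  have -> : e * `|h| = e / 3 * `|h| + e / 3 * `|h| + e / 3 * `|h| by field.
  apply: le_trans (ler_normD _ _) _; apply: lerD; last exact: (B _ _ hc H2).
  by apply: le_trans (ler_normD _ _) _; apply: lerD; [exact: (B _ _ ha H0)|exact: (B _ _ hb H1)].
move=> /(congr1 (fun g => g (delta_mx 0 i))); rewrite d0 /= /L (bigD1 i) //= big1 => [|j /negPf ji].
  by rewrite mxE !eqxx mul1r addr0.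
by rewrite mxE eqxx ji mul0r.
Unshelve. all: by end_near. Qed.

End Taylor.

(** * Diagonalization of a symmetric matrix of order three *)

Section Diagonalization.
Context {R : realType}.
Local Notation R3 := 'rV[R]_3.
Implicit Types (x y z u v q : R3).

Definition dot x y : R := \sum_(i < 3) x 0 i * y 0 i.
Definition form (H : 'M[R]_3) x y : R := \sum_(i < 3) \sum_(j < 3) x 0 i * y 0 j * H i j.

Lemma dotE x y : dot x y = x 0 0 * y 0 0 + x 0 1 * y 0 1 + x 0 2 * y 0 2.
Proof. exact: sum3. Qed.

Lemma formE H x y : form H x y =
  x 0 0 * y 0 0 * H 0 0 + x 0 0 * y 0 1 * H 0 1 + x 0 0 * y 0 2 * H 0 2 +
  (x 0 1 * y 0 0 * H 1 0 + x 0 1 * y 0 1 * H 1 1 + x 0 1 * y 0 2 * H 1 2) +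
  (x 0 2 * y 0 0 * H 2 0 + x 0 2 * y 0 1 * H 2 1 + x 0 2 * y 0 2 * H 2 2).
Proof. by rewrite /form !sum3. Qed.

Lemma dot_ge0 x : 0 <= dot x x.
Proof. by apply: sumr_ge0 => i _; rewrite -expr2 sqr_ge0. Qed.

Lemma dot_continuous : continuous (fun x => dot x x).
Proof.
move=> x; apply: (smooth_on_continuous _ (I : setT x)); apply: (smooth_on_sum _ openT) => i.
exact: (smooth_onM openT (smooth_on_coord i openT) (smooth_on_coord i openT)).
Qed.

Lemma dotr_continuous q : continuous (fun x => dot x q).
Proof.
move=> x; apply: (smooth_on_continuous _ (I : setT x)); apply: (smooth_on_sum _ openT) => i.
exact: (smooth_onM openT (smooth_on_coord i openT) (smooth_on_cst _ openT)).
Qed.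

Lemma form_continuous H : continuous (fun x => form H x x).
Proof.
move=> x; apply: (smooth_on_continuous _ (I : setT x)).
do 2 (apply: (smooth_on_sum _ openT) => ?).
apply: (smooth_onM openT _ (smooth_on_cst _ openT)).
exact: (smooth_onM openT (smooth_on_coord _ openT) (smooth_on_coord _ openT)).
Qed.

(** First-order condition at a maximum: a linear term cannot be dominated by a quadratic
one near [0]. *)
Lemma quadratic_le0 (b c : R) : (forall t, t * b *+ 2 <= t ^+ 2 * c) -> b = 0.
Proof.
move=> H; have d0 : 0 < `|c| + 1 by rewrite ltr_wpDl.
have := H (b / (`|c| + 1)); rewrite -(ler_pM2r (exprn_gt0 2 d0)).
have -> : b / (`|c| + 1) * b *+ 2 * (`|c| + 1) ^+ 2 = b ^+ 2 * (`|c| + 1) *+ 2.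
  by rewrite -mulr_natr -[in RHS]mulr_natr; field; rewrite gt_eqF.
have -> : (b / (`|c| + 1)) ^+ 2 * c * (`|c| + 1) ^+ 2 = b ^+ 2 * c.
  by field; rewrite gt_eqF.
move=> K; apply/eqP; rewrite -sqrf_eq0 eq_le sqr_ge0 andbT leNgt; apply/negP => b0.
have : b ^+ 2 * c <= b ^+ 2 * `|c| by rewrite ler_pM2l // ler_norm.
have : 0 <= b ^+ 2 * `|c| by rewrite mulr_ge0 // ltW.
rewrite mulrDr mulr1 in K; lra.
Qed.

(** Maximize the form [H] over the unit vectors orthogonal to [q]. Moving the maximizer
[u] in a direction [y] orthogonal to [q] and [u] changes the form at first order by
[form H u y], which must therefore vanish. With [q = 0] this yields a first eigenvector,
with [q] that eigenvector a second one. *)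
Lemma sphere_maximizer (H : 'M[R]_3) q : H^T = H ->
  (exists v, dot v v = 1 /\ dot v q = 0) ->
  exists u, [/\ dot u u = 1, dot u q = 0 & forall y, dot y q = 0 -> dot y u = 0 -> form H u y = 0].
Proof.
move=> Hsym [v [v1 vq]]; pose A : set R3 := [set x | dot x x = 1] `&` [set x | dot x q = 0].
have A0 : A !=set0 by exists v.
have cA : compact A.
  apply: bounded_closed_compact.
    exists 1; split; first exact: num_real.
    move=> M M1 x [/= x1 _]; apply/norm_rV3_leP; first by rewrite (le_trans _ (ltW M1)).
    move=> i; rewrite (le_trans _ (ltW M1)) // -(expr_le1 (n := 2)) // real_normK ?num_real //.
    by rewrite -x1 /dot (bigD1 i) //= -expr2 lerDl sumr_ge0 // => j _; rewrite -expr2 sqr_ge0.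
  apply: closedI.
    exact: ((continuous_closedP _).1 dot_continuous _ (@closed_eq R 1)).
  exact: ((continuous_closedP _).1 (@dotr_continuous q) _ (@closed_eq R 0)).
have [u /set_mem [/= u1 uq] umax] := EVT_max_rV A0 cA (continuous_subspaceT (@form_continuous H)).
exists u; split=> // y yq yu; apply: (@quadratic_le0 _ (form H u u * dot y y - form H y y)) => t.
pose z := u + t *: y.
have zz : dot z z = 1 + t ^+ 2 * dot y y.
  rewrite -u1 -[LHS]subr0 -(mulr0 (t * 2)) -yu !dotE !mxE; ring.
have zpos : 0 < dot z z by rewrite zz ltr_pwDl // mulr_ge0 ?sqr_ge0 ?dot_ge0.
have zq : dot z q = 0 by rewrite -[RHS]addr0 -{1}uq -(mulr0 t) -yq !dotE !mxE; ring.
pose s := (Num.sqrt (dot z z))^-1.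
have s2 : s ^+ 2 * dot z z = 1 by rewrite exprVn sqr_sqrtr ?ltW // mulVf // gt_eqF.
have K : form H (s *: z) (s *: z) <= form H u u.
  apply: umax; rewrite inE; split=> /=.
    by rewrite -s2 !dotE !mxE; ring.
  by transitivity (s * dot z q); [rewrite !dotE !mxE; ring|rewrite zq mulr0].
have s2p : 0 < s ^+ 2 by rewrite exprn_gt0 // invr_gt0 sqrtr_gt0.
have {}K : form H z z <= form H u u * dot z z.
  rewrite -(ler_pM2l s2p) mulrCA s2 mulr1 (le_trans _ K) //.
  by rewrite le_eqVlt; apply/orP; left; apply/eqP; rewrite !formE !mxE; ring.
have E : form H z z = form H u u + t * form H u y *+ 2 + t ^+ 2 * form H y y.
  have h i j : H i j = H j i by rewrite -{1}Hsym mxE.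
  by rewrite !formE !mxE (h 1 0) (h 2 0) (h 2 1) -mulr_natr; ring.
move: K; rewrite E zz !mulr2n; lra.
Qed.

Lemma unit_orthogonal q : dot q q = 1 -> exists v, dot v v = 1 /\ dot v q = 0.
Proof.
move=> q1; pose w : R3 := \row_j (if j == 0 then - q 0 1 else if j == 1 then q 0 0 else 0).
have ww : dot w w = q 0 0 ^+ 2 + q 0 1 ^+ 2 by rewrite dotE !mxE /=; ring.
have [w0|w0] := eqVneq (dot w w) 0.
  have q0 : q 0 0 = 0.
    apply/eqP; rewrite -sqrf_eq0 eq_le sqr_ge0 andbT.
    by have := sqr_ge0 (q 0 1); rewrite ww in w0; lra.
  exists (delta_mx 0 0); rewrite !dotE !mxE /= q0; split; ring.
have wp : 0 < dot w w by rewrite lt_neqAle eq_sym w0 dot_ge0.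
pose s := (Num.sqrt (dot w w))^-1.
have s2 : s ^+ 2 * dot w w = 1 by rewrite exprVn sqr_sqrtr ?ltW // mulVf // gt_eqF.
exists (s *: w); split; first by rewrite -s2 !dotE !mxE; ring.
by rewrite !dotE !mxE /=; ring.
Qed.

Lemma ord3_01 : 0 + 1 = 1 :> 'I_3. Proof. exact/val_inj. Qed.
Lemma ord3_02 : 0 + 2 = 2 :> 'I_3. Proof. exact/val_inj. Qed.
Lemma ord3_11 : 1 + 1 = 2 :> 'I_3. Proof. exact/val_inj. Qed.
Lemma ord3_12 : 1 + 2 = 0 :> 'I_3. Proof. exact/val_inj. Qed.
Lemma ord3_21 : 2 + 1 = 0 :> 'I_3. Proof. exact/val_inj. Qed.
Lemma ord3_22 : 2 + 2 = 1 :> 'I_3. Proof. exact/val_inj. Qed.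

(** The rows of [Q] are two successive maximizers of the quadratic form and their cross
product; the cross product makes the frame positively oriented, which is what the second
clause says and what the curl needs in order to keep its form. *)
Lemma diagonalize (H : 'M[R]_3) : H^T = H ->
  exists (Q : 'M[R]_3) (lam : 'I_3 -> R),
  [/\ forall i k, \sum_(j < 3) Q i j * Q k j = (i == k)%:R,
      forall i j, Q (i + 1) (j + 1) * Q (i + 2) (j + 2) - Q (i + 1) (j + 2) * Q (i + 2) (j + 1) = Q i j &
      forall i k, \sum_(j < 3) \sum_(l < 3) Q i j * Q k l * H j l = lam k * (i == k)%:R].
Proof.
move=> Hsym.
have [|a [a1 _ amax]] := @sphere_maximizer H 0 Hsym.
  by exists (delta_mx 0 0); rewrite !dotE !mxE /=; split; ring.
have [b [b1 ba bmax]] := sphere_maximizer Hsym (unit_orthogonal a1).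
pose c : R3 := \row_j (a 0 (j + 1) * b 0 (j + 2) - a 0 (j + 2) * b 0 (j + 1)).
pose Q : 'M[R]_3 := \matrix_(i, j) (if i == 0 then a 0 j else if i == 1 then b 0 j else c 0 j).
have o3 := (ord3_01, ord3_02, ord3_11, ord3_12, ord3_21, ord3_22).
have c0 : c 0 0 = a 0 1 * b 0 2 - a 0 2 * b 0 1 by rewrite mxE !o3.
have cc1 : c 0 1 = a 0 2 * b 0 0 - a 0 0 * b 0 2 by rewrite mxE !o3.
have c2 : c 0 2 = a 0 0 * b 0 1 - a 0 1 * b 0 0 by rewrite mxE !o3.
have ca : dot c a = 0 by rewrite dotE c0 cc1 c2; ring.
have cb : dot c b = 0 by rewrite dotE c0 cc1 c2; ring.
have c1 : dot c c = 1.
  transitivity (dot a a * dot b b - dot b a * dot b a); last by rewrite a1 b1 ba; ring.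
  by rewrite !dotE c0 cc1 c2; ring.
have dotC x y : dot x y = dot y x by rewrite !dotE; ring.
have Q0 j : Q 0 j = a 0 j by rewrite mxE.
have Q1 j : Q 1 j = b 0 j by rewrite mxE.
have Q2 j : Q 2 j = c 0 j by rewrite mxE.
have h x y : form H x y = form H y x.
  have h i j : H i j = H j i by rewrite -{1}Hsym mxE.
  by rewrite !formE (h 1 0) (h 2 0) (h 2 1); ring.
have cross1 j : b 0 (j + 1) * c 0 (j + 2) - b 0 (j + 2) * c 0 (j + 1) = a 0 j.
  (* The triple product expansion [b x (a x b) = (b.b) a - (b.a) b]. *)
  transitivity (dot b b * a 0 j - dot b a * b 0 j); last by rewrite b1 ba mul1r mul0r subr0.
  by rewrite !dotE; move: j; apply: ord3_ind; rewrite !o3 ?c0 ?cc1 ?c2; ring.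
have cross2 j : c 0 (j + 1) * a 0 (j + 2) - c 0 (j + 2) * a 0 (j + 1) = b 0 j.
  transitivity (dot a a * b 0 j - dot b a * a 0 j); last by rewrite a1 ba mul1r mul0r subr0.
  by rewrite !dotE; move: j; apply: ord3_ind; rewrite !o3 ?c0 ?cc1 ?c2; ring.
have a00 : form H a b = 0 by apply: amax => //; rewrite !dotE !mxE; ring.
have ac0 : form H a c = 0 by apply: amax => //; rewrite !dotE !mxE; ring.
have bc0 : form H b c = 0 by apply: bmax.
exists Q, (fun i => form H (row i Q) (row i Q)); split.
- apply: ord3_ind; apply: ord3_ind; under eq_bigr do rewrite ?Q0 ?Q1 ?Q2;
  rewrite -[LHS]/(dot _ _) /= ?a1 ?b1 ?c1 ?ba ?ca ?cb // dotC //.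
- apply: ord3_ind => j; rewrite !o3 ?Q0 ?Q1 ?Q2 //.
  by move: j; apply: ord3_ind; rewrite !o3.
- have E i k : \sum_(j < 3) \sum_(l < 3) Q i j * Q k l * H j l = form H (row i Q) (row k Q).
    by apply: eq_bigr => j _; apply: eq_bigr => l _; rewrite !mxE.
  have r0 : row 0 Q = a by apply/rowP => j; rewrite mxE Q0.
  have r1 : row 1 Q = b by apply/rowP => j; rewrite mxE Q1.
  have r2 : row 2 Q = c by apply/rowP => j; rewrite mxE Q2.
  apply: ord3_ind; apply: ord3_ind; rewrite E ?r0 ?r1 ?r2 /= ?mulr1 ?mulr0 //.
  + by rewrite h.
  + by rewrite h.
  + by rewrite h.
Qed.

End Diagonalization.

(** * The algebra of consecutive jets *)

Section JetEquations.
Context {R : realFieldType}.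
Local Notation arr := (nat -> nat -> nat -> R).


Definition arr0 : arr := fun _ _ _ => 0.

(** The equations between Taylor coefficients that the proof extracts from [curl X = f
X], [div X = 0] and [grad f . X = 0] at order [N], in coordinates where the Hessian is
[diag(l1, l2, l3)]. The entry [v1 a b c] is the derivative of order [(a, b, c)] of the
first component of [X]; the arrays [F1, F2, F3] are the derivatives of [f X]; the last
field is the derivative of [l1 x1 X1 + l2 x2 X2 + l3 x3 X3], in which [x1] lowers the
index [a] and contributes the factor [a]. Entries with an index [_.-1] at [0] carry the
factor [0]. *)
Record level_eqs (l1 l2 l3 : R) (N : nat) (v1 v2 v3 F1 F2 F3 : arr) : Prop := LevelEqs {
  level_curl1 : forall a b c, (a + b + c).+1 = N -> v3 a b.+1 c - v2 a b c.+1 = F1 a b c;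
  level_curl2 : forall a b c, (a + b + c).+1 = N -> v1 a b c.+1 - v3 a.+1 b c = F2 a b c;
  level_curl3 : forall a b c, (a + b + c).+1 = N -> v2 a.+1 b c - v1 a b.+1 c = F3 a b c;
  level_div : forall a b c, (a + b + c).+1 = N -> v1 a.+1 b c + v2 a b.+1 c + v3 a b c.+1 = 0;
  level_euler : forall a b c, (a + b + c)%N = N.+1 ->
    l1 * a%:R * v1 a.-1 b c + l2 * b%:R * v2 a b.-1 c + l3 * c%:R * v3 a b c.-1 = 0 }.

(** Cyclic permutation of the three axes, under which the equations are invariant; it
reduces statements about three axes to statements about one. *)
Definition rot (v : arr) : arr := fun a b c => v c a b.

Lemma level_eqs_rot (l1 l2 l3 : R) N (v1 v2 v3 F1 F2 F3 : arr) :
  level_eqs l1 l2 l3 N v1 v2 v3 F1 F2 F3 ->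
  level_eqs l2 l3 l1 N (rot v2) (rot v3) (rot v1) (rot F2) (rot F3) (rot F1).
Proof.
case=> c1 c2 c3 dv eu; split=> a b c H; rewrite /rot.
- by apply: c2; lia.
- by apply: c3; lia.
- by apply: c1; lia.
- by have := dv c a b ltac:(lia); lra.
- by have := eu c a b ltac:(lia); lra.
Qed.

Section Weights.
Variables (l1 l2 l3 : R) (N : nat) (v1 v2 v3 F1 F2 F3 : arr).
Hypothesis E : level_eqs l1 l2 l3 N v1 v2 v3 F1 F2 F3.

(** Use the curl equations to express, in the last equation at index [(a + 1, b, c)],
the entries of [v2] and [v3] through entries of [v1]. What is left is [v1 a b c] times a
weight: the level determines the coefficient as soon as the weight is not zero. *)
Lemma level_weight1 a b c : (a + b + c)%N = N ->
  (l1 * a%:R + l2 * b%:R + l3 * c%:R + l1) * v1 a b c =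
  l3 * c%:R * F2 a b c.-1 - l2 * b%:R * F3 a b.-1 c.
Proof.
move=> H; have := level_euler E (a := a.+1) (b := b) (c := c).
rewrite !addSn H => /(_ erefl) /=; rewrite -natr1.
case: b H => [|b] H; case: c H => [|c] H /=.
- by rewrite !mulr0 !mul0r; lra.
- have := level_curl2 E (a := a) (b := 0) (c := c); rewrite -addnS H => /(_ erefl) <-.
  rewrite !mulr0 !mul0r; lra.
- have := level_curl3 E (a := a) (b := b) (c := 0); rewrite -addSn -addnS H => /(_ erefl) <-.
  rewrite !mulr0 !mul0r; lra.
have := level_curl3 E (a := a) (b := b) (c := c.+1); rewrite -addSn -addnS H => /(_ erefl) <-.
have := level_curl2 E (a := a) (b := b.+1) (c := c); rewrite -addnS H => /(_ erefl) <-.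
lra.
Qed.

End Weights.

Lemma level_weight2 (l1 l2 l3 : R) N (v1 v2 v3 F1 F2 F3 : arr) a b c :
  level_eqs l1 l2 l3 N v1 v2 v3 F1 F2 F3 -> (a + b + c)%N = N ->
  (l1 * a%:R + l2 * b%:R + l3 * c%:R + l2) * v2 a b c =
  l1 * a%:R * F3 a.-1 b c - l3 * c%:R * F1 a b c.-1.
Proof.
move=> /level_eqs_rot E H; have := level_weight1 E (a := b) (b := c) (c := a).
by rewrite /rot => <-; [congr (_ * _); ring|lia].
Qed.

Lemma level_weight3 (l1 l2 l3 : R) N (v1 v2 v3 F1 F2 F3 : arr) a b c :
  level_eqs l1 l2 l3 N v1 v2 v3 F1 F2 F3 -> (a + b + c)%N = N ->
  (l1 * a%:R + l2 * b%:R + l3 * c%:R + l3) * v3 a b c =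
  l2 * b%:R * F1 a b.-1 c - l1 * a%:R * F2 a.-1 b c.
Proof.
move=> /level_eqs_rot/level_eqs_rot E H; have := level_weight1 E (a := c) (b := a) (c := b).
by rewrite /rot => <-; [congr (_ * _); ring|lia].
Qed.

(** A level without curl is the gradient of a homogeneous polynomial of degree one more;
this array lists the derivatives of that polynomial, read off from whichever component
is available. *)
Definition potential (y1 y2 y3 : arr) : arr := fun a b c =>
  if a is a'.+1 then y1 a' b c else if b is b'.+1 then y2 a b' c
  else if c is c'.+1 then y3 a b c' else 0.

Section Irrotational.
Variables (l1 l2 l3 : R) (m : nat) (y1 y2 y3 : arr).
Hypothesis E : level_eqs l1 l2 l3 m y1 y2 y3 arr0 arr0 arr0.
Let u := potential y1 y2 y3.

Lemma potential1 a b c : u a.+1 b c = y1 a b c. Proof. by []. Qed.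

Lemma potential2 a b c : (a + b + c)%N = m -> u a b.+1 c = y2 a b c.
Proof.
case: a => // a H /=; apply/esym/eqP; rewrite -subr_eq0; apply/eqP.
by apply: (level_curl3 E); rewrite -H !addSn.
Qed.

Lemma potential3 a b c : (a + b + c)%N = m -> u a b c.+1 = y3 a b c.
Proof.
case: a => [|a] H /=.
  case: b H => // b H; apply/esym/eqP; rewrite -subr_eq0; apply/eqP.
  by apply: (level_curl1 E); rewrite -H !addnS !addSn.
apply/eqP; rewrite -subr_eq0; apply/eqP.
by apply: (level_curl2 E); rewrite -H !addSn.
Qed.

(** The last equation of the level says that [l1 x1 d1 + l2 x2 d2 + l3 x3 d3] kills the
potential. A monomial is an eigenvector of this operator, so only the resonant ones, of
weight [0], can occur. *)
Lemma potential_weight a b c : (a + b + c)%N = m.+1 ->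
  (l1 * a%:R + l2 * b%:R + l3 * c%:R) * u a b c = 0.
Proof.
move=> H; rewrite -(level_euler E H) !mulrDl; congr (_ + _ + _).
- by case: a H => [|a] //= _; rewrite !mulr0 !mul0r.
- case: b H => [|b] H; first by rewrite !mulr0 !mul0r.
  by rewrite potential2 //; move: H; rewrite addnS addSn => -[].
- case: c H => [|c] H; first by rewrite !mulr0 !mul0r.
  by rewrite potential3 //; move: H; rewrite addnS => -[].
Qed.

Lemma potential_harmonic a b c : (a + b + c).+1 = m ->
  u a.+2 b c + u a b.+2 c + u a b c.+2 = 0.
Proof.
move=> H; rewrite -(level_div E H) potential1 potential2 ?potential3 //; lia.
Qed.

(** By harmonicity the coefficients at [(a + 2, b, c)], [(a, b + 2, c)] and [(a, b, c +
2)] sum to [0], and their weights differ when the eigenvalues do. If the first were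
nonzero, its weight would be [0], hence those of the other two would not, and the sum
would be the first coefficient alone. *)
Lemma potential_ge2 a b c : l1 != l2 -> l1 != l3 -> (a + b + c).+1 = m -> u a.+2 b c = 0.
Proof.
move=> l12 l13 H; have := potential_harmonic H.
have W1 := @potential_weight a.+2 b c; have W2 := @potential_weight a b.+2 c.
have W3 := @potential_weight a b c.+2.
have {W1}/eqP := W1 ltac:(lia); have {W2}/eqP := W2 ltac:(lia); have {W3}/eqP := W3 ltac:(lia).
rewrite !mulf_eq0 -!natr1 => /orP[/eqP w3|/eqP -> ] /orP[/eqP w2|/eqP ->] /orP[/eqP w1|/eqP -> //];
  rewrite ?addr0 //; move=> _.
- by case/eqP: l12; lra.
- by case/eqP: l13; lra.
- by case/eqP: l12; lra.
Qed.

End Irrotational.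

Lemma potential_rot (l1 l2 l3 : R) m y1 y2 y3 a b c :
  level_eqs l1 l2 l3 m y1 y2 y3 arr0 arr0 arr0 -> (a + b + c)%N = m.+1 ->
  potential (rot y2) (rot y3) (rot y1) a b c = potential y1 y2 y3 c a b.
Proof.
move=> E H; case: a H => [|a] H.
  case: b H => [|b] H; first by case: c H => // c H; rewrite potential1.
  by rewrite (potential3 E) //; lia.
by rewrite (potential2 E) //; lia.
Qed.

Lemma distinct_support (l1 l2 l3 : R) m y1 y2 y3 a b c :
  level_eqs l1 l2 l3 m y1 y2 y3 arr0 arr0 arr0 -> l1 != l2 -> l1 != l3 -> l2 != l3 ->
  (a + b + c)%N = m.+1 -> potential y1 y2 y3 a b c != 0 ->
  [/\ (a <= 1)%N, (b <= 1)%N & (c <= 1)%N].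
Proof.
move=> E l12 l13 l23 H un0.
have E1 := level_eqs_rot E; have E2 := level_eqs_rot E1.
have l21 : l2 != l1 by rewrite eq_sym.
have l31 : l3 != l1 by rewrite eq_sym.
have l32 : l3 != l2 by rewrite eq_sym.
split; rewrite leqNgt; apply: contra un0 => k.
- case: a k H => [|[|a]] // _ H.
  by rewrite (potential_ge2 E) //; lia.
- case: b k H => [|[|b]] // _ H.
  rewrite -(@potential_rot _ _ _ m y1 y2 y3 b.+2 c a E); last by lia.
  by rewrite (potential_ge2 E1) //; lia.
- case: c k H => [|[|c]] // _ H.
  rewrite -(@potential_rot _ _ _ m y1 y2 y3 b c.+2 a E); last by lia.
  rewrite -(potential_rot E1); last by lia.
  by rewrite (potential_ge2 E2) //; lia.
Qed.

(** When [l1 = l2] the weight is [l1 (a + b) + l3 c]; the exponents [c >= 2] are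
excluded as before and [c = 0] by [l1 != 0]. The potential is [x3] times a binary form.
*)
Lemma equal12_support (l1 l2 l3 : R) m y1 y2 y3 a b c : l1 != 0 ->
  level_eqs l1 l2 l3 m y1 y2 y3 arr0 arr0 arr0 -> l1 = l2 ->
  (a + b + c)%N = m.+1 -> potential y1 y2 y3 a b c != 0 ->
  [/\ l1 != l3, c = 1%N & l1 * m%:R + l3 = 0].
Proof.
move=> l1n0 E l12 H un0; have /eqP := potential_weight E H; rewrite mulf_eq0 (negPf un0) orbF => /eqP W.
have l13 : l1 != l3.
  apply/eqP => l13; move: W; rewrite -l12 -l13 -!mulrDr -!natrD H => /eqP.
  by rewrite mulf_eq0 (negPf l1n0) pnatr_eq0.
have E1 := level_eqs_rot E; have E2 := level_eqs_rot E1.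
case: c H un0 W => [|[|c]] H un0 W.
- move: W; rewrite -l12 mulr0 addr0 -mulrDr -natrD (_ : (a + b)%N = m.+1); last by lia.
  by move/eqP; rewrite mulf_eq0 (negPf l1n0) pnatr_eq0.
- split=> //; rewrite -W -l12 -mulrDr -natrD mulr1; congr (_ * _%:R + _); lia.
- have l31 : l3 != l1 by rewrite eq_sym.
  case/negP: un0; rewrite -(@potential_rot _ _ _ m y1 y2 y3 b c.+2 a E); last by lia.
  rewrite -(potential_rot E1); last by lia.
  by rewrite (potential_ge2 E2) -?l12 //; lia.
Qed.

Lemma distinct_consecutive (l1 l2 l3 : R) m y1 y2 y3 z1 z2 z3 a b c a' b' c' :
  l1 != 0 -> l2 != 0 -> l3 != 0 ->
  level_eqs l1 l2 l3 m y1 y2 y3 arr0 arr0 arr0 ->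
  level_eqs l1 l2 l3 m.+1 z1 z2 z3 arr0 arr0 arr0 ->
  l1 != l2 -> l1 != l3 -> l2 != l3 ->
  (a + b + c)%N = m.+1 -> potential y1 y2 y3 a b c != 0 ->
  (a' + b' + c')%N = m.+2 -> potential z1 z2 z3 a' b' c' = 0.
Proof.
move=> l1n0 l2n0 l3n0 E E' l12 l13 l23 H un0 H'; apply/eqP; apply: contraT => un0'.
have /eqP := potential_weight E H; rewrite mulf_eq0 (negPf un0) orbF => /eqP W.
have /eqP := potential_weight E' H'; rewrite mulf_eq0 (negPf un0') orbF => /eqP W'.
have [a1 b1 c1] := distinct_support E l12 l13 l23 H un0.
have [a1' b1' c1'] := distinct_support E' l12 l13 l23 H' un0'.
clear un0 un0' E E' l12 l13 l23.
case: a a1 H W => [|[|//]] _; case: b b1 => [|[|//]] _; case: c c1 => [|[|//]] _ H W;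
case: a' a1' H' W' => [|[|//]] _; case: b' b1' => [|[|//]] _; case: c' c1' => [|[|//]] _ H' W';
try lia; exfalso; move: l1n0 l2n0 l3n0 => /eqP l1n0 /eqP l2n0 /eqP l3n0;
try (by apply: l1n0; lra); try (by apply: l2n0; lra); by apply: l3n0; lra.
Qed.

Lemma equal12_consecutive (l1 l2 l3 : R) m y1 y2 y3 z1 z2 z3 a b c a' b' c' :
  l1 != 0 -> l2 != 0 -> l3 != 0 ->
  level_eqs l1 l2 l3 m y1 y2 y3 arr0 arr0 arr0 ->
  level_eqs l1 l2 l3 m.+1 z1 z2 z3 arr0 arr0 arr0 ->
  l1 = l2 ->
  (a + b + c)%N = m.+1 -> potential y1 y2 y3 a b c != 0 ->
  (a' + b' + c')%N = m.+2 -> potential z1 z2 z3 a' b' c' = 0.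
Proof.
move=> l1n0 l2n0 l3n0 E E' l12 H un0 H'; apply/eqP; apply: contraT => un0'.
have [_ _ W] := equal12_support l1n0 E l12 H un0.
have [_ _] := equal12_support l1n0 E' l12 H' un0'; rewrite -natr1.
by move: l1n0 => /eqP l1n0 W'; exfalso; apply: l1n0; lra.
Qed.

(** Resonance in two consecutive degrees is impossible. For distinct eigenvalues the
exponents are [0] or [1], and each of the finitely many pairs of weights [0] forces an
eigenvalue to vanish; for [l1 = l2] the relations [m l1 + l3 = 0] and [(m + 1) l1 + l3 =
0] give [l1 = 0]. *)
Lemma consecutive_levels (l1 l2 l3 : R) m y1 y2 y3 z1 z2 z3 a b c a' b' c' :
  l1 != 0 -> l2 != 0 -> l3 != 0 ->
  level_eqs l1 l2 l3 m y1 y2 y3 arr0 arr0 arr0 ->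
  level_eqs l1 l2 l3 m.+1 z1 z2 z3 arr0 arr0 arr0 ->
  (a + b + c)%N = m.+1 -> potential y1 y2 y3 a b c != 0 ->
  (a' + b' + c')%N = m.+2 -> potential z1 z2 z3 a' b' c' = 0.
Proof.
move=> l1n0 l2n0 l3n0 E E' H un0 H'.
have E1 := level_eqs_rot E; have E2 := level_eqs_rot E1.
have E1' := level_eqs_rot E'; have E2' := level_eqs_rot E1'.
have H1 : (b + c + a)%N = m.+1 by lia.
have H2 : (c + a + b)%N = m.+1 by lia.
have H1' : (b' + c' + a')%N = m.+2 by lia.
have H2' : (c' + a' + b')%N = m.+2 by lia.
have [l12|l12] := eqVneq l1 l2; first exact: (equal12_consecutive l1n0 l2n0 l3n0 E E' l12 H un0 H').
have [l23|l23] := eqVneq l2 l3.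
  rewrite -(potential_rot E' H1'); rewrite -(potential_rot E H1) in un0.
  exact: (equal12_consecutive l2n0 l3n0 l1n0 E1 E1' l23 H1 un0 H1').
have [l31|l31] := eqVneq l3 l1.
  rewrite -(potential_rot E' H1') -(potential_rot E1' H2').
  rewrite -(potential_rot E H1) -(potential_rot E1 H2) in un0.
  exact: (equal12_consecutive l3n0 l1n0 l2n0 E2 E2' l31 H2 un0 H2').
rewrite eq_sym in l31.
exact: (distinct_consecutive l1n0 l2n0 l3n0 E E' l12 l31 l23 H un0 H').
Qed.

(** The derivatives of the product of [(l1 x1^2 + l2 x2^2 + l3 x3^2) / 2] with the
function whose derivatives are listed in [y]. *)
Definition quad_source (l1 l2 l3 : R) (y : arr) : arr := fun a b c =>
  2^-1 * (l1 * (a * a.-1)%:R * y a.-2 b c + l2 * (b * b.-1)%:R * y a b.-2 c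
          + l3 * (c * c.-1)%:R * y a b c.-2).

(** The first level above the lowest one that is fed by it: the next one, through the
value of [f] at [p] when this is not zero; otherwise the third one after it, through the
Hessian. *)
Definition second_level (l1 l2 l3 : R) m (y1 y2 y3 : arr) :=
  (exists k : R, exists v1 v2 v3 : arr, k != 0 /\
     level_eqs l1 l2 l3 m.+1 v1 v2 v3 (fun a b c => k * y1 a b c)
       (fun a b c => k * y2 a b c) (fun a b c => k * y3 a b c)) \/
  (exists v1 v2 v3 : arr, level_eqs l1 l2 l3 m.+3 v1 v2 v3
     (quad_source l1 l2 l3 y1) (quad_source l1 l2 l3 y2) (quad_source l1 l2 l3 y3)).

Lemma quad_source_rot (l1 l2 l3 : R) y :
  rot (quad_source l1 l2 l3 y) = quad_source l2 l3 l1 (rot y).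
Proof.
apply: funext => a; apply: funext => b; apply: funext => c.
by rewrite /rot /quad_source; congr (_ * _); ring.
Qed.

Lemma second_level_rot (l1 l2 l3 : R) m y1 y2 y3 :
  second_level l1 l2 l3 m y1 y2 y3 -> second_level l2 l3 l1 m (rot y2) (rot y3) (rot y1).
Proof.
case=> [[k [v1 [v2 [v3 [k0 /level_eqs_rot E]]]]]|[v1 [v2 [v3 /level_eqs_rot E]]]].
  by left; exists k, (rot v2), (rot v3), (rot v1).
right; exists (rot v2), (rot v3), (rot v1).
by rewrite -(quad_source_rot l1 l2 l3 y1) -(quad_source_rot l1 l2 l3 y2) -(quad_source_rot l1 l2 l3 y3).
Qed.

(** With a source whose two relevant entries agree (they are the mixed derivatives [(1,
1, t)] of one potential), the weights give [v3 0 0 t.+2 = 0], so the divergence equation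
makes the two other diagonal terms opposite. They have the same source but, for [l1 !=
l2], different weights, so they vanish, and so does the source. *)
Lemma pair_source0 (l1 l2 l3 : R) t v1 v2 v3 F1 F2 F3 :
  level_eqs l1 l2 l3 t.+2 v1 v2 v3 F1 F2 F3 -> l3 != 0 -> l1 != l2 ->
  F2 1%N 0%N t = F1 0%N 1%N t -> F1 0%N 1%N t = 0.
Proof.
move=> V l3n0 l12 FE.
have D := @level_div _ _ _ _ _ _ _ _ _ _ V 0 0 t.+1 erefl.
have W1 := @level_weight1 _ _ _ _ _ _ _ _ _ _ V 1 0 t.+1 erefl.
have W2 := @level_weight2 _ _ _ _ _ _ _ _ _ _ 0 1 t.+1 V erefl.
have /eqP W3 := @level_weight3 _ _ _ _ _ _ _ _ _ _ 0 0 t.+2 V erefl.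
rewrite /= !mulr0 !mul0r subrr !add0r -{2}(mulr1 l3) -mulrDr -natr1 in W3.
rewrite natr1 natr1 mulf_eq0 mulf_eq0 (negPf l3n0) pnatr_eq0 /= in W3.
rewrite (eqP W3) addr0 in D.
have v21 : v2 0%N 1%N t.+1 = - v1 1%N 0%N t.+1 by lra.
rewrite v21 FE /= in W1 W2.
have /eqP : (l1 - l2) * v1 1%N 0%N t.+1 = 0 by lra.
rewrite mulf_eq0 subr_eq0 (negPf l12) /= => /eqP v10.
rewrite v10 mulr0 !mulr0 !mul0r subr0 in W1.
by move/esym/eqP: W1; rewrite !mulf_eq0 (negPf l3n0) pnatr_eq0 /= => /eqP.
Qed.

Lemma pair12 (l1 l2 l3 : R) m y1 y2 y3 s :
  level_eqs l1 l2 l3 m y1 y2 y3 arr0 arr0 arr0 -> second_level l1 l2 l3 m y1 y2 y3 ->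
  l3 != 0 -> l1 != l2 -> s.+1 = m -> potential y1 y2 y3 1 1 s = 0.
Proof.
move=> E S l3n0 l12 sm; have U2 := @potential2 _ _ _ _ _ _ _ E 1 0 s ltac:(lia).
have U1 := potential1 y1 y2 y3 0 1 s.
case: S => [[k [v1 [v2 [v3 [k0 V]]]]]|[v1 [v2 [v3 V]]]]; rewrite -sm in V.
  have := pair_source0 V l3n0 l12.
  by rewrite -U1 -U2 => /(_ erefl)/eqP; rewrite mulf_eq0 (negPf k0) => /eqP.
have := pair_source0 V l3n0 l12.
have Q (y : arr) i j : (i <= 1)%N -> (j <= 1)%N ->
    quad_source l1 l2 l3 y i j s.+2 = 2^-1 * l3 * (s.+2 * s.+1)%:R * y i j s.
  by move=> i1 j1; rewrite /quad_source /=; case: i i1 => [|[|//]] _; case: j j1 => [|[|//]] _ /=;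
    rewrite ?mul0n ?muln0; ring.
rewrite !Q // -U1 -U2 => /(_ erefl)/eqP.
by rewrite !mulf_eq0 invr_eq0 !pnatr_eq0 (negPf l3n0) => /eqP.
Qed.

Lemma potential_harmonic12 (l1 l2 l3 : R) m y1 y2 y3 a b :
  level_eqs l1 l2 l3 m y1 y2 y3 arr0 arr0 arr0 -> l1 = l2 -> l1 != l3 -> (a + b).+2 = m ->
  potential y1 y2 y3 a.+2 b 1 = - potential y1 y2 y3 a b.+2 1.
Proof.
move=> E l12 l13 H; have D := potential_harmonic E (a := a) (b := b) (c := 1) ltac:(lia).
have E1 := level_eqs_rot E; have E2 := level_eqs_rot E1.
suff : potential y1 y2 y3 a b 3 = 0 by lra.
rewrite -(@potential_rot _ _ _ _ _ _ _ b 3 a E); last by lia.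
rewrite -(potential_rot E1); last by lia.
by rewrite (potential_ge2 E2) -?l12 1?eq_sym //; lia.
Qed.

(** For [l1 = l2] the potential is [x3] times a harmonic binary form of degree [n + 1],
determined by the two coefficients in the conclusion. Each of the four cases (two kinds
of second level, two coefficients) chooses one index at which the divergence equation,
with the weights of the three coefficients entering it and [l3 = - (n + 1) l1], becomes
a linear system that only [0] solves. *)
Lemma equal_pair (l1 l2 l3 : R) n y1 y2 y3 :
  level_eqs l1 l2 l3 n.+1 y1 y2 y3 arr0 arr0 arr0 -> second_level l1 l2 l3 n.+1 y1 y2 y3 ->
  l1 = l2 -> l1 != 0 -> l1 != l3 -> l1 * n.+1%:R + l3 = 0 ->
  potential y1 y2 y3 n 1 1 = 0 /\ potential y1 y2 y3 n.+1 0 1 = 0.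
Proof.
move=> E S l12 l1n0 l13 l3E; set u := potential y1 y2 y3.
have U1 a b c : y1 a b c = u a.+1 b c by [].
have U2 a b c : (a + b + c)%N = n.+1 -> y2 a b c = u a b.+1 c by move=> H; rewrite /u (potential2 E).
have U3 a b c : (a + b + c)%N = n.+1 -> y3 a b c = u a b c.+1 by move=> H; rewrite /u (potential3 E).
have Hn a b : (a + b).+1 = n -> u a.+2 b 1 = - u a b.+2 1.
  by move=> H; apply: (potential_harmonic12 E l12 l13); rewrite H.
(* The factor [n] makes the relations below hold for [n = 0] as well, where the index
   [n.-1] has no meaning. *)
have nU : n%:R * u n.-1 2 1 = - (n%:R * u n.+1 0 1).
  case: n Hn {E S l3E U2 U3} => [|n] Hn; first by rewrite mulr0n !mul0r oppr0.
  by rewrite [n.+1.-1]/= (Hn n 0%N) ?addn0 // mulrN opprK.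
have nz i : (n%:R + i.+1%:R : R) != 0 by rewrite -natrD pnatr_eq0 addnS.
have nz1 : (n%:R + 1 : R) != 0 by rewrite natr1 pnatr_eq0.
have n3 : n%:R * y3 n.-1 2 0 = - (n%:R * u n.+1 0 1).
  rewrite -nU; case: n U3 {E S l3E U2 nU Hn nz nz1} => [|n] U3; first by rewrite mulr0n !mul0r.
  by rewrite [n.+1.-1]/= U3 //; lia.
have n2 : n%:R * y2 n.-1 1 1 = - (n%:R * u n.+1 0 1).
  rewrite -nU; case: n U2 {E S l3E U3 nU Hn nz nz1 n3} => [|n] U2; first by rewrite mulr0n !mul0r.
  by rewrite [n.+1.-1]/= U2 //; lia.
have [n1 n1'] : y3 n 1 0 = u n 1 1 /\ y2 n 0 1 = u n 1 1 by split; [apply: U3|apply: U2]; lia.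
have [m1 m1'] : y3 n.+1 0 0 = u n.+1 0 1 /\ y1 n 0 1 = u n.+1 0 1 by split=> //; apply: U3; lia.
have l3E' : l3 = - (l1 * (n%:R + 1)) by move: l3E; rewrite -natr1; lra.
move: n1 n1' m1 m1' n2 n3; set U := u n 1 1; set W := u n.+1 0 1.
move=> n1 n1' m1 m1' n2 n3.
case: S => [[k [v1 [v2 [v3 [k0 V]]]]]|[v1 [v2 [v3 V]]]]; split.
- have D := @level_div _ _ _ _ _ _ _ _ _ _ V n.+1 0 0 ltac:(lia).
  have W1 := @level_weight1 _ _ _ _ _ _ _ _ _ _ V n.+2 0 0 ltac:(lia).
  have W2 := @level_weight2 _ _ _ _ _ _ _ _ _ _ n.+1 1 0 V ltac:(lia).
  have W3 := @level_weight3 _ _ _ _ _ _ _ _ _ _ n.+1 0 1 V ltac:(lia).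
  move: D W1 W2 W3; rewrite /= n1 n1' -l12 l3E' -!natr1.
  move: (v1 _ _ _) (v2 _ _ _) (v3 _ _ _) => a b c D W1 W2 W3.
  have /eqP : l1 * (n%:R + 3) * a = 0 by lra.
  rewrite !mulf_eq0 (negPf l1n0) (negPf (nz _)) /= => /eqP a0.
  have bE : b = - c by lra.
  rewrite a0 bE in D W1 W2.
  have /eqP : l1 * (n%:R + 2) * c = 0 by lra.
  rewrite !mulf_eq0 (negPf l1n0) (negPf (nz _)) /= => /eqP c0; rewrite c0 in W3.
  have /eqP : l1 * (n%:R + 1) * (k * U) = 0 by lra.
  by rewrite !mulf_eq0 (negPf l1n0) (negPf nz1) (negPf k0) => /eqP.
- have D := @level_div _ _ _ _ _ _ _ _ _ _ V n 1 0 ltac:(lia).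
  have W1 := @level_weight1 _ _ _ _ _ _ _ _ _ _ V n.+1 1 0 ltac:(lia).
  have W2 := @level_weight2 _ _ _ _ _ _ _ _ _ _ n 2 0 V ltac:(lia).
  have W3 := @level_weight3 _ _ _ _ _ _ _ _ _ _ n 1 1 V ltac:(lia).
  move: D W1 W2 W3; rewrite /= m1 m1' -l12 -!(mulrA l1 n%:R) !(mulrCA n%:R k) n2 n3 l3E' -!natr1.
  move: (v1 _ _ _) (v2 _ _ _) (v3 _ _ _) => a b c D W1 W2 W3.
  have cE : c = - (a + b) by lra.
  rewrite cE in W3.
  have /eqP : l1 * (n%:R + 2) * (a + b) = 0 by lra.
  rewrite !mulf_eq0 (negPf l1n0) (negPf (nz _)) /= => /eqP ab0.
  have bE : b = - a by lra.
  rewrite bE in W2.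
  have /eqP : l1 * (n%:R + 1) * (k * W) = 0 by lra.
  by rewrite !mulf_eq0 (negPf l1n0) (negPf nz1) (negPf k0) => /eqP.
- have D := @level_div _ _ _ _ _ _ _ _ _ _ V n.+3 0 0 ltac:(lia).
  have W1 := @level_weight1 _ _ _ _ _ _ _ _ _ _ V n.+4 0 0 ltac:(lia).
  have W2 := @level_weight2 _ _ _ _ _ _ _ _ _ _ n.+3 1 0 V ltac:(lia).
  have W3 := @level_weight3 _ _ _ _ _ _ _ _ _ _ n.+3 0 1 V ltac:(lia).
  have h0 : 2^-1 != 0 :> R by rewrite invr_eq0 pnatr_eq0.
  move: D W1 W2 W3; rewrite /quad_source; set h := 2^-1 in h0 *; clearbody h.
  rewrite /= !mul0n !muln0 n1 n1' -l12 l3E' !natrM -!natr1.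
  move: (v1 _ _ _) (v2 _ _ _) (v3 _ _ _) => a b c D W1 W2 W3.
  have /eqP : l1 * (n%:R + 5) * a = 0 by lra.
  rewrite !mulf_eq0 (negPf l1n0) (negPf (nz _)) /= => /eqP a0.
  have bE : b = - c by lra.
  rewrite a0 bE in D W1 W2.
  have /eqP : l1 * (n%:R + 2) * c = 0 by lra.
  rewrite !mulf_eq0 (negPf l1n0) (negPf (nz _)) /= => /eqP c0; rewrite c0 in W3.
  have /eqP : h * l1 * l1 * (n%:R + 1) * (n%:R + 2) * (n%:R + 3) * U = 0 by lra.
  by rewrite !mulf_eq0 (negPf l1n0) (negPf h0) (negPf nz1) !(negPf (nz _)) => /eqP.
- have D := @level_div _ _ _ _ _ _ _ _ _ _ V n.+2 1 0 ltac:(lia).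
  have W1 := @level_weight1 _ _ _ _ _ _ _ _ _ _ V n.+3 1 0 ltac:(lia).
  have W2 := @level_weight2 _ _ _ _ _ _ _ _ _ _ n.+2 2 0 V ltac:(lia).
  have W3 := @level_weight3 _ _ _ _ _ _ _ _ _ _ n.+2 1 1 V ltac:(lia).
  have h0 : 2^-1 != 0 :> R by rewrite invr_eq0 pnatr_eq0.
  move: D W1 W2 W3; rewrite /quad_source; set h := 2^-1 in h0 *; clearbody h.
  rewrite /= !mul0n !muln0 m1 m1' -l12 !natrM.
  rewrite l3E' -!natr1.
  have e3 : h * l1 * l1 * (n%:R + 2) * (n%:R + 1) * (n%:R * y3 n.-1 2 0)
    = h * l1 * l1 * (n%:R + 2) * (n%:R + 1) * (- (n%:R * W)) by rewrite n3.
  have e2 : h * l1 * l1 * (n%:R + 2) * (n%:R + 1) * (n%:R * y2 n.-1 1 1)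
    = h * l1 * l1 * (n%:R + 2) * (n%:R + 1) * (- (n%:R * W)) by rewrite n2.
  move: (v1 _ _ _) (v2 _ _ _) (v3 _ _ _) => a b c D W1 W2 W3.
  have cE : c = - (a + b) by lra.
  rewrite cE in W3.
  have /eqP : l1 * (n%:R + 2) * (a + b) = 0 by lra.
  rewrite !mulf_eq0 (negPf l1n0) (negPf (nz _)) /= => /eqP ab0.
  have bE : b = - a by lra.
  rewrite bE in W2.
  have /eqP : h * l1 * l1 * (n%:R + 1) * (n%:R + 1) * (n%:R + 2) * W = 0 by lra.
  by rewrite !mulf_eq0 (negPf l1n0) (negPf h0) (negPf nz1) !(negPf (nz _)) => /eqP.
Qed.

Lemma equal12_level_zero (l1 l2 l3 : R) m y1 y2 y3 a b c :
  l1 != 0 -> l3 != 0 -> l1 = l2 ->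
  level_eqs l1 l2 l3 m y1 y2 y3 arr0 arr0 arr0 -> second_level l1 l2 l3 m y1 y2 y3 ->
  (a + b + c)%N = m.+1 -> potential y1 y2 y3 a b c = 0.
Proof.
move=> l1n0 l3n0 l12 E S H; apply/eqP; apply: contraT => un0.
have [l13 c1 l3E] := equal12_support l1n0 E l12 H un0.
case: m E S H l3E => [|n] E S H l3E.
  by move: l3n0; rewrite -l3E mulr0 add0r eqxx.
have [u1 u0] := equal_pair E S l12 l1n0 l13 l3E.
suff Z : forall b a, (a + b)%N = n.+1 -> potential y1 y2 y3 a b 1 = 0.
  by move: un0; rewrite c1 Z ?eqxx //; lia.
move=> {un0 c1 H a b c} b; elim/ltn_ind: b => -[|[|b]] IH a ab.
- by rewrite (_ : a = n.+1) //; lia.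
- by rewrite (_ : a = n) //; lia.
- apply: oppr_inj; rewrite oppr0 -(potential_harmonic12 E l12 l13); last by lia.
  by apply: IH => //; lia.
Qed.

(** The lowest level cannot be different from [0]. When two eigenvalues agree, the
potential is reduced to its two basic coefficients; when they are distinct, the resonant
monomials with exponents at most [1] have exactly two exponents equal to [1] or all
three, since every eigenvalue is nonzero, and each of them is excluded through [pair12].
*)
Lemma level_zero (l1 l2 l3 : R) m y1 y2 y3 a b c :
  l1 != 0 -> l2 != 0 -> l3 != 0 ->
  level_eqs l1 l2 l3 m y1 y2 y3 arr0 arr0 arr0 -> second_level l1 l2 l3 m y1 y2 y3 ->
  (a + b + c)%N = m.+1 -> potential y1 y2 y3 a b c = 0.
Proof.
move=> l1n0 l2n0 l3n0 E S H.
have E1 := level_eqs_rot E; have E2 := level_eqs_rot E1.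
have S1 := second_level_rot S; have S2 := second_level_rot S1.
have H1 : (b + c + a)%N = m.+1 by lia.
have H2 : (c + a + b)%N = m.+1 by lia.
have [l12|l12] := eqVneq l1 l2; first exact: (equal12_level_zero l1n0 l3n0 l12 E S H).
have [l23|l23] := eqVneq l2 l3.
  by rewrite -(potential_rot E H1) (equal12_level_zero l2n0 l1n0 l23 E1 S1).
have [l31|l31] := eqVneq l3 l1.
  by rewrite -(potential_rot E H1) -(potential_rot E1 H2) (equal12_level_zero l3n0 l2n0 l31 E2 S2).
have l13 : l1 != l3 by rewrite eq_sym.
apply/eqP; apply: contraT => un0.
have [a1 b1 c1] := distinct_support E l12 l13 l23 H un0.
have /eqP := potential_weight E H; rewrite mulf_eq0 (negPf un0) orbF => /eqP W.
have P3 s : s.+1 = m -> potential y1 y2 y3 1 1 s = 0 by move=> sm; exact: (pair12 E S l3n0 l12 sm).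
have P1 s : s.+1 = m -> potential y1 y2 y3 s 1 1 = 0.
  move=> sm; rewrite -(@potential_rot _ _ _ _ _ _ _ 1 1 s E); last by lia.
  exact: (pair12 E1 S1 l1n0 l23 sm).
have P2 s : s.+1 = m -> potential y1 y2 y3 1 s 1 = 0.
  move=> sm; rewrite -(@potential_rot _ _ _ _ _ _ _ s 1 1 E); last by lia.
  rewrite -(@potential_rot _ _ _ _ _ _ _ 1 1 s E1); last by lia.
  exact: (pair12 E2 S2 l2n0 l31 sm).
move: un0 H W {H1 H2}; case: a a1 => [|[|//]] _; case: b b1 => [|[|//]] _; case: c c1 => [|[|//]] _;
  rewrite ?mulr0 ?mulr1 ?addr0 ?add0r ?(negPf l1n0) // => un0 [H] W; exfalso.
all: try by [move: l3n0; rewrite W eqxx | move: l2n0; rewrite W eqxx | move: l1n0; rewrite W eqxx].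
all: case/negP: un0; apply/eqP; first [exact: (P1 _ H)|exact: (P2 _ H)|exact: (P3 _ H)].
Qed.

End JetEquations.

(** * Derivations along an orthonormal frame *)

Section Frame.
Context {R : realType}.
Local Notation R3 := 'rV[R]_3.
Variables (U : set R3) (p : R3) (Q : 'M[R]_3).
Hypotheses (oU : open U) (Up : U p).
Hypothesis Qcol : forall j k, \sum_(i < 3) Q i j * Q i k = (j == k)%:R.
Hypothesis Qrow : forall i k, \sum_(j < 3) Q i j * Q k j = (i == k)%:R.
Implicit Types (x y z : R3) (F G : R3 -> R).
Local Notation smooth := (smooth_on U).

Definition fd (i : 'I_3) F : R3 -> R := fun x => \sum_(j < 3) Q i j * partial j F x.

Lemma fd_smooth i F : smooth F -> smooth (fd i F).
Proof.
move=> sF; apply: (smooth_on_sum _ oU) => j; apply: (smooth_onZ _ oU).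
exact: smooth_on_partial.
Qed.

Lemma fd_eq_on i F G : {in U, F =1 G} -> {in U, fd i F =1 fd i G}.
Proof. by move=> FG x Ux; apply: eq_bigr => j _; rewrite (partial_eq_on j oU FG). Qed.

Lemma fdD i F G : smooth F -> smooth G ->
  {in U, fd i (fun x => F x + G x) =1 fun x => fd i F x + fd i G x}.
Proof.
move=> sF sG x /set_mem Ux; rewrite /fd -big_split; apply: eq_bigr => j _ /=.
by rewrite (partialD (smooth_on_derivable sF Ux) (smooth_on_derivable sG Ux)) mulrDr.
Qed.

Lemma fdM i F G : smooth F -> smooth G ->
  {in U, fd i (fun x => F x * G x) =1 fun x => fd i F x * G x + F x * fd i G x}.
Proof.
move=> sF sG x /set_mem Ux; rewrite /fd mulr_suml mulr_sumr -big_split; apply: eq_bigr => j _ /=.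
rewrite (partialM (smooth_on_derivable sF Ux) (smooth_on_derivable sG Ux)); ring.
Qed.

Lemma fd_cst i (a : R) : fd i (fun=> a) = fun=> 0.
Proof. by apply/funext => x; rewrite /fd big1 // => j _; rewrite partial_cst mulr0. Qed.

Lemma fdZ i a F : smooth F -> {in U, fd i (fun x => a * F x) =1 fun x => a * fd i F x}.
Proof.
by move=> sF x Ux; rewrite (fdM i (smooth_on_cst a oU) sF Ux) fd_cst mul0r add0r.
Qed.

Lemma fd_fdE i j F : smooth F -> {in U, fd i (fd j F) =1
  fun x => \sum_(k < 3) \sum_(l < 3) Q i k * Q j l * partial k (partial l F) x}.
Proof.
move=> sF x /set_mem Ux; rewrite /fd; apply: eq_bigr => k _.
have [|_ ->] := @partial_sum R 'I_3 (index_enum 'I_3) (fun l x => Q j l * partial l F x) x k.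
  by move=> l; apply: smooth_on_derivable Ux; apply: (smooth_onZ _ oU); exact: smooth_on_partial.
rewrite mulr_sumr; apply: eq_bigr => l _.
rewrite (partialZ _ (smooth_on_derivable (smooth_on_partial l sF) Ux)).
exact: mulrA.
Qed.

Lemma fdC i j F : smooth F -> {in U, fd i (fd j F) =1 fd j (fd i F)}.
Proof.
move=> sF x Ux; rewrite !fd_fdE // exchange_big; apply: eq_bigr => k _; apply: eq_bigr => l _ /=.
by rewrite (partialC l k oU sF Ux) [Q i l * _]mulrC.
Qed.

Lemma partial_fd j F x : partial j F x = \sum_(i < 3) Q i j * fd i F x.
Proof.
rewrite /fd; under eq_bigr do rewrite mulr_sumr; rewrite exchange_big /=.
rewrite (bigD1 j) //= [X in _ + X]big1 ?addr0 => [|k kj].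
  under eq_bigr do rewrite mulrA; by rewrite -mulr_suml Qcol eqxx mul1r.
by under eq_bigr do rewrite mulrA; rewrite -mulr_suml Qcol eq_sym (negPf kj) mul0r.
Qed.

(** The frame being orthonormal, partial derivatives and frame derivatives are
combinations of each other. *)
Lemma vanishS_fd k F : smooth F -> vanish k.+1 p F <-> forall i, vanish k p (fd i F).
Proof.
move=> sF; split=> [/vanishS H i|H].
  by apply: (vanish_sum _ oU Up) => j; [apply: (smooth_onZ _ oU)|apply: (vanishZ _ oU Up) (H j)];
    exact: smooth_on_partial.
apply/vanishS => j; rewrite (_ : partial j F = fun x => \sum_(i < 3) Q i j * fd i F x); last first.
  by apply/funext => x; exact: partial_fd.
by apply: (vanish_sum _ oU Up) => i; [apply: (smooth_onZ _ oU)|apply: (vanishZ _ oU Up) (H i)];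
    exact: fd_smooth.
Qed.

Definition frame_partial (a b c : nat) F := iter a (fd 0) (iter b (fd 1) (iter c (fd 2) F)).
Definition jet (a b c : nat) F : R := frame_partial a b c F p.

Lemma iter_fd_smooth n i F : smooth F -> smooth (iter n (fd i) F).
Proof. by move=> sF; elim: n => [|n IH]; [exact: sF|exact: fd_smooth IH]. Qed.

Lemma iter_fd_eq_on n i F G : {in U, F =1 G} -> {in U, iter n (fd i) F =1 iter n (fd i) G}.
Proof. by move=> FG; elim: n => [|n IH]; [exact: FG|exact: fd_eq_on IH]. Qed.

Lemma iter_fdC n i j F : smooth F -> {in U, iter n (fd i) (fd j F) =1 fd j (iter n (fd i) F)}.
Proof.
move=> sF; elim: n => [|n IH] x Ux //=.
by rewrite (fd_eq_on i IH Ux) (fdC i j (iter_fd_smooth n i sF) Ux).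
Qed.

Lemma jet_eq_on a b c F G : {in U, F =1 G} -> jet a b c F = jet a b c G.
Proof.
move=> FG; rewrite /jet /frame_partial; apply: iter_fd_eq_on (mem_set Up).
by apply: iter_fd_eq_on; exact: iter_fd_eq_on.
Qed.

Lemma jet_fd2 a b c F : jet a b c (fd 2 F) = jet a b c.+1 F.
Proof. by rewrite /jet /frame_partial iterSr. Qed.

Lemma jet_fd1 a b c F : smooth F -> jet a b c (fd 1 F) = jet a b.+1 c F.
Proof.
move=> sF; rewrite /jet /frame_partial iterSr; apply: iter_fd_eq_on (mem_set Up).
by apply: iter_fd_eq_on; exact: iter_fdC.
Qed.

Lemma jet_fd0 a b c F : smooth F -> jet a b c (fd 0 F) = jet a.+1 b c F.
Proof.
move=> sF; rewrite /jet /frame_partial iterSr; apply: iter_fd_eq_on (mem_set Up).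
move=> x Ux; rewrite (iter_fd_eq_on b 1 (iter_fdC c 2 0 sF) Ux) (iter_fdC b 1 0 (iter_fd_smooth c 2 sF) Ux).
by [].
Qed.

(** Jets are computed from the innermost derivation outwards: the last nonzero index is
lowered by replacing [F] with its derivative. The case for a derivative comes together
with that for [F] itself, which the product rule requires. *)
Lemma jet_ind (P : nat -> nat -> nat -> (R3 -> R) -> Prop) :
  (forall F, smooth F -> P 0%N 0%N 0%N F) ->
  (forall a F, smooth F -> P a 0%N 0%N (fd 0 F) -> P a 0%N 0%N F -> P a.+1 0%N 0%N F) ->
  (forall a b F, smooth F -> P a b 0%N (fd 1 F) -> P a b 0%N F -> P a b.+1 0%N F) ->
  (forall a b c F, smooth F -> P a b c (fd 2 F) -> P a b c F -> P a b c.+1 F) ->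
  forall a b c F, smooth F -> P a b c F.
Proof.
move=> H0 H1 H2 H3 a b c; elim: c => [|c IH] F sF; last first.
  exact: H3 sF (IH _ (fd_smooth 2 sF)) (IH _ sF).
elim: b F sF => [|b IH] F sF; last exact: H2 sF (IH _ (fd_smooth 1 sF)) (IH _ sF).
elim: a F sF => [|a IH] F sF; last exact: H1 sF (IH _ (fd_smooth 0 sF)) (IH _ sF).
exact: H0.
Qed.

Lemma jetD a b c F G : smooth F -> smooth G ->
  jet a b c (fun x => F x + G x) = jet a b c F + jet a b c G.
Proof.
move=> sF; move: a b c F sF G.
apply: (jet_ind (P := fun a b c F => forall G, smooth G -> jet a b c (fun x => F x + G x) = jet a b c F + jet a b c G)) => //.
- move=> a F sF IH _ G sG; rewrite -(jet_fd0 _ _ _ (smooth_onD oU sF sG)) -(jet_fd0 _ _ _ sF) -(jet_fd0 _ _ _ sG).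
  by rewrite -IH; [apply: jet_eq_on; exact: fdD|exact: fd_smooth].
- move=> a b F sF IH _ G sG; rewrite -(jet_fd1 _ _ _ (smooth_onD oU sF sG)) -(jet_fd1 _ _ _ sF) -(jet_fd1 _ _ _ sG).
  by rewrite -IH; [apply: jet_eq_on; exact: fdD|exact: fd_smooth].
- move=> a b c F sF IH _ G sG; rewrite -!jet_fd2.
  by rewrite -IH; [apply: jet_eq_on; exact: fdD|exact: fd_smooth].
Qed.

Lemma jetZ a b c k F : smooth F -> jet a b c (fun x => k * F x) = k * jet a b c F.
Proof.
move: a b c F.
apply: (jet_ind (P := fun a b c F => jet a b c (fun x => k * F x) = k * jet a b c F)) => //.
- move=> a F sF IH _; rewrite -(jet_fd0 _ _ _ (smooth_onZ k oU sF)) -(jet_fd0 _ _ _ sF).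
  by rewrite -IH; apply: jet_eq_on; exact: fdZ.
- move=> a b F sF IH _; rewrite -(jet_fd1 _ _ _ (smooth_onZ k oU sF)) -(jet_fd1 _ _ _ sF).
  by rewrite -IH; apply: jet_eq_on; exact: fdZ.
- move=> a b c F sF IH _; rewrite -!jet_fd2.
  by rewrite -IH; apply: jet_eq_on; exact: fdZ.
Qed.

Lemma jet_vanish a b c F : smooth F -> vanish (a + b + c) p F -> jet a b c F = 0.
Proof.
move: a b c F.
apply: (jet_ind (P := fun a b c F => vanish (a + b + c) p F -> jet a b c F = 0)).
- by move=> F sF /vanish0.
- by move=> a F sF IH _; rewrite !addSn => /(vanishS_fd _ sF)/(_ 0)/IH; rewrite jet_fd0.
- by move=> a b F sF IH _; rewrite addnS !addSn => /(vanishS_fd _ sF)/(_ 1)/IH; rewrite jet_fd1.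
- by move=> a b c F sF IH _; rewrite addnS => /(vanishS_fd _ sF)/(_ 2)/IH; rewrite jet_fd2.
Qed.

Lemma vanish_jet k F : smooth F ->
  (forall a b c, (a + b + c)%N = k -> jet a b c F = 0) -> vanish k p F.
Proof.
elim: k F => [|k IH] F sF H; first by apply/vanish0; exact: (H 0 0 0)%N.
apply/(vanishS_fd _ sF); apply: ord3_ind; apply: IH; try exact: fd_smooth; move=> a b c abc.
- by rewrite jet_fd0 // H // !addSn abc.
- by rewrite jet_fd1 // H // addnS addSn abc.
- by rewrite jet_fd2 // H // addnS abc.
Qed.

Definition xi (k : 'I_3) : R3 -> R := fun x => \sum_(j < 3) Q k j * (x 0 j - p 0 j).

Lemma smooth_shift_coord j : smooth (fun x => x 0 j - p 0 j).
Proof. exact: (smooth_onD oU (smooth_on_coord j oU) (smooth_on_cst (- p 0 j) oU)). Qed.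

Lemma xi_smooth k : smooth (xi k).
Proof.
apply: (smooth_on_sum _ oU) => j; apply: (smooth_onZ _ oU); exact: smooth_shift_coord.
Qed.

Lemma xi_p k : xi k p = 0.
Proof. by rewrite /xi big1 // => j _; rewrite subrr mulr0. Qed.

Lemma fd_xi i k : {in U, fd i (xi k) =1 fun=> (i == k)%:R}.
Proof.
move=> x /set_mem Ux; rewrite -Qrow /fd; apply: eq_bigr => l _; congr (_ * _).
have [|_ ->] := @partial_sum R 'I_3 (index_enum 'I_3) (fun j x => Q k j * (x 0 j - p 0 j)) x l.
  by move=> j; apply: smooth_on_derivable Ux; apply: (smooth_onZ _ oU); exact: smooth_shift_coord.
have E j : partial l (fun x => Q k j * (x 0 j - p 0 j)) x = Q k j * (l == j)%:R.
  rewrite (partialZ _ (smooth_on_derivable (smooth_shift_coord j) Ux)).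
  rewrite (partialD (smooth_on_derivable (smooth_on_coord j oU) Ux) (derivable_cst _ _ _)).
  by rewrite partial_coord partial_cst addr0.
under eq_bigr do rewrite E.
by rewrite (bigD1 l) //= eqxx mulr1 big1 ?addr0 // => j /negPf jl; rewrite eq_sym jl mulr0.
Qed.

Lemma fd_xiM i k F : smooth F ->
  {in U, fd i (fun x => xi k x * F x) =1 fun x => (i == k)%:R * F x + xi k x * fd i F x}.
Proof. by move=> sF x Ux; rewrite (fdM i (xi_smooth k) sF Ux) (fd_xi i k Ux). Qed.

(** The Leibniz rule for a factor that is linear in the frame coordinates and vanishes
at [p]. *)
Lemma jet_xi k a b c F : smooth F -> jet a b c (fun x => xi k x * F x) =
  (0 == k)%:R * a%:R * jet a.-1 b c F + (1 == k)%:R * b%:R * jet a b.-1 c F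
  + (2 == k)%:R * c%:R * jet a b c.-1 F.
Proof.
move: a b c F.
apply: (jet_ind (P := fun a b c F => jet a b c (fun x => xi k x * F x) = _)).
- by move=> F sF; rewrite /jet /frame_partial /= xi_p !mulr0 !mul0r !addr0.
- move=> a F sF IH _; have sx := smooth_onM oU (xi_smooth k) sF.
  have s' := fd_smooth 0 sF; have sx' := smooth_onM oU (xi_smooth k) s'.
  rewrite -(jet_fd0 _ _ _ sx) (jet_eq_on _ _ _ (fd_xiM 0 k sF)) (jetD _ _ _ (smooth_onZ _ oU sF) sx').
  rewrite (jetZ _ _ _ _ sF) IH !mulr0 !mul0r !addr0 -natr1.
  by case: a {IH} => [|a]; rewrite /= ?(jet_fd0 _ _ _ sF); ring.
- move=> a b F sF IH _; have sx := smooth_onM oU (xi_smooth k) sF.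
  have s' := fd_smooth 1 sF; have sx' := smooth_onM oU (xi_smooth k) s'.
  rewrite -(jet_fd1 _ _ _ sx) (jet_eq_on _ _ _ (fd_xiM 1 k sF)) (jetD _ _ _ (smooth_onZ _ oU sF) sx').
  rewrite (jetZ _ _ _ _ sF) IH !mulr0 !mul0r !addr0 -natr1.
  by case: b {IH} => [|b]; rewrite /= ?(jet_fd1 _ _ _ sF); ring.
- move=> a b c F sF IH _; have sx := smooth_onM oU (xi_smooth k) sF.
  have s' := fd_smooth 2 sF; have sx' := smooth_onM oU (xi_smooth k) s'.
  rewrite -jet_fd2 (jet_eq_on _ _ _ (fd_xiM 2 k sF)) (jetD _ _ _ (smooth_onZ _ oU sF) sx').
  rewrite (jetZ _ _ _ _ sF) IH -natr1.
  by case: c {IH} => [|c]; rewrite /= ?jet_fd2; ring.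
Qed.

End Frame.

(** * The Beltrami equations in a frame *)

Section BeltramiJets.
Context {R : realType}.

(** The antisymmetric part of [d], contracted with [a] and [b], only sees their cross
product. *)
Lemma rotate_curl (a b : 'I_3 -> R) (d : 'I_3 -> 'I_3 -> R) :
  \sum_(j < 3) \sum_(l < 3) a j * b l * d j l - \sum_(j < 3) \sum_(l < 3) b j * a l * d j l =
  (a 1 * b 2 - a 2 * b 1) * (d 1 2 - d 2 1) + (a 2 * b 0 - a 0 * b 2) * (d 2 0 - d 0 2) +
  (a 0 * b 1 - a 1 * b 0) * (d 0 1 - d 1 0).
Proof.
rewrite !sum3; move: (a 0) (a 1) (a 2) (b 0) (b 1) (b 2) (d 0) (d 1) (d 2) => a0 a1 a2 b0 b1 b2 d0 d1 d2.
by move: (d0 0) (d0 1) (d0 2) (d1 0) (d1 1) (d1 2) (d2 0) (d2 1) (d2 2) => *; ring.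
Qed.

Lemma div_curl_cancel (a b c f f0 f1 f2 y0 y1 y2 e0 e1 e2 : R) :
  a - b = f0 * y0 + f * e0 -> c - a = f1 * y1 + f * e1 -> b - c = f2 * y2 + f * e2 ->
  f * (e0 + e1 + e2) = 0 -> f0 * y0 + f1 * y1 + f2 * y2 = 0.
Proof. by lra. Qed.

Local Notation R3 := 'rV[R]_3.
Variables (U : set R3) (p : R3) (f : R3 -> R) (X : R3 -> R3).
Hypotheses (oU : open U) (Up : U p) (sf : smooth_on U f).
Hypothesis BX : divfree_beltrami_field U f X.
Implicit Types (x y z : R3) (F G : R3 -> R).

Let sX j : smooth_on U (component X j). Proof. case: BX => H _ _; exact: H. Qed.

Lemma beltrami_curlE i x : U x ->
  partial (i + 1) (component X (i + 2)) x - partial (i + 2) (component X (i + 1)) x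
  = f x * component X i x.
Proof.
move=> Ux; case: BX => _ /(_ x Ux) H _.
by move: H => /(congr1 (fun v : R3 => v 0 i)); rewrite !mxE.
Qed.

Lemma beltrami_curl i j k : (i + 1 = j)%R -> (i + 2 = k)%R ->
  {in U, (fun x => partial j (component X k) x + (-1) * partial k (component X j) x)
      =1 (fun x => f x * component X i x)}.
Proof. by move=> <- <- x /set_mem Ux; rewrite mulN1r; exact: beltrami_curlE. Qed.

Lemma beltrami_div x : U x -> \sum_(i < 3) partial i (component X i) x = 0.
Proof. by case: BX => _ _; apply. Qed.

Lemma beltrami_curl_partial i j k l x : (i + 1 = j)%R -> (i + 2 = k)%R -> U x ->
  partial l (partial j (component X k)) x - partial l (partial k (component X j)) x
  = partial l f x * component X i x + f x * partial l (component X i) x.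
Proof.
move=> ij ik Ux; have := partial_eq_on l oU (beltrami_curl ij ik) (mem_set Ux).
have dj := smooth_on_partial j (sX k); have dk := smooth_on_partial k (sX j).
rewrite (partialD (smooth_on_derivable dj Ux) (smooth_on_derivable (smooth_onZ _ oU dk) Ux)).
rewrite (partialZ _ (smooth_on_derivable dk Ux)) mulN1r => ->.
exact: (partialM (smooth_on_derivable sf Ux) (smooth_on_derivable (sX i) Ux)).
Qed.

Lemma beltrami_div_partial l x : U x ->
  \sum_(i < 3) partial l (partial i (component X i)) x = 0.
Proof.
move=> Ux; have [|_ <-] := @partial_sum R 'I_3 (index_enum 'I_3) (fun i => partial i (component X i)) x l.
  by move=> i; exact: (smooth_on_derivable (smooth_on_partial i (sX i)) Ux).
rewrite (partial_eq_on (G := fun=> 0) l oU) ?partial_cst // ?mem_set //.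
by move=> z /set_mem Uz; exact: beltrami_div.
Qed.

(** The divergence of [curl X = f X] is [0 = grad f . X + f div X]. *)
Lemma beltrami_grad x : U x -> \sum_(i < 3) partial i f x * component X i x = 0.
Proof.
move=> Ux; have Ux' := mem_set Ux.
have D (i j k l : 'I_3) (ij : (i + 1 = j)%R) (ik : (i + 2 = k)%R) :
    partial l (partial j (component X k)) x - partial l (partial k (component X j)) x
    = partial l f x * component X i x + f x * partial l (component X i) x.
  exact: beltrami_curl_partial.
have D0 := D 0 1 2 0 ltac:(by apply/val_inj) ltac:(by apply/val_inj).
have D1 := D 1 2 0 1 ltac:(by apply/val_inj) ltac:(by apply/val_inj).
have D2 := D 2 0 1 2 ltac:(by apply/val_inj) ltac:(by apply/val_inj).
have S i j k := partialC i j oU (sX k) Ux'.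
rewrite (S 2 0) in D2; rewrite (S 1 0) in D1; rewrite (S 2 1) in D2.
have := beltrami_div Ux; rewrite !sum3.
move: D0 D1 D2.
move: (partial 0 (partial 1 _) x) (partial 0 (partial 2 _) x) (partial 1 (partial 2 _) x) => d01 d02 d12 D0 D1 D2 dv.
have : f x * (partial 0 (component X 0) x + partial 1 (component X 1) x + partial 2 (component X 2) x) = 0.
  by rewrite dv mulr0.
exact: div_curl_cancel D0 D1 D2.
Qed.

Section Frame.
Variables (Q : 'M[R]_3).
Hypothesis Qcol : forall j k, \sum_(i < 3) Q i j * Q i k = (j == k)%:R.
Hypothesis Qrow : forall i k, \sum_(j < 3) Q i j * Q k j = (i == k)%:R.
Hypothesis Qcross : forall i j,
  Q (i + 1) (j + 1) * Q (i + 2) (j + 2) - Q (i + 1) (j + 2) * Q (i + 2) (j + 1) = Q i j.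

Definition frame_component i : R3 -> R := fun x => \sum_(j < 3) Q i j * component X j x.
Local Notation Y := frame_component.
Local Notation fd := (fd Q).

Lemma frame_component_smooth i : smooth_on U (Y i).
Proof. apply: (smooth_on_sum _ oU) => j; exact: (smooth_onZ _ oU (sX j)). Qed.

Lemma fd_frame_component i k x : U x -> fd i (Y k) x =
  \sum_(j < 3) \sum_(l < 3) Q i j * Q k l * partial j (component X l) x.
Proof.
move=> Ux; rewrite /fd; apply: eq_bigr => j _.
have [|_ ->] := @partial_sum R 'I_3 (index_enum 'I_3) (fun l x => Q k l * component X l x) x j.
  by move=> l; apply: smooth_on_derivable Ux; exact: (smooth_onZ _ oU (sX l)).
rewrite mulr_sumr; apply: eq_bigr => l _.
by rewrite (partialZ _ (smooth_on_derivable (sX l) Ux)) mulrA.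
Qed.

(** Curl commutes with rotations: this is where the frame has to be positively oriented.
*)
Lemma frame_curl i x : U x ->
  fd (i + 1) (Y (i + 2)) x - fd (i + 2) (Y (i + 1)) x = f x * Y i x.
Proof.
move=> Ux; rewrite !fd_frame_component //.
have E (l j k : 'I_3) (H : (l + 1 = j)%R) (H' : (l + 2 = k)%R) := beltrami_curl H H' (mem_set Ux).
have := E 0 1 2 ltac:(by apply/val_inj) ltac:(by apply/val_inj).
have := E 1 2 0 ltac:(by apply/val_inj) ltac:(by apply/val_inj).
have := E 2 0 1 ltac:(by apply/val_inj) ltac:(by apply/val_inj).
have := Qcross i 0; have := Qcross i 1; have := Qcross i 2.
rewrite !ord3_21 !ord3_22 !ord3_11 !ord3_12 !ord3_01 !ord3_02.
rewrite !mulN1r => q2 q1 q0 c2 c1 c0.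
rewrite [LHS](_ : _ = (Q (i + 1) 1 * Q (i + 2) 2 - Q (i + 1) 2 * Q (i + 2) 1) * (f x * component X 0 x) +
  (Q (i + 1) 2 * Q (i + 2) 0 - Q (i + 1) 0 * Q (i + 2) 2) * (f x * component X 1 x) +
  (Q (i + 1) 0 * Q (i + 2) 1 - Q (i + 1) 1 * Q (i + 2) 0) * (f x * component X 2 x)); last first.
  rewrite -c0 -c1 -c2.
  exact: (rotate_curl (Q (i + 1)) (Q (i + 2)) (fun j l => partial j (component X l) x)).
by rewrite q0 q1 q2 /frame_component (sum3 (M := R)) !mulrDr ![f x * (_ * _)]mulrCA.
Qed.

Lemma frame_div x : U x -> fd 0 (Y 0) x + fd 1 (Y 1) x + fd 2 (Y 2) x = 0.
Proof.
move=> Ux; rewrite -(beltrami_div Ux) -(sum3 (fun i => fd i (Y i) x)).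
under eq_bigr do rewrite fd_frame_component //.
rewrite exchange_big; apply: eq_bigr => j _ /=.
rewrite exchange_big (bigD1 j) //= [X in _ + X]big1 ?addr0 => [|l /negPf lj].
  by rewrite -mulr_suml Qcol eqxx mul1r.
by rewrite -mulr_suml Qcol eq_sym lj mul0r.
Qed.

Lemma frame_grad x : U x -> fd 0 f x * Y 0 x + fd 1 f x * Y 1 x + fd 2 f x * Y 2 x = 0.
Proof.
move=> Ux; rewrite -(beltrami_grad Ux) -(sum3 (fun i => fd i f x * Y i x)).
transitivity (\sum_(i < 3) \sum_(j < 3) \sum_(k < 3)
    Q i j * Q i k * (partial j f x * component X k x)).
  apply: eq_bigr => i _; rewrite /fd /Y mulr_suml; apply: eq_bigr => j _.
  by rewrite mulr_sumr; apply: eq_bigr => k _; ring.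
rewrite exchange_big; apply: eq_bigr => j _ /=.
rewrite exchange_big (bigD1 j) //= [X in _ + X]big1 ?addr0 => [|l /negPf lj].
  by rewrite -mulr_suml Qcol eqxx mul1r.
by rewrite -mulr_suml Qcol eq_sym lj mul0r.
Qed.

End Frame.
End BeltramiJets.

(** * The Taylor series of the field vanishes *)

Section FormalVanishing.
Context {R : realType}.
Local Notation R3 := 'rV[R]_3.
Variables (U : set R3) (p : R3) (f : R3 -> R) (X : R3 -> R3).
Hypotheses (oU : open U) (Up : U p) (sf : smooth_on U f).
Hypothesis BX : divfree_beltrami_field U f X.
Variables (Q : 'M[R]_3) (lam : 'I_3 -> R).
Hypothesis Qcol : forall j k, \sum_(i < 3) Q i j * Q i k = (j == k)%:R.
Hypothesis Qrow : forall i k, \sum_(j < 3) Q i j * Q k j = (i == k)%:R.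
Hypothesis Qcross : forall i j,
  Q (i + 1) (j + 1) * Q (i + 2) (j + 2) - Q (i + 1) (j + 2) * Q (i + 2) (j + 1) = Q i j.
Local Notation fd := (fd Q).
Local Notation jet := (jet p Q).
Local Notation xi := (xi p Q).
Local Notation Y := (frame_component X Q).
Local Notation smooth := (smooth_on U).
Hypothesis lam_neq0 : forall i, lam i != 0.
Hypothesis crit : forall i, fd i f p = 0.
Hypothesis hess : forall i k, fd i (fd k f) p = lam k * (i == k)%:R.
Hypotheses (f3 : vanish 3 p f) (f5 : vanish 5 p f).

Let Up' : p \in U := mem_set Up.
Let sY i : smooth (Y i) := frame_component_smooth oU BX Q i.
Let sfd i : smooth (fd i f) := fd_smooth Q oU i sf.
Let sxi i : smooth (xi i) := xi_smooth p Q oU i.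

(** Of the gradient of [f], only the linear part enters the equations between jets; for
the rest the orders of the derivatives that vanish at [p] are all that matters. *)
Definition grad_rem i : R3 -> R := fun x => fd i f x + - lam i * xi i x.

Lemma grad_rem_smooth i : smooth (grad_rem i).
Proof. exact: (smooth_onD oU (sfd i) (smooth_onZ _ oU (sxi i))). Qed.

Lemma fd_grad_rem j i : {in U, fd j (grad_rem i) =1 fun x => fd j (fd i f) x + - lam i * (j == i)%:R}.
Proof.
move=> x Ux; rewrite (fdD Q j (sfd i) (smooth_onZ _ oU (sxi i)) Ux).
by rewrite (fdZ Q oU j _ (sxi i) Ux) (fd_xi p oU Qrow j i Ux).
Qed.

Lemma grad_rem_vanish0 i : vanish 0 p (grad_rem i).
Proof. by apply/vanish0; rewrite /grad_rem crit xi_p mulr0 addr0. Qed.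

Lemma grad_rem_vanish1 i : vanish 1 p (grad_rem i).
Proof.
apply/(vanishS_fd oU Up Qcol _ (grad_rem_smooth i)) => j; apply/vanish0.
by rewrite (fd_grad_rem j i Up') hess mulNr subrr.
Qed.

Lemma grad_rem_vanish k i : vanish k.+3 p f -> vanish k.+2 p (grad_rem i).
Proof.
move=> /(vanishS_fd oU Up Qcol _ sf)/(_ i)/(vanishS_fd oU Up Qcol _ (sfd i)) H.
apply/(vanishS_fd oU Up Qcol _ (grad_rem_smooth i)) => j.
have sj := fd_smooth Q oU j (grad_rem_smooth i).
have sfj := fd_smooth Q oU j (sfd i).
apply/(vanishS_fd oU Up Qcol _ sj) => l.
have /(vanishS_fd oU Up Qcol _ sfj)/(_ l) := H j.
apply: (vanish_eq_on oU Up) => x Ux.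
rewrite (fd_eq_on Q oU l (fd_grad_rem j i) Ux).
by rewrite (fdD Q l sfj (smooth_on_cst _ oU) Ux) fd_cst addr0.
Qed.

(** The term of degree two of the Taylor series of [f], in frame coordinates. *)
Definition quad_part : R3 -> R := fun x => 2^-1 * \sum_(k < 3) lam k * (xi k x * xi k x).

Let sxx k : smooth (fun x => lam k * (xi k x * xi k x)) :=
  smooth_onZ (lam k) oU (smooth_onM oU (sxi k) (sxi k)).
Let sq : smooth quad_part := smooth_onZ 2^-1 oU (smooth_on_sum _ oU sxx).

Lemma fd_quad_part i : {in U, fd i quad_part =1 fun x => lam i * xi i x}.
Proof.
move=> x Ux; rewrite (fdZ Q oU i _ (smooth_on_sum _ oU sxx) Ux).
rewrite (_ : (fun y => \sum_(k < 3) lam k * (xi k y * xi k y)) =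
   fun y => lam 0 * (xi 0 y * xi 0 y) + lam 1 * (xi 1 y * xi 1 y) + lam 2 * (xi 2 y * xi 2 y)); last first.
  by apply/funext => y; rewrite sum3.
rewrite (fdD Q i (smooth_onD oU (sxx 0) (sxx 1)) (sxx 2) Ux).
rewrite (fdD Q i (sxx 0) (sxx 1) Ux).
have E k : fd i (fun y => lam k * (xi k y * xi k y)) x = lam k * ((i == k)%:R * xi k x *+ 2).
  rewrite (fdZ Q oU i _ (smooth_onM oU (sxi k) (sxi k)) Ux).
  by rewrite (fdM Q i (sxi k) (sxi k) Ux) (fd_xi p oU Qrow i k Ux) [xi k x * _]mulrC mulr2n.
rewrite !E; move: i {E}; apply: ord3_ind; rewrite /= !mul0r !mul1r !mul0rn !mulr0 ?addr0 ?add0r; lra.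
Qed.

Definition fun_rem : R3 -> R := fun x => f x + -1 * quad_part x.

Lemma fun_rem_smooth : smooth fun_rem.
Proof. exact: (smooth_onD oU sf (smooth_onZ _ oU sq)). Qed.

Lemma fun_rem_vanish0 : f p = 0 -> vanish 0 p fun_rem.
Proof.
move=> fp; apply/vanish0; rewrite /fun_rem /quad_part fp big1 ?mulr0 ?addr0 // => k _.
by rewrite xi_p !mulr0.
Qed.

Lemma fun_remS k : (forall i, vanish k p (grad_rem i)) -> vanish k.+1 p fun_rem.
Proof.
move=> H; apply/(vanishS_fd oU Up Qcol _ fun_rem_smooth) => i.
apply: (vanish_eq_on oU Up _ (H i)) => x Ux.
rewrite (fdD Q i sf (smooth_onZ _ oU sq) Ux) (fdZ Q oU i _ sq Ux) (fd_quad_part i Ux).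
by rewrite /grad_rem mulrA mulN1r.
Qed.

Lemma jet_quad_part F a b c : smooth F ->
  jet a b c (fun x => quad_part x * F x) =
  quad_source (lam 0) (lam 1) (lam 2) (fun a b c => jet a b c F) a b c.
Proof.
move=> sF.
have sk k : smooth (fun x => xi k x * F x) := smooth_onM oU (sxi k) sF.
have skk k : smooth (fun x => xi k x * (xi k x * F x)) := smooth_onM oU (sxi k) (sk k).
have slk k : smooth (fun x => lam k * (xi k x * (xi k x * F x))) := smooth_onZ _ oU (skk k).
rewrite (_ : (fun x => quad_part x * F x) = fun x => 2^-1 *
  (lam 0 * (xi 0 x * (xi 0 x * F x)) + lam 1 * (xi 1 x * (xi 1 x * F x)) + lam 2 * (xi 2 x * (xi 2 x * F x)))); last first.
  apply/funext => x; rewrite /quad_part sum3.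
  by move: (xi 0 x) (xi 1 x) (xi 2 x) => *; ring.
rewrite (jetZ Q oU Up _ _ _ _ (smooth_onD oU (smooth_onD oU (slk 0) (slk 1)) (slk 2))).
rewrite (jetD Q oU Up _ _ _ (smooth_onD oU (slk 0) (slk 1)) (slk 2)).
rewrite (jetD Q oU Up _ _ _ (slk 0) (slk 1)).
rewrite !(jetZ Q oU Up _ _ _ _ (skk _)).
rewrite !(jet_xi oU Up Qrow _ _ _ _ (sk _)).
rewrite !(jet_xi oU Up Qrow _ _ _ _ sF) /quad_source /= !natrM.
ring.
Qed.

Let y i : nat -> nat -> nat -> R := fun a b c => jet a b c (Y i).

(** The equations satisfied by the field, differentiated at [p], form a level as soon as
the nonlinear part of the gradient does not contribute to [grad f . X = 0] at that
order. *)
Lemma jet_level N (F : 'I_3 -> nat -> nat -> nat -> R) :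
  (forall i a b c, (a + b + c).+1 = N -> jet a b c (fun x => f x * Y i x) = F i a b c) ->
  (forall i, vanish N.+1 p (fun x => grad_rem i x * Y i x)) ->
  level_eqs (lam 0) (lam 1) (lam 2) N (y 0) (y 1) (y 2) (F 0) (F 1) (F 2).
Proof.
move=> HF HG.
have curl (i j k : 'I_3) a b c : (i + 1 = j)%R -> (i + 2 = k)%R -> (a + b + c).+1 = N ->
    jet a b c (fd j (Y k)) - jet a b c (fd k (Y j)) = F i a b c.
  move=> ij ik abc; rewrite -(HF i a b c abc).
  have s1 := fd_smooth Q oU j (sY k); have s2 := fd_smooth Q oU k (sY j).
  rewrite -mulN1r -(jetZ Q oU Up _ _ _ _ s2) -(jetD Q oU Up _ _ _ s1 (smooth_onZ _ oU s2)).
  apply: (jet_eq_on Q oU Up) => x /set_mem Ux; rewrite mulN1r -ij -ik.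
  exact: (frame_curl oU BX Qcross).
split=> a b c abc.
- rewrite -(curl 0 1 2) //; try exact/val_inj.
  by rewrite (jet_fd1 Q oU Up _ _ _ (sY 2)) jet_fd2.
- rewrite -(curl 1 2 0) //; try exact/val_inj.
  by rewrite (jet_fd0 Q oU Up _ _ _ (sY 2)) jet_fd2.
- rewrite -(curl 2 0 1) //; try exact/val_inj.
  by rewrite (jet_fd1 Q oU Up _ _ _ (sY 0)) (jet_fd0 Q oU Up _ _ _ (sY 1)).
- rewrite /y -(jet_fd0 Q oU Up _ _ _ (sY 0)) -(jet_fd1 Q oU Up _ _ _ (sY 1)) -jet_fd2.
  have s0 := fd_smooth Q oU 0 (sY 0); have s1 := fd_smooth Q oU 1 (sY 1).
  have s2 := fd_smooth Q oU 2 (sY 2).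
  rewrite -(jetD Q oU Up _ _ _ s0 s1) -(jetD Q oU Up _ _ _ (smooth_onD oU s0 s1) s2).
  rewrite (jet_eq_on Q oU Up _ _ _ (G := fun=> 0)).
    by apply: (jet_vanish oU Up Qcol); [exact: smooth_on_cst|exact: vanish_cst0].
  by move=> x /set_mem Ux; exact: (frame_div oU BX Qcol).
- have sg i : smooth (fun x => grad_rem i x * Y i x) := smooth_onM oU (grad_rem_smooth i) (sY i).
  have sx i : smooth (fun x => xi i x * Y i x) := smooth_onM oU (sxi i) (sY i).
  have slx i : smooth (fun x => lam i * (xi i x * Y i x)) := smooth_onZ _ oU (sx i).
  have H i : jet a b c (fun x => grad_rem i x * Y i x) = 0.
    by apply: (jet_vanish oU Up Qcol (sg i)); rewrite abc; exact: HG.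
  have Z : jet a b c (fun x => fd 0 f x * Y 0 x + fd 1 f x * Y 1 x + fd 2 f x * Y 2 x) = 0.
    rewrite (jet_eq_on Q oU Up _ _ _ (G := fun=> 0)).
      by apply: (jet_vanish oU Up Qcol); [exact: smooth_on_cst|exact: vanish_cst0].
    by move=> x /set_mem Ux; exact: (frame_grad oU sf BX Qcol).
  have sfy i : smooth (fun x => fd i f x * Y i x) := smooth_onM oU (sfd i) (sY i).
  rewrite (jetD Q oU Up _ _ _ (smooth_onD oU (sfy 0) (sfy 1)) (sfy 2)) in Z.
  rewrite (jetD Q oU Up _ _ _ (sfy 0) (sfy 1)) in Z.
  have E i : jet a b c (fun x => fd i f x * Y i x) = lam i * jet a b c (fun x => xi i x * Y i x).
    rewrite -[RHS]add0r -(H i) -(jetZ Q oU Up _ _ _ _ (sx i)) -(jetD Q oU Up _ _ _ (sg i) (slx i)).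
    congr (jet a b c _); apply/funext => x; rewrite /grad_rem; ring.
  rewrite !E !(jet_xi oU Up Qrow _ _ _ _ (sY _)) in Z.
  rewrite -Z /y /=; ring.
Qed.

Lemma jet_of_potential m : (forall a b c, (a + b + c)%N = m.+1 -> potential (y 0) (y 1) (y 2) a b c = 0) ->
  level_eqs (lam 0) (lam 1) (lam 2) m (y 0) (y 1) (y 2) arr0 arr0 arr0 ->
  forall i, vanish m p (Y i).
Proof.
move=> Z E i; apply: (vanish_jet oU Up Qcol) (sY i) _ => a b c abc.
rewrite -/(y i a b c); move: i; apply: ord3_ind.
- by rewrite -(potential1 _ (y 1) (y 2)) Z // !addSn abc.
- by rewrite -(potential2 E) // Z // addnS addSn abc.
- by rewrite -(potential3 E) // Z // addnS abc.
Qed.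

(** Induction on the order [m]: the jets below [m] are zero, so those of order [m]
satisfy the homogeneous equations and derive from a potential. If [f p] is not zero, the
jets of order [m.+1] form the second level. If it is zero, they satisfy homogeneous
equations too, so vanish by [consecutive_levels] if those of order [m] do not, and then
the jets of order [m.+3] form the second level. In every product that has to be
negligible, the factors of [X] of order below [m] (in the last case also of order
[m.+1]) vanish, and so do the derivatives of [f] of orders three and five: the term
[f_4] meets only the jets of order [m.+1]. *)
Lemma frame_component_vanish m i : vanish m p (Y i).
Proof.
elim/ltn_ind: m i => m IH.
have prod_vanish N G i : smooth G -> (forall k l, (k + l)%N = N -> (m <= l)%N ->
    vanish k p G \/ vanish l p (Y i)) -> vanish N p (fun x => G x * Y i x).
  move=> sG H; apply: (vanishM oU Up sG (sY i)) => k l kl.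
  by have [lm|ml] := ltnP l m; [right; exact: IH|exact: H].
have g0 i := grad_rem_vanish0 i; have g1 i := grad_rem_vanish1 i.
have g2 i : vanish 2 p (grad_rem i) := grad_rem_vanish i f3.
have g4 i : vanish 4 p (grad_rem i) := grad_rem_vanish i f5.
have E : level_eqs (lam 0) (lam 1) (lam 2) m (y 0) (y 1) (y 2) arr0 arr0 arr0.
  apply: (jet_level (F := fun _ => arr0)) => [i a b c abc|i].
    apply: (jet_vanish oU Up Qcol (smooth_onM oU sf (sY i))).
    by apply: prod_vanish sf _ => k l; lia.
  apply: prod_vanish (grad_rem_smooth i) _ => -[|[|k]] l kl ml; [by left|by left|lia].
apply: jet_of_potential (E) => a b c abc.
have [fp|fp] := eqVneq (f p) 0; last first.
  apply: (level_zero _ _ _ E _ abc) => //; left; exists (f p), (y 0), (y 1), (y 2); split=> //.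
  apply: (jet_level (F := fun i a b c => f p * y i a b c)) => [i a' b' c' [abc']|i].
    pose h x := f x + - f p.
    have sh : smooth h := smooth_onD oU sf (smooth_on_cst _ oU).
    rewrite -(jetZ Q oU Up _ _ _ _ (sY i)) -[RHS]addr0.
    rewrite -[X in _ = _ + X](_ : jet a' b' c' (fun x => h x * Y i x) = 0).
      rewrite -(jetD Q oU Up _ _ _ (smooth_onZ _ oU (sY i)) (smooth_onM oU sh (sY i))).
      by congr (jet _ _ _ _); apply/funext => x; rewrite /h; ring.
    apply: (jet_vanish oU Up Qcol (smooth_onM oU sh (sY i))).
    apply: prod_vanish sh _ => -[|k] l kl ml; last lia.
    by left; apply/vanish0; rewrite /h subrr.
  apply: prod_vanish (grad_rem_smooth i) _ => -[|[|[|k]]] l kl ml; [by left|by left|by left|lia].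
apply/eqP; apply: contraT => un0.
have E' : level_eqs (lam 0) (lam 1) (lam 2) m.+1 (y 0) (y 1) (y 2) arr0 arr0 arr0.
  apply: (jet_level (F := fun _ => arr0)) => [i a' b' c' [abc']|i].
    apply: (jet_vanish oU Up Qcol (smooth_onM oU sf (sY i))).
    apply: prod_vanish sf _ => -[|k] l kl ml; last lia.
    by left; apply/vanish0.
  apply: prod_vanish (grad_rem_smooth i) _ => -[|[|[|k]]] l kl ml; [by left|by left|by left|lia].
(* The gradient of [f_4], of degree three, meets the jets of order [m + 1] in the
   equations of level [m + 3]. *)
have v1 : forall i, vanish m.+1 p (Y i).
  apply: jet_of_potential (E') => a' b' c' abc'.
  exact: (consecutive_levels (lam_neq0 0) (lam_neq0 1) (lam_neq0 2) E E' abc un0 abc').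
case/eqP: un0; apply: (level_zero _ _ _ E _ abc) => //; right.
exists (y 0), (y 1), (y 2).
apply: (jet_level (F := fun i => quad_source (lam 0) (lam 1) (lam 2) (y i))) => [i a' b' c' [abc']|i].
  have srem := fun_rem_smooth.
  rewrite -(jet_quad_part _ _ _ (sY i)) -[RHS]addr0.
  rewrite -[X in _ = _ + X](_ : jet a' b' c' (fun x => fun_rem x * Y i x) = 0).
    rewrite -(jetD Q oU Up _ _ _ (smooth_onM oU sq (sY i)) (smooth_onM oU srem (sY i))).
    by congr (jet _ _ _ _); apply/funext => x; rewrite /fun_rem; ring.
  apply: (jet_vanish oU Up Qcol (smooth_onM oU srem (sY i))).
  have r0 := fun_rem_vanish0 fp; have r1 := fun_remS g0; have r2 := fun_remS g1; have r3 := fun_remS g2.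
  apply: prod_vanish srem _ => -[|[|[|[|k]]]] l kl ml; [by left|by left|by left|by left|lia].
apply: prod_vanish (grad_rem_smooth i) _ => -[|[|[|[|[|k]]]]] l kl ml; [by left|by left|by left| |by left|].
  by right; have -> : l = m.+1 by lia.
by lia.
Qed.

Lemma component_vanish m j : vanish m p (component X j).
Proof.
rewrite (_ : component X j = fun x => \sum_(i < 3) Q i j * Y i x); last first.
  apply/funext => x; rewrite /frame_component; under eq_bigr do rewrite mulr_sumr.
  rewrite exchange_big (bigD1 j) //= [X in _ + X]big1 ?addr0 => [|l /negPf lj].
    by under eq_bigr do rewrite mulrA; rewrite -mulr_suml Qcol eqxx mul1r.
  by under eq_bigr do rewrite mulrA; rewrite -mulr_suml Qcol eq_sym lj mul0r.
apply: (vanish_sum _ oU Up) => i; first exact: (smooth_onZ _ oU (sY i)).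
exact: (vanishZ _ oU Up (sY i) (@frame_component_vanish m i)).
Qed.

End FormalVanishing.

(** * Comparing a function with a divergence *)

Section RiemannSums.
Context {R : realType}.
Local Notation R3 := 'rV[R]_3.
Implicit Types (x y z p q : R3) (F G T : R3 -> R).

Lemma heine_cantor (K : set R3) G (e : R) : compact K -> continuous G -> 0 < e ->
  exists2 d : R, 0 < d & forall x y, K x -> `|y - x| <= d -> `|G x - G y| <= e.
Proof.
move=> /compact_near_coveringP cK cG e0.
pose P (d : R) (x : R3) := forall y, `|y - x| <= d -> `|G x - G y| <= e.
have e2 : 0 < e / 2 by rewrite divr_gt0.
have H x : K x -> \forall x' \near x & d \near 0^'+, P d x'.
  move=> _; have /cvgrPdist_le/(_ _ e2)/near_closed_ball[d d0 Hd] := cG x.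
  have d2 : 0 < d / 2 by rewrite divr_gt0.
  exists (ball x (d / 2), [set t : R | t < d / 2]).
    by split=> /=; [exact: nbhsx_ballx|exact: nbhs_right_lt].
  move=> [x' t] [/= xx' td] y yx'.
  have xx'2 : `|x - x'| < d / 2 by move: xx'; rewrite -ball_normE.
  have h1 : `|G x - G x'| <= e / 2.
    by apply: Hd; rewrite distrC ltW // (lt_trans xx'2) // ltr_pdivrMr // mulr_natr mulr2n ltrDl.
  have h2 : `|G x - G y| <= e / 2.
    apply: Hd; rewrite (splitr d) -(subrKA x') (le_trans (ler_normD _ _)) // lerD //.
      by rewrite (le_trans yx') // ltW.
    by rewrite distrC ltW.
  rewrite (splitr e) -(subrKA (G x)) (le_trans (ler_normD _ _)) // lerD //.
  by rewrite distrC.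
have /filter_ex : \forall d \near 0^'+, 0 < d /\ K `<=` P d.
  by near=> d; split; near: d; [exact: nbhs_right_gt|exact: cK H].
by move=> [d [d0 Kd]]; exists d => // x y Kx; exact: Kd.
Unshelve. all: by end_near. Qed.

Lemma compact_cube p (L : R) : compact [set x : R3 | `|x - p| <= L].
Proof.
apply: bounded_closed_compact.
  exists (L + `|p|); split; first exact: num_real.
  move=> M M1 x /= xp; rewrite (le_trans _ (ltW M1)) // -[x](subrK p).
  by rewrite (le_trans (ler_normD _ _)) // lerD2r.
have cN : continuous (fun x : R3 => `|x - p|).
  move=> x; apply: (@continuous_comp _ _ _ (fun y : R3 => y - p) (fun y => `|y|)).
    by apply: continuousB; [exact: id|exact: cst_continuous].
  exact: norm_continuous.
exact: ((continuous_closedP _).1 cN _ (@closed_le R L)).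
Qed.

(** Riemann sums of a derivative telescope up to the oscillation of the derivative over
one step. *)
Lemma riemann_telescope F i z (h e : R) N : 0 <= h ->
  (forall x, derivable F x (delta_mx 0 i)) ->
  (forall m y, (m < N)%N -> `|y - (z + (h * m%:R) *: delta_mx 0 i)| <= h ->
     `|partial i F (z + (h * m%:R) *: delta_mx 0 i) - partial i F y| <= e) ->
  `|\sum_(m < N) h * partial i F (z + (h * m%:R) *: delta_mx 0 i)
     - (F (z + (h * N%:R) *: delta_mx 0 i) - F z)| <= N%:R * h * e.
Proof.
move=> h0 dF; elim: N => [|N IH] osc.
  by rewrite big_ord0 mulr0 scale0r addr0 subrr subr0 normr0 !mul0r.
have {IH} := IH (fun m y mN => osc m y (ltnW mN)).
rewrite big_ord_recr /=; set S := \sum_(m < N) _ => IH.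
pose w := z + (h * N%:R) *: delta_mx 0 i.
have Ew : z + (h * N.+1%:R) *: delta_mx 0 i = w + h *: delta_mx 0 i.
  by rewrite /w -natr1 mulrDr mulr1 scalerDl addrA.
have [t _|c ch E] := @mvt_line _ _ F (delta_mx 0 i) w h; first exact: dF.
have := osc N (w + c *: delta_mx 0 i) (ltnSn N).
rewrite -/w in IH * => /(_ _) O.
have {O} : `|partial i F w - partial i F (w + c *: delta_mx 0 i)| <= e.
  apply: O; rewrite addrC addKr normrZ (le_trans (ler_wpM2l _ (norm_delta i))) //.
  by rewrite mulr1 (le_trans ch) // ger0_norm.
rewrite Ew -/(partial i F _) in E *; move: E.
move: (partial i F w) (partial i F (w + _)) (F (w + _)) (F w) (F z) IH => a b u v t IH E ab.
have -> : u = v + h * b by rewrite -E; ring.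
rewrite -natr1 (_ : S + h * a - (v + h * b - t) = (S - (v - t)) + h * (a - b)); last by ring.
rewrite (le_trans (ler_normD _ _)) // mulrDl mul1r mulrDl lerD //.
by rewrite normrM ger0_norm // ler_wpM2l.
Qed.

Definition gpt q (h : R) (i j k : nat) : R3 :=
  \row_l (q 0 l + h * (if l == 0 then i else if l == 1 then j else k)%:R).

Lemma gpt0E q h i j k : gpt q h i j k = gpt q h 0 j k + (h * i%:R) *: delta_mx 0 0.
Proof. by apply/rowP; apply: ord3_ind; rewrite !mxE /= ?mulr0 ?mulr1 ?addr0. Qed.
Lemma gpt1E q h i j k : gpt q h i j k = gpt q h i 0 k + (h * j%:R) *: delta_mx 0 1.
Proof. by apply/rowP; apply: ord3_ind; rewrite !mxE /= ?mulr0 ?mulr1 ?addr0. Qed.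
Lemma gpt2E q h i j k : gpt q h i j k = gpt q h i j 0 + (h * k%:R) *: delta_mx 0 2.
Proof. by apply/rowP; apply: ord3_ind; rewrite !mxE /= ?mulr0 ?mulr1 ?addr0. Qed.

Definition grid_sum q h N G : R :=
  h ^+ 3 * \sum_(i < N) \sum_(j < N) \sum_(k < N) G (gpt q h i j k).

Lemma grid_sumD q h N F G :
  grid_sum q h N (fun x => F x + G x) = grid_sum q h N F + grid_sum q h N G.
Proof.
rewrite /grid_sum -mulrDr -big_split; congr (_ * _); apply: eq_bigr => i _ /=.
by rewrite -big_split; apply: eq_bigr => j _ /=; rewrite -big_split.
Qed.

Lemma grid_sum_cst q h N (c : R) : grid_sum q h N (fun=> c) = (h * N%:R) ^+ 3 * c.
Proof.
rewrite /grid_sum !sumr_const card_ord -!mulrnA -[c *+ _]mulr_natr !natrM; ring.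
Qed.

Lemma grid_sum_le q h N F G : 0 <= h -> (forall x, F x <= G x) ->
  grid_sum q h N F <= grid_sum q h N G.
Proof.
move=> h0 FG; rewrite ler_wpM2l ?exprn_ge0 //.
by apply: ler_sum => i _; apply: ler_sum => j _; apply: ler_sum => k _.
Qed.

Lemma double_sum_bound (N : nat) (a : 'I_N -> 'I_N -> R) (b : R) :
  (forall i j, `|a i j| <= b) -> `|\sum_(i < N) \sum_(j < N) a i j| <= N%:R ^+ 2 * b.
Proof.
move=> H; rewrite (le_trans (ler_norm_sum _ _ _)) //.
rewrite (le_trans (ler_sum _ (fun i _ => ler_norm_sum _ _ _))) //.
rewrite (le_trans (ler_sum _ (fun i _ => ler_sum _ (fun j _ => H i j)))) //.
by rewrite !sumr_const card_ord -mulrnA -[b *+ _]mulr_natl natrM expr2.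
Qed.

Section Divergence.
Variables (p : R3) (L : R).
Hypothesis L0 : 0 < L.
Let q : R3 := p - L *: const_mx 1.
Let step (N : nat) : R := 2 * L / N%:R.

Let stepN N : (0 < N)%N -> step N * N%:R = 2 * L.
Proof. by move=> N0; rewrite /step divfK // pnatr_eq0 -lt0n. Qed.

Lemma gpt_in_cube N i j k : (0 < N)%N -> (i <= N)%N -> (j <= N)%N -> (k <= N)%N ->
  `|gpt q (step N) i j k - p| <= L.
Proof.
move=> N0 iN jN kN; apply/norm_rV3_leP => [|l]; first exact: ltW.
rewrite !mxE; set m := (if l == 0 then _ else _).
have mN : (m <= N)%N by rewrite /m; case: ifP => // _; case: ifP.
have h0 : 0 <= step N by rewrite divr_ge0 ?mulr_ge0 // ltW.
have hm : step N * m%:R <= 2 * L by rewrite -(stepN N0) ler_wpM2l // ler_nat.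
have hm0 : 0 <= step N * m%:R by rewrite mulr_ge0.
rewrite mulr1 ler_norml; apply/andP; split; lra.
Qed.

(** The discrete divergence theorem: along each grid line in direction [i] the sum
telescopes to the difference of two boundary values, which are [0]. *)
Lemma grid_sum_partial F i (e : R) : 0 < e ->
  (forall x, derivable F x (delta_mx 0 i)) -> continuous (partial i F) ->
  (forall x, L <= `|x 0 i - p 0 i| -> F x = 0) ->
  exists N0, forall N, (N0 <= N)%N -> (0 < N)%N ->
    `|grid_sum q (step N) N (partial i F)| <= e.
Proof.
move=> e0 dF cF zF; have L3 : 0 < (2 * L) ^+ 3 by rewrite exprn_gt0 // mulr_gt0.
have [d d0 Hd] := @heine_cantor _ _ (e / (2 * L) ^+ 3) (@compact_cube p L) cF (divr_gt0 e0 L3).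
exists (Num.truncn (2 * L / d)).+1 => N N0N N0.
have Np : 0 < N%:R :> R by rewrite ltr0n.
have hd : step N <= d.
  rewrite ler_pdivrMr // [d * _]mulrC -ler_pdivrMr //; apply: ltW.
  by apply: (lt_le_trans (truncnS_gt _)); rewrite ler_nat.
have h0 : 0 <= step N by rewrite divr_ge0 ?mulr_ge0 // ltW.
set h := step N in h0 hd *.
have tele z : (forall m, (m < N)%N -> `|z + (h * m%:R) *: delta_mx 0 i - p| <= L) ->
   z 0 i = q 0 i -> `|\sum_(m < N) partial i F (z + (h * m%:R) *: delta_mx 0 i)| * h
     <= 2 * L * (e / (2 * L) ^+ 3).
  move=> zin zi.
  have zi' : z 0 i = p 0 i - L by rewrite zi !mxE mulr1.
  have Fz : F z = 0 by apply: zF; rewrite zi' addrC addKr normrN ger0_norm // ltW.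
  have FzN : F (z + (h * N%:R) *: delta_mx 0 i) = 0.
    apply: zF; rewrite /h stepN // !mxE !eqxx zi' mulr1.
    by rewrite (_ : _ - _ = L) ?ger0_norm // ?ltW //; ring.
  have := @riemann_telescope F i z h (e / (2 * L) ^+ 3) N h0 dF.
  rewrite FzN Fz subrr subr0 -mulr_sumr normrM (ger0_norm h0) [h * _]mulrC [N%:R * h]mulrC /h stepN //.
  by apply=> m y mN ym; apply: Hd; [exact: zin|exact: le_trans hd].
rewrite /grid_sum normrM (ger0_norm (exprn_ge0 3 h0)).
suff H : `|\sum_(a < N) \sum_(b < N) \sum_(c < N) partial i F (gpt q h a b c)| * h
      <= N%:R ^+ 2 * (2 * L * (e / (2 * L) ^+ 3)).
  rewrite exprSr -mulrA [h * _]mulrC (le_trans (ler_wpM2l _ H)) ?exprn_ge0 //.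
  rewrite [leLHS]mulrA -exprMn /h stepN // le_eqVlt; apply/orP; left; apply/eqP.
  by field; rewrite gt_eqF.
have tele' (G : nat -> nat -> R3) :
  (forall a b m, (a < N)%N -> (b < N)%N -> (m < N)%N -> `|G a b + (h * m%:R) *: delta_mx 0 i - p| <= L) ->
  (forall a b, (G a b) 0 i = q 0 i) ->
  `|\sum_(a < N) \sum_(b < N) \sum_(m < N) partial i F (G a b + (h * m%:R) *: delta_mx 0 i)| * h
      <= N%:R ^+ 2 * (2 * L * (e / (2 * L) ^+ 3)).
  move=> G1 G2; rewrite -[h in leLHS]ger0_norm // -normrM mulr_suml.
  under eq_bigr do rewrite mulr_suml.
  apply: double_sum_bound => a b; rewrite normrM [`|h|]ger0_norm //.
  by apply: tele => // m mN; exact: G1.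
have cube a b c : (a < N)%N -> (b < N)%N -> (c < N)%N -> `|gpt q h a b c - p| <= L.
  by move=> aN bN cN; apply: gpt_in_cube => //; exact: ltnW.
have [i0|i1|i2] : [\/ i = 0, i = 1 | i = 2].
  by move: (i); apply: ord3_ind; [constructor 1|constructor 2|constructor 3].
- rewrite i0 in tele' *; rewrite exchange_big /=.
  under eq_bigr do rewrite exchange_big /=.
  under eq_bigr do under eq_bigr do under eq_bigr do rewrite gpt0E.
  apply: (tele' (fun b c => gpt q h 0 b c)) => [b c m bN cN mN|b c]; first by rewrite -gpt0E; exact: cube.
  by rewrite !mxE mulr0 addr0.
- rewrite i1 in tele' *; under eq_bigr do rewrite exchange_big /=.
  under eq_bigr do under eq_bigr do under eq_bigr do rewrite gpt1E.
  apply: (tele' (fun b c => gpt q h b 0 c)) => [b c m bN cN mN|b c]; first by rewrite -gpt1E; exact: cube.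
  by rewrite !mxE mulr0 addr0.
- rewrite i2 in tele' *; under eq_bigr do under eq_bigr do under eq_bigr do rewrite gpt2E.
  apply: (tele' (fun b c => gpt q h b c 0)) => [b c m bN cN mN|b c]; first by rewrite -gpt2E; exact: cube.
  by rewrite !mxE mulr0 addr0.
Qed.

(** The increments of this truncation along an arithmetic progression bound from below
the number of points that fall close to [c]. *)
Definition clamp (c r t : R) := Num.max (c - r) (Num.min t (c + r)).

Lemma clamp_step (c r t h : R) : 0 <= h -> h <= r ->
  clamp c r (t + h) - clamp c r t <= h * (`|t - c| <= 2 * r)%R%:R.
Proof.
move=> h0 hr; rewrite /clamp.
have mi (a b : R) : a <= b /\ Num.min a b = a \/ b <= a /\ Num.min a b = b.
  by case: (leP a b) => H; [left|right; rewrite ltW].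
have ma (a b : R) : a <= b /\ Num.max a b = b \/ b <= a /\ Num.max a b = a.
  by case: (leP a b) => H; [left|right; rewrite ltW].
have [] : (`|t - c| <= 2 * r)%R%:R = 1 :> R /\ - (2 * r) <= t - c <= 2 * r \/
    (`|t - c| <= 2 * r)%R%:R = 0 :> R /\ (t - c < - (2 * r) \/ 2 * r < t - c).
  rewrite ler_norml; case: (leP (- (2 * r)) (t - c)) => a1; last by right; split; [|left].
  by case: (leP (t - c) (2 * r)) => a2; [left; split|right; split; [|right]].
- move=> [-> /andP[a1 a2]].
  case: (mi (t + h) (c + r)) => -[m1 ->]; case: (mi t (c + r)) => -[m2 ->].
  + case: (ma (c - r) (t + h)) => -[m3 ->]; case: (ma (c - r) t) => -[m4 ->]; lra.
  + case: (ma (c - r) (t + h)) => -[m3 ->]; case: (ma (c - r) (c + r)) => -[m4 ->]; lra.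
  + case: (ma (c - r) (c + r)) => -[m3 ->]; case: (ma (c - r) t) => -[m4 ->]; lra.
  + lra.
- move=> [-> H].
  case: (mi (t + h) (c + r)) => -[m1 ->]; case: (mi t (c + r)) => -[m2 ->].
  + case: (ma (c - r) (t + h)) => -[m3 ->]; case: (ma (c - r) t) => -[m4 ->]; case: H => H; lra.
  + case: (ma (c - r) (t + h)) => -[m3 ->]; case: (ma (c - r) (c + r)) => -[m4 ->]; case: H => H; lra.
  + case: (ma (c - r) (c + r)) => -[m3 ->]; case: (ma (c - r) t) => -[m4 ->]; case: H => H; lra.
  + lra.
Qed.

(** The number of grid points within [2 r] of [c], times the step, is at least the
length [2 r] of the interval of half length [r], as long as the step is at most [r]. *)
Lemma grid_count (c r q0 h : R) N : 0 <= h -> h <= r -> q0 <= c - r -> c + r <= q0 + h * N%:R ->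
  2 * r <= h * \sum_(m < N) (`|q0 + h * m%:R - c| <= 2 * r)%R%:R.
Proof.
move=> h0 hr qc cq; have r0 := le_trans h0 hr.
pose a m := clamp c r (q0 + h * m%:R).
have E : \sum_(0 <= m < N) (a m.+1 - a m) = 2 * r.
  rewrite telescope_sumr // /a mulr0 addr0 /clamp.
  rewrite (min_r cq) (min_l (y := c + r)); last lra.
  rewrite (max_r (y := c + r)); last lra.
  by rewrite (max_l qc); ring.
rewrite -[leLHS]E big_mkord mulr_sumr; apply: ler_sum => m _.
rewrite /a -[m.+1%:R]natr1 [h * (_ + 1)]mulrDr mulr1 addrA; exact: clamp_step.
Qed.

(** The integral of [T] over the cube of side [2 L] is at most that of [B], the integral
of a divergence with compact support being [0], and at least [d] times the volume of a
cube of side [2 r]. The integrals are replaced by sums over a fine grid, for which both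
estimates are elementary. *)
Lemma grid_compare T (Psi : 'I_3 -> R3 -> R) z (B r d : R) :
  (forall i x, derivable (Psi i) x (delta_mx 0 i)) ->
  (forall i, continuous (partial i (Psi i))) ->
  (forall i x, L <= `|x - p| -> Psi i x = 0) ->
  (forall x, T x <= \sum_(i < 3) partial i (Psi i) x + B) ->
  (forall x, 0 <= T x) -> 0 <= d -> 0 < r -> (forall x, `|x - z| <= 2 * r -> d <= T x) ->
  `|z - p| + r <= L ->
  d * (2 * r) ^+ 3 <= (2 * L) ^+ 3 * B.
Proof.
move=> dP cP zP TP T0 d0 r0 Td zL.
apply/ler_addgt0Pl => e e0; have e3 : 0 < e / 3 by rewrite divr_gt0.
have zP' i x : L <= `|x 0 i - p 0 i| -> Psi i x = 0.
  move=> H; apply: zP; rewrite (le_trans H) //.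
  by have := coord_le_norm (x - p) i; rewrite !mxE.
have [N0 H0] := grid_sum_partial e3 (dP 0) (cP 0) (@zP' 0).
have [N1 H1] := grid_sum_partial e3 (dP 1) (cP 1) (@zP' 1).
have [N2 H2] := grid_sum_partial e3 (dP 2) (cP 2) (@zP' 2).
pose N := (N0 + N1 + N2 + (Num.truncn (2 * L / r)).+1)%N.
have Npos : (0 < N)%N by rewrite /N addnS.
have Np : 0 < N%:R :> R by rewrite ltr0n.
have h0 : 0 <= step N by rewrite divr_ge0 ?mulr_ge0 // ltW.
have hr : step N <= r.
  rewrite ler_pdivrMr // [r * _]mulrC -ler_pdivrMr //; apply: ltW.
  apply: (lt_le_trans (truncnS_gt _)); by rewrite ler_nat /N leq_addl.
have {H0} := H0 N ltac:(rewrite /N; lia) Npos; have {H1} := H1 N ltac:(rewrite /N; lia) Npos.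
have {H2} := H2 N ltac:(rewrite /N; lia) Npos.
set h := step N in h0 hr *; have hN : h * N%:R = 2 * L := stepN Npos.
move=> /ler_normlP[_ S2] /ler_normlP[_ S1] /ler_normlP[_ S0].
have up : grid_sum q h N T <= (2 * L) ^+ 3 * B + e.
  apply: le_trans (grid_sum_le _ _ h0 TP) _.
  rewrite (_ : (fun x => _) = fun x => partial 0 (Psi 0) x + partial 1 (Psi 1) x + partial 2 (Psi 2) x + B); last first.
    by apply/funext => x; rewrite sum3.
  by rewrite !grid_sumD grid_sum_cst hN; lra.
rewrite addrC; apply: le_trans up.
pose b l (m : nat) : R := (`|q 0 l + h * m%:R - z 0 l| <= 2 * r)%R%:R.
have bcount l : 2 * r <= h * \sum_(m < N) b l m.
  have zl : `|z 0 l - p 0 l| <= L - r.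
    rewrite (le_trans _ (_ : `|z - p| <= L - r)) //; last by rewrite lerBrDr.
    by have := coord_le_norm (z - p) l; rewrite !mxE.
  move: zl; rewrite ler_norml => /andP[zl1 zl2].
  apply: grid_count => //; rewrite ?hN !mxE mulr1; lra.
have Tb i j k : d * (b 0 i * b 1 j * b 2 k) <= T (gpt q h i j k).
  rewrite /b; case: (leP `|q 0 0 + _ - _|) => c0; rewrite ?mul0r ?mulr0 //.
  case: (leP `|q 0 1 + _ - _|) => c1; rewrite ?mul0r ?mulr0 ?mul0r ?mulr0 //.
  case: (leP `|q 0 2 + _ - _|) => c2; rewrite ?mul0r ?mulr0 ?mulr1 //.
  apply: Td; apply/norm_rV3_leP; first by rewrite mulr_ge0 // ltW.
  by apply: ord3_ind; move: c0 c1 c2; rewrite !mxE.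
apply: le_trans (_ : h ^+ 3 * (\sum_(i < N) \sum_(j < N) \sum_(k < N) d * (b 0 i * b 1 j * b 2 k)) <= _); last first.
  by rewrite ler_wpM2l ?exprn_ge0 //; apply: ler_sum => i _; apply: ler_sum => j _; apply: ler_sum => k _.
have -> : \sum_(i < N) \sum_(j < N) \sum_(k < N) d * (b 0 i * b 1 j * b 2 k) =
  d * ((\sum_(i < N) b 0 i) * (\sum_(j < N) b 1 j) * (\sum_(k < N) b 2 k)).
  rewrite !mulr_suml mulr_sumr; apply: eq_bigr => i _.
  rewrite [b 0 i * _]mulr_sumr mulr_suml mulr_sumr; apply: eq_bigr => j _.
  by rewrite mulr_sumr mulr_sumr.
rewrite [leRHS]mulrCA; apply: ler_wpM2l => //.
rewrite (_ : h ^+ 3 * _ = (h * \sum_(i < N) b 0 i) * (h * \sum_(j < N) b 1 j) * (h * \sum_(k < N) b 2 k)); last by ring.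
have r2 : 0 <= 2 * r by rewrite mulr_ge0 // ltW.
rewrite (_ : (2 * r) ^+ 3 = (2 * r) * (2 * r) * (2 * r)); last by ring.
by apply: ler_pM (bcount 2) => //; [exact: mulr_ge0|apply: ler_pM].
Qed.

End Divergence.
End RiemannSums.

(** * Functions flat at a point *)

Section C1.
Context {R : realType}.
Local Notation R3 := 'rV[R]_3.
Implicit Types (x y z p : R3) (F G : R3 -> R) (V K : set R3).
Local Notation e i := (delta_mx 0 i : R3).

Definition C1on V F := forall x, V x ->
  {for x, continuous F} /\ forall i, derivable F x (e i) /\ {for x, continuous (partial i F)}.

Lemma C1_derivable V F x i : C1on V F -> V x -> derivable F x (e i).
Proof. by move=> cF /cF[_ /(_ i)[]]. Qed.

Lemma C1_continuous V F x : C1on V F -> V x -> {for x, continuous F}.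
Proof. by move=> cF /cF[]. Qed.

Lemma C1_partial_continuous V F x i : C1on V F -> V x -> {for x, continuous (partial i F)}.
Proof. by move=> cF /cF[_ /(_ i)[]]. Qed.

Lemma C1_smooth V F : smooth_on V F -> C1on V F.
Proof.
move=> sF x Vx; split=> [|i]; first exact: (smooth_on_continuous sF Vx).
split; first exact: (smooth_on_derivable sF Vx).
exact: (smooth_on_continuous (smooth_on_partial i sF) Vx).
Qed.

Lemma C1_sub V V' F : V' `<=` V -> C1on V F -> C1on V' F.
Proof. by move=> VV cF x /VV; exact: cF. Qed.

Lemma C1D V F G : open V -> C1on V F -> C1on V G -> C1on V (fun x => F x + G x).
Proof.
move=> oV cF cG x Vx; split.
  exact: (continuousD (C1_continuous cF Vx) (C1_continuous cG Vx)).
move=> i; split; first exact: (derivableD (C1_derivable cF Vx) (C1_derivable cG Vx)).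
have E : {near x, (fun y => partial i F y + partial i G y) =1 partial i (fun y => F y + G y)}.
  apply: (near_open oV Vx) => y Vy.
  by rewrite (partialD (C1_derivable cF Vy) (C1_derivable cG Vy)).
apply: (near_eq_continuous E).
exact: (continuousD (C1_partial_continuous cF Vx) (C1_partial_continuous cG Vx)).
Qed.

Lemma C1M V F G : open V -> C1on V F -> C1on V G -> C1on V (fun x => F x * G x).
Proof.
move=> oV cF cG x Vx; split.
  exact: (continuousM (C1_continuous cF Vx) (C1_continuous cG Vx)).
move=> i; split; first exact: (derivableM (C1_derivable cF Vx) (C1_derivable cG Vx)).
have E : {near x, (fun y => partial i F y * G y + F y * partial i G y) =1 partial i (fun y => F y * G y)}.
  apply: (near_open oV Vx) => y Vy.
  by rewrite (partialM (C1_derivable cF Vy) (C1_derivable cG Vy)).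
apply: (near_eq_continuous E).
apply: (@continuousD R R R3 (fun y => partial i F y * G y) (fun y => F y * partial i G y)).
  exact: (continuousM (C1_partial_continuous cF Vx) (C1_continuous cG Vx)).
exact: (continuousM (C1_continuous cF Vx) (C1_partial_continuous cG Vx)).
Qed.

Lemma partialV F x i : F x != 0 -> derivable F x (e i) ->
  partial i (fun y => (F y)^-1) x = - (F x) ^- 2 * partial i F x.
Proof. by move=> F0 dF; exact: deriveV. Qed.

Lemma C1V V F : open V -> C1on V F -> (forall x, V x -> F x != 0) -> C1on V (fun x => (F x)^-1).
Proof.
move=> oV cF F0 x Vx; have cV y : V y -> {for y, continuous (fun y => (F y)^-1)}.
  by move=> Vy; exact: (continuousV (F0 y Vy) (C1_continuous cF Vy)).
split; first exact: cV.
move=> i; split; first exact: (derivableV (F0 x Vx) (C1_derivable cF Vx)).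
have E : {near x, (fun y => - ((F y)^-1 * (F y)^-1) * partial i F y) =1 partial i (fun y => (F y)^-1)}.
  apply: (near_open oV Vx) => y Vy.
  by rewrite (partialV (F0 y Vy) (C1_derivable cF Vy)) -expr2 exprVn.
apply: (near_eq_continuous E); apply: continuousM (C1_partial_continuous cF Vx).
by apply: continuousN; apply: continuousM; exact: cV.
Qed.

Lemma is_derive_comp (phi : R -> R) F x (v : R3) (a b : R) :
  is_derive (F x) 1 phi a -> is_derive x v F b -> is_derive x v (fun y => phi (F y)) (a * b).
Proof.
move=> dphi dF; pose g (t : R) := F (x + t *: v).
have dg : is_derive (0 : R) (1 : R) g b by apply: is_derive_line; rewrite scale0r addr0.
have g0 : g 0 = F x by rewrite /g scale0r addr0.
have dpg : is_derive (0 : R) (1 : R) (phi \o g) (a * b).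
  by apply: is_derive1_comp; rewrite g0.
have E : (fun h : R => h^-1 *: ((phi \o g) (h *: (1 : R) + 0) - (phi \o g) 0)) =
    (fun h : R => h^-1 *: (phi (F (h *: v + x)) - phi (F x))).
  by apply/funext => h; rewrite /g /= scale0r !addr0 [h *: 1]mulr1 [x + _]addrC.
case: dpg => D1 D2; apply: DeriveDef.
  by move: D1; rewrite /derivable E.
by rewrite -D2 /derive /= E.
Qed.

Lemma C1_comp V (phi dphi : R -> R) F : open V -> (forall t : R, is_derive t (1 : R) phi (dphi t)) ->
  continuous dphi -> C1on V F -> C1on V (fun x => phi (F x)).
Proof.
move=> oV Hphi cd cF x Vx.
have dF y i : V y -> is_derive y (e i) (fun y => phi (F y)) (dphi (F y) * partial i F y).
  by move=> Vy; apply: is_derive_comp => //; apply: derivableP; exact: (C1_derivable cF Vy).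
split.
  apply: (continuous_comp (C1_continuous cF Vx)).
  by case: (Hphi (F x)) => /derivable1_diffP/differentiable_continuous.
move=> i; split; first by case: (dF x i Vx).
have E : {near x, (fun y => dphi (F y) * partial i F y) =1 partial i (fun y => phi (F y))}.
  by apply: (near_open oV Vx) => y Vy; case: (dF y i Vy) => _ <-.
apply: (near_eq_continuous E); apply: continuousM (C1_partial_continuous cF Vx).
exact: (continuous_comp (C1_continuous cF Vx) (@cd _)).
Qed.

Lemma near0_partial F x i : {near x, F =1 (fun=> 0)} -> derivable F x (e i) /\ partial i F x = 0.
Proof.
move=> F0; have F0' : {near x, (fun=> 0) =1 F} by apply: filterS F0 => y ->.
split; first exact: (near_eq_derivable F0' (derivable_cst (0 : R) x (e i))).
by rewrite /partial (near_eq_derive _ F0) derive_cst.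
Qed.

(** A [C^1] function on an open set that vanishes off a closed subset of it is [C^1] on
the whole space: this is how a cutoff makes a locally defined flux global. *)
Lemma C1_extend V K F : open V -> closed K -> K `<=` V -> C1on V F ->
  (forall x, ~ K x -> F x = 0) -> C1on setT F.
Proof.
move=> oV cK KV cF F0 x _; have [/KV Vx|nKx] := pselect (K x); first exact: cF.
have oK : open (~` K) by rewrite openC.
have near0 y : ~ K y -> {near y, F =1 (fun=> 0)}.
  by move=> nKy; apply: (near_open oK nKy) => z; exact: F0.
have near0' : {near x, (fun=> 0) =1 F} by apply: filterS (near0 x nKx) => y ->.
split; first by apply: (near_eq_continuous near0'); exact: cst_continuous.
move=> i; split; first by case: (near0_partial i (near0 x nKx)).
have E : {near x, (fun=> 0) =1 partial i F}.
  by apply: (near_open oK nKx) => y nKy; case: (near0_partial i (near0 y nKy)).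
by apply: (near_eq_continuous E); exact: cst_continuous.
Qed.

End C1.

Section Flat.
Context {R : realType}.
Local Notation R3 := 'rV[R]_3.
Variable p : R3.
Implicit Types (x y z : R3) (F G : R3 -> R).
Local Notation e i := (delta_mx 0 i : R3).

Lemma is_derive_quadratic (V : normedModType R) (F : V -> R) (x v : V) (C d : R) : 0 < d ->
  (forall t : R, `|t| <= d -> `|F (t *: v + x) - F x| <= C * t ^+ 2) -> is_derive x v F 0.
Proof.
move=> d0 H.
have E : (fun h : R => h^-1 *: (F (h *: v + x) - F x)) @ 0^' --> (0 : R).
  apply/cvgrPdist_le => eps eps0; near=> h.
  have h0 : h != 0 by near: h; exact: nbhs_dnbhs_neq.
  have hd : `|h| <= d by near: h; apply: dnbhs0_le.
  have he : `|h| <= eps / (`|C| + 1).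
    by near: h; apply: dnbhs0_le; rewrite divr_gt0 // ltr_wpDl.
  rewrite sub0r normrN normrM normfV mulrC ler_pdivrMr ?normr_gt0 //.
  rewrite (le_trans (H h hd)) // -[h ^+ 2]real_normK ?num_real // expr2 mulrA ler_wpM2r //.
  rewrite (le_trans (_ : _ <= (`|C| + 1) * (eps / (`|C| + 1)))) //.
    apply: le_trans (_ : `|C| * `|h| <= _); first by rewrite ler_wpM2r // ler_norm.
    by apply: ler_pM => //; rewrite lerDl.
  by rewrite mulrC divfK // gt_eqF // ltr_wpDl.
by apply: DeriveDef; [apply/cvg_ex; exists 0|exact: cvg_lim E].
Unshelve. all: by end_near. Qed.

Local Notation bigO := (bigO p).

Lemma near_norm (q : R3) (m : R) : 0 < m -> \forall x \near q, `|x - q| < m.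
Proof.
move=> m0; have := nbhsx_ballx q m m0; apply: filterS => y.
by rewrite -ball_normE /= distrC.
Qed.

Definition flat F := forall N, bigO N F.

Lemma bigOD N F G : bigO N F -> bigO N G -> bigO N (fun x => F x + G x).
Proof.
move=> [C [d d0 [C0 HF]]] [C' [d' d'0 [C'0 HG]]].
exists (C + C'), (Num.min d d'); first by rewrite lt_min d0.
split=> [|x]; first exact: addr_ge0.
rewrite le_min => /andP[xd xd']; rewrite mulrDl (le_trans (ler_normD _ _)) // lerD //.
  exact: HF.
exact: HG.
Qed.

Lemma bigOM N M F G : bigO N F -> bigO M G -> bigO (N + M) (fun x => F x * G x).
Proof.
move=> [C [d d0 [C0 HF]]] [C' [d' d'0 [C'0 HG]]].
exists (C * C'), (Num.min d d'); first by rewrite lt_min d0.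
split=> [|x]; first exact: mulr_ge0.
rewrite le_min => /andP[xd xd']; rewrite normrM exprD mulrACA; apply: ler_pM => //.
  exact: HF.
exact: HG.
Qed.

Lemma flatD F G : flat F -> flat G -> flat (fun x => F x + G x).
Proof. by move=> fF fG N; exact: bigOD. Qed.

Lemma flatM F G : flat F -> bigO 0 G -> flat (fun x => F x * G x).
Proof. by move=> fF bG N; have := bigOM (fF N) bG; rewrite addn0. Qed.

Lemma flat0 F : flat F -> F p = 0.
Proof.
move=> /(_ 1%N)[C [d d0 [C0 /(_ p)]]].
by rewrite subrr normr0 expr1 mulr0 => /(_ (ltW d0)); rewrite normr_le0 => /eqP.
Qed.

Lemma flat_continuous F : flat F -> {for p, continuous F}.
Proof.
move=> fF; have Fp := flat0 fF; have [C [d d0 [C0 H]]] := fF 1%N.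
apply: (cvgrPdist_le (F := nbhs p) F (F p)).2 => eps eps0; rewrite Fp.
have m0 : 0 < Num.min d (eps / (C + 1)) by rewrite lt_min d0 divr_gt0 // ltr_wpDl.
apply: filterS (near_norm p m0) => x; rewrite lt_min => /andP[xd xe].
rewrite sub0r normrN (le_trans (H x (ltW xd))) // expr1.
rewrite (le_trans (_ : _ <= (C + 1) * (eps / (C + 1)))) //.
  by apply: ler_pM => //; [rewrite lerDl|exact: ltW].
by rewrite mulrC divfK // gt_eqF // ltr_wpDl.
Qed.

Lemma flat_is_derive F v : flat F -> is_derive p v F 0.
Proof.
move=> fF; have Fp := flat0 fF; have [C [d d0 [C0 H]]] := fF 2%N.
apply: (@is_derive_quadratic _ F p v (C * `|v| ^+ 2) (d / (`|v| + 1))).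
  by rewrite divr_gt0 // ltr_wpDl.
move=> t td; rewrite Fp subr0.
have E : `|t *: v + p - p| = `|t| * `|v| by rewrite addrK normrZ.
have := H (t *: v + p); rewrite E => /(_ _)/le_trans; apply.
  rewrite (le_trans (_ : _ <= (d / (`|v| + 1)) * (`|v| + 1))) //.
    by apply: ler_pM => //; rewrite lerDl.
  by rewrite divfK // gt_eqF // ltr_wpDl.
by rewrite exprMn -[t ^+ 2]real_normK ?num_real // le_eqVlt; apply/orP; left; apply/eqP; ring.
Qed.

(** The squared Euclidean distance to [p]; unlike the square of the sup norm it is
smooth. *)
Definition rho x : R := \sum_(i < 3) (x 0 i - p 0 i) ^+ 2.

Lemma rho_ge x : `|x - p| ^+ 2 <= rho x.
Proof.
have r0 : 0 <= rho x by apply: sumr_ge0 => i _; exact: sqr_ge0.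
rewrite -(sqr_sqrtr r0) ler_pXn2r ?nnegrE ?sqrtr_ge0 //.
apply/norm_rV3_leP => [|i]; first exact: sqrtr_ge0.
rewrite -sqrtr_sqr ler_wsqrtr // /rho (bigD1 i) //= !mxE lerDl.
by apply: sumr_ge0 => j _; exact: sqr_ge0.
Qed.

Lemma rho_ge0 x : 0 <= rho x.
Proof. by apply: sumr_ge0 => i _; exact: sqr_ge0. Qed.

Lemma rho_p : rho p = 0.
Proof. by rewrite /rho big1 // => i _; rewrite subrr expr0n. Qed.

Lemma rho_gt0 x : x != p -> 0 < rho x.
Proof.
move=> xp; apply: lt_le_trans (rho_ge x).
by rewrite exprn_gt0 // normr_gt0 subr_eq0.
Qed.

Lemma rho_smooth V : open V -> smooth_on V rho.
Proof.
move=> oV; apply: (smooth_on_sum _ oV) => i.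
have s : smooth_on V (fun x => x 0 i - p 0 i).
  exact: (smooth_onD oV (smooth_on_coord i oV) (smooth_on_cst (- p 0 i) oV)).
exact: (smooth_onM oV s s).
Qed.

Lemma partial_rho i x : partial i rho x = 2 * (x 0 i - p 0 i).
Proof.
have s j : smooth_on setT (fun x : R3 => x 0 j - p 0 j).
  exact: (smooth_onD openT (smooth_on_coord j openT) (smooth_on_cst (- p 0 j) openT)).
have d j := smooth_on_derivable (i := i) (s j) (I : setT x).
have [|_ ->] := @partial_sum R 'I_3 (index_enum 'I_3) (fun j x => (x 0 j - p 0 j) ^+ 2) x i.
  by move=> j; exact: (derivableM (d j) (d j)).
have E j : partial i (fun y : R3 => (y 0 j - p 0 j) ^+ 2) x = (i == j)%:R * (2 * (x 0 j - p 0 j)).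
  rewrite [LHS](partialM (d j) (d j)).
  rewrite (partialD (smooth_on_derivable (smooth_on_coord j openT) (I : setT x)) (derivable_cst _ _ _)).
  rewrite partial_coord partial_cst; ring.
under eq_bigr do rewrite E.
by rewrite (bigD1 i) //= eqxx mul1r big1 ?addr0 // => j /negPf ji; rewrite eq_sym ji mul0r.
Qed.

Lemma bigO_rhoV N F : bigO N.+2 F -> bigO N (fun x => F x * (rho x)^-1).
Proof.
move=> [C [d d0 [C0 H]]]; exists C, d => //; split=> // x xd.
have [->|xp] := eqVneq x p; first by rewrite rho_p invr0 mulr0 normr0 mulr_ge0 ?exprn_ge0.
have r0 := rho_gt0 xp; rewrite normrM normfV (gtr0_norm r0) ler_pdivrMr //.
rewrite (le_trans (H x xd)) // -[N.+2]addn2 exprD mulrA ler_wpM2l ?mulr_ge0 ?exprn_ge0 //.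
exact: rho_ge.
Qed.

Lemma flat_rhoV F : flat F -> flat (fun x => F x * (rho x)^-1).
Proof. by move=> fF N; exact: bigO_rhoV. Qed.

(** Flatness of the partial derivatives is part of the class because the partial
derivatives of a quotient by [rho] are continuous at [p] only thanks to it. *)
Definition flatC1 F := [/\ C1on setT F, flat F & forall i, flat (partial i F)].

Lemma flatC1D F G : flatC1 F -> flatC1 G -> flatC1 (fun x => F x + G x).
Proof.
move=> [cF fF dF] [cG fG dG]; split; [exact: (C1D openT cF cG)|exact: flatD|move=> i].
rewrite (_ : partial i _ = fun x => partial i F x + partial i G x); first exact: flatD.
by apply/funext => x; rewrite (partialD (C1_derivable cF (I : setT x)) (C1_derivable cG (I : setT x))).
Qed.

Lemma open_punctured : open (~` [set p]).
Proof.
rewrite openC (_ : [set p] = rho @^-1` [set y | y = 0]).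
  apply: ((continuous_closedP _).1 _ _ (@closed_eq R 0)) => x.
  exact: (smooth_on_continuous (rho_smooth openT) (I : setT x)).
apply/seteqP; split=> x /=; first by move=> ->; exact: rho_p.
by apply: contraPP => /eqP /rho_gt0 r0; apply/eqP; rewrite gt_eqF.
Qed.

Lemma C1_rhoV : C1on (~` [set p]) (fun x => (rho x)^-1).
Proof.
apply: (C1V open_punctured (C1_smooth (rho_smooth open_punctured))) => x /= /eqP xp.
by rewrite gt_eqF // rho_gt0.
Qed.

(** Division by the squared distance loses two orders of vanishing, which costs nothing
to a flat function. The convention [0^-1 = 0] gives the quotient its correct value at
[p]. *)
Lemma flatC1_rhoV F : flatC1 F -> flatC1 (fun x => F x * (rho x)^-1).
Proof.
move=> [cF fF dF]; have fG := flat_rhoV fF.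
have cG : C1on (~` [set p]) (fun x => F x * (rho x)^-1).
  exact: (C1M open_punctured (C1_sub (@subsetT _ _) cF) C1_rhoV).
pose D i x := partial i F x * (rho x)^-1 + F x * (-2 * (x 0 i - p 0 i)) * (rho x)^-1 * (rho x)^-1.
have DE i : partial i (fun x => F x * (rho x)^-1) = D i.
  apply/funext => x; have [->|xp] := eqVneq x p.
    rewrite /D rho_p invr0 !mulr0 addr0.
    by have [_] := flat_is_derive (e i) fG.
  have r0 : rho x != 0 by rewrite gt_eqF // rho_gt0.
  have dr : derivable rho x (e i) := smooth_on_derivable (rho_smooth openT) (I : setT x).
  rewrite (partialM (C1_derivable cF (I : setT x)) (derivableV r0 dr)).
  rewrite (partialV r0 dr) partial_rho /D -exprVn; ring.
have fD i : flat (D i).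
  apply: flatD; first exact: flat_rhoV.
  do 2 apply: flat_rhoV; apply: flatM fF _; apply: continuous_bigO.
  apply: (smooth_on_continuous _ (I : setT p)); apply: (smooth_onZ _ openT).
  exact: (smooth_onD openT (smooth_on_coord i openT) (smooth_on_cst (- p 0 i) openT)).
split=> // [x _|i]; last by rewrite DE.
have [->|/eqP xp] := eqVneq x p; last exact: cG.
split; first exact: flat_continuous.
move=> i; split; first by case: (flat_is_derive (e i) fG).
by rewrite DE; exact: flat_continuous.
Qed.

(** A flat function absorbs the singularity of every weight [(1 + 1/rho)^n] of the
Carleman estimate, so no ball around [p] has to be removed. *)
Lemma flatC1_weight n F : flatC1 F -> flatC1 (fun x => F x * (1 + (rho x)^-1) ^+ n).
Proof.
elim: n F => [|n IH] F fF; first by under eq_fun do rewrite expr0 mulr1.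
rewrite (_ : (fun x => _) = fun x => (F x + F x * (rho x)^-1) * (1 + (rho x)^-1) ^+ n); last first.
  by apply/funext => x; rewrite exprS; ring.
apply: (IH (fun x => F x + F x * (rho x)^-1)); exact: (flatC1D fF (flatC1_rhoV fF)).
Qed.

End Flat.

(** * A divergence identity for Beltrami fields *)

Section CarlemanAlgebra.
Context {R : realType}.
Variables (u y : 'I_3 -> R) (a : 'I_3 -> 'I_3 -> R) (S : 'I_3 -> 'I_3 -> 'I_3 -> R).
Variables (f s ds W dW : R) (df : 'I_3 -> R).

(** Everything in this part is evaluated at one point [x]: [u] is the value of the
field, [y] that of [x - p], [a i j] that of [partial i (u j)], [S i k j] that of
[partial i (partial k (u j))], [df] that of the gradient of [f]; [W] is a radial weight
with gradient [dW y], and [s] a radial function with gradient [ds y]. *)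

Definition sq_u := u 0 * u 0 + u 1 * u 1 + u 2 * u 2.
(** The derivative of the field along the radial field [y]. *)
Definition euler j := y 0 * a 0 j + y 1 * a 1 j + y 2 * a 2 j.
Definition deuler i j := a i j + (y 0 * S i 0 j + y 1 * S i 1 j + y 2 * S i 2 j).
Definition dot3 (v w : 'I_3 -> R) := v 0 * w 0 + v 1 * w 1 + v 2 * w 2.
(** The divergence of the first term contains second derivatives of the field, through
[u . (y . grad) E] with [E] the radial derivative; for a field without curl and
divergence the two other terms cancel them. *)
Definition flux_val i :=
  (s * sq_u + dot3 u euler) * y i + dot3 u y * euler i - dot3 y euler * u i.
(** The derivative of [flux_val] along its own direction, given by the product rule. *)
Definition dflux_val i :=
  (ds * y i * sq_u + s * (2 * dot3 u (a i)) + (dot3 (a i) euler + dot3 u (deuler i))) * y i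
  + (s * sq_u + dot3 u euler)
  + ((dot3 (a i) y + u i) * euler i + dot3 u y * deuler i i)
  - ((euler i + dot3 y (deuler i)) * u i + dot3 y euler * a i i).

(** With [E] the radial derivative of the field, this is [(E + f y x u + s u) . (E + s
u)]: a square up to the term in [f]. *)
Definition shifted_sq := 
  (euler 0 + f * (y 1 * u 2 - y 2 * u 1) + s * u 0) * (euler 0 + s * u 0) +
  (euler 1 + f * (y 2 * u 0 - y 0 * u 2) + s * u 1) * (euler 1 + s * u 1) +
  (euler 2 + f * (y 0 * u 1 - y 1 * u 0) + s * u 2) * (euler 2 + s * u 2).

Lemma dot3_deltal (v : 'I_3 -> R) i : dot3 (fun j => (i == j)%:R) v = v i.
Proof. by rewrite /dot3; move: i; apply: ord3_ind; rewrite /= !mul1r !mul0r; ring. Qed.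

Lemma dot3_deltar (v : 'I_3 -> R) i : dot3 v (fun j => (i == j)%:R) = v i.
Proof. by rewrite /dot3; move: i; apply: ord3_ind; rewrite /= !mulr1 !mulr0; ring. Qed.

Lemma dot3C (v w : 'I_3 -> R) : dot3 v w = dot3 w v.
Proof. by rewrite /dot3; ring. Qed.

Hypothesis curl0 : a 1 2 - a 2 1 = f * u 0.
Hypothesis curl1 : a 2 0 - a 0 2 = f * u 1.
Hypothesis curl2 : a 0 1 - a 1 0 = f * u 2.
Hypothesis div0 : a 0 0 + a 1 1 + a 2 2 = 0.
Hypothesis Ssym : forall i k j, S i k j = S k i j.
Hypothesis dcurl0 : forall k, S k 1 2 - S k 2 1 = df k * u 0 + f * a k 0.
Hypothesis dcurl1 : forall k, S k 2 0 - S k 0 2 = df k * u 1 + f * a k 1.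
Hypothesis dcurl2 : forall k, S k 0 1 - S k 1 0 = df k * u 2 + f * a k 2.
Hypothesis ddiv0 : forall k, S k 0 0 + S k 1 1 + S k 2 2 = 0.
Variable r : R.
Hypothesis rE : r = dot3 y y.
Hypothesis WE : dW * r = (2 * s - 3) * W.

(** The choice of the weight, [dW r = (2 s - 3) W], makes the terms without a sign
cancel and leaves a square and a zeroth-order term, whose factor [ds] can be made large.
The derivatives of the equations enter only through the combination [C] below, found by
identifying coefficients. *)
Lemma flux_divergence :
  (dW * y 0 * flux_val 0 + W * dflux_val 0) + (dW * y 1 * flux_val 1 + W * dflux_val 1)
   + (dW * y 2 * flux_val 2 + W * dflux_val 2)
  = W * (2 * shifted_sq + ds * r * sq_u).
Proof.
have a12 : a 1 2 = a 2 1 + f * u 0 by rewrite -curl0; ring.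
have a20 : a 2 0 = a 0 2 + f * u 1 by rewrite -curl1; ring.
have a01 : a 0 1 = a 1 0 + f * u 2 by rewrite -curl2; ring.
have a22 : a 2 2 = - a 0 0 - a 1 1 by have := div0; lra.
have -> : (dW * y 0 * flux_val 0 + W * dflux_val 0) + (dW * y 1 * flux_val 1 + W * dflux_val 1)
   + (dW * y 2 * flux_val 2 + W * dflux_val 2)
  = (dW * dot3 y y) * (s * sq_u + dot3 u euler) + W * (dflux_val 0 + dflux_val 1 + dflux_val 2).
  by rewrite /flux_val /dot3; ring.
rewrite -rE WE.
pose h0 k := S k 1 2 - S k 2 1 - (df k * u 0 + f * a k 0).
pose h1 k := S k 2 0 - S k 0 2 - (df k * u 1 + f * a k 1).
pose h2 k := S k 0 1 - S k 1 0 - (df k * u 2 + f * a k 2).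
have h00 k : h0 k = 0 by rewrite /h0 dcurl0 subrr.
have h10 k : h1 k = 0 by rewrite /h1 dcurl1 subrr.
have h20 k : h2 k = 0 by rewrite /h2 dcurl2 subrr.
pose C k := (y 0 * u 1 - y 1 * u 0) * h2 k + (y 1 * u 2 - y 2 * u 1) * h0 k + (y 2 * u 0 - y 0 * u 2) * h1 k
  + dot3 u y * (S k 0 0 + S k 1 1 + S k 2 2).
have C0 k : C k = 0 by rewrite /C h00 h10 h20 ddiv0 !mulr0 !addr0.
suff E : dflux_val 0 + dflux_val 1 + dflux_val 2 = 2 * shifted_sq + ds * r * sq_u
    - (2 * s - 3) * (s * sq_u + dot3 u euler) + (y 0 * C 0 + y 1 * C 1 + y 2 * C 2).
  by rewrite E !C0; ring.
rewrite /C /h0 /h1 /h2 /dflux_val /deuler rE /shifted_sq /dot3 /euler /sq_u.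
rewrite !(Ssym 0 1) !(Ssym 0 2) !(Ssym 1 2) a12 a20 a01 a22.
move: (S 0 0 0) (S 0 0 1) (S 0 0 2) (S 1 1 0) (S 1 1 1) (S 1 1 2) (S 2 2 0) (S 2 2 1) (S 2 2 2).
move: (S 1 0 0) (S 1 0 1) (S 1 0 2) (S 2 0 0) (S 2 0 1) (S 2 0 2) (S 2 1 0) (S 2 1 1) (S 2 1 2).
move: (a 0 0) (a 0 2) (a 1 0) (a 1 1) (a 2 1) (u 0) (u 1) (u 2) (y 0) (y 1) (y 2) (df 0) (df 1) (df 2).
move=> *; ring.
Qed.

(** For vectors, [4 (v + g) . v >= - |g|^2], with [v = E + s u], [g = f y x u] and [|y x
u|^2 <= |y|^2 |u|^2]. *)
Lemma shifted_sq_ge : - (f ^+ 2 * r * sq_u) <= 4 * shifted_sq.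
Proof.
rewrite rE /shifted_sq /dot3 /sq_u.
move: (euler 0) (euler 1) (euler 2) => e0 e1 e2.
move: (u 0) (u 1) (u 2) (y 0) (y 1) (y 2) => u0 u1 u2 y0 y1 y2.
have := sqr_ge0 (2 * (e0 + s * u0) + f * (y1 * u2 - y2 * u1)).
have := sqr_ge0 (2 * (e1 + s * u1) + f * (y2 * u0 - y0 * u2)).
have := sqr_ge0 (2 * (e2 + s * u2) + f * (y0 * u1 - y1 * u0)).
(* Lagrange's identity turns this square into the difference between [|y|^2 |u|^2] and
   [|y x u|^2]. *)
have := sqr_ge0 (f * (y0 * u0 + y1 * u1 + y2 * u2)).
lra.
Qed.

Lemma flux_divergence_ge : 0 <= W ->
  W * ((2 * (ds * r) - f ^+ 2 * r) * sq_u) <=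
  2 * ((dW * y 0 * flux_val 0 + W * dflux_val 0) + (dW * y 1 * flux_val 1 + W * dflux_val 1)
   + (dW * y 2 * flux_val 2 + W * dflux_val 2)).
Proof.
move=> W0; rewrite flux_divergence [leRHS]mulrCA; apply: ler_wpM2l => //.
have := shifted_sq_ge; lra.
Qed.

Lemma flux_val_bound (m : R) i : 0 <= m -> `|s| <= m -> (forall j, `|u j| <= 1) -> (forall j, `|y j| <= 1) ->
  (forall i j, `|a i j| <= 1) -> `|flux_val i| <= 3 * m + 27.
Proof.
move=> m0 sm u1 y1 a1.
have dotb v w c : 0 <= c -> (forall j, `|v j| <= 1) -> (forall j, `|w j| <= c) -> `|dot3 v w| <= 3 * c.
  move=> c0 v1 wc; have H j : `|v j * w j| <= c.
    by rewrite normrM -[leRHS]mul1r ler_pM.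
  rewrite /dot3 (le_trans (ler_normD _ _)) // (le_trans (lerD (ler_normD _ _) (lexx _))) //.
  have := H 0; have := H 1; have := H 2; lra.
have e3 j : `|euler j| <= 3.
  by have := dotb y (fun i => a i j) 1 ler01 y1 (fun i => a1 i j); rewrite mulr1.
have b1 := dotb u u 1 ler01 u1 u1; have b2 := dotb u euler 3 ltac:(by []) u1 e3.
have b3 := dotb u y 1 ler01 u1 y1; have b4 := dotb y euler 3 ltac:(by []) y1 e3.
rewrite /flux_val (le_trans (ler_normB _ _)) //.
rewrite (le_trans (lerD (ler_normD _ _) (lexx _))) // !normrM.
have t1 : `|s * sq_u + dot3 u euler| * `|y i| <= (3 * m + 9) * 1.
  apply: ler_pM => //; rewrite (le_trans (ler_normD _ _)) // normrM.
  have : `|s| * `|sq_u| <= m * (3 * 1) by apply: ler_pM.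
  lra.
have t2 : `|dot3 u y| * `|euler i| <= (3 * 1) * 3 by apply: ler_pM.
have t3 : `|dot3 y euler| * `|u i| <= (3 * 3) * 1 by apply: ler_pM.
lra.
Qed.

End CarlemanAlgebra.

(** * A cutoff function *)

Section DerivationRules.
Context {R : realType}.
Local Notation R3 := 'rV[R]_3.
Implicit Types (x y z : R3) (F G : R3 -> R).

Lemma dvD F G x v (a b : R) : is_derive x v F a -> is_derive x v G b ->
  is_derive x v (fun y => F y + G y) (a + b).
Proof. by move=> dF dG; exact: is_deriveD. Qed.

Lemma dvB F G x v (a b : R) : is_derive x v F a -> is_derive x v G b ->
  is_derive x v (fun y => F y - G y) (a - b).
Proof. by move=> dF dG; exact: is_deriveB. Qed.

Lemma dvM F G x v (a b : R) : is_derive x v F a -> is_derive x v G b ->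
  is_derive x v (fun y => F y * G y) (a * G x + F x * b).
Proof.
move=> dF dG; apply: (is_derive_eq (is_deriveM dF dG)).
by rewrite addrC; congr (_ + _); exact: mulrC.
Qed.

Lemma dvV F x v (b : R) : F x != 0 -> is_derive x v F b ->
  is_derive x v (fun y => (F y)^-1) (- (F x) ^- 2 * b).
Proof.
move=> F0 [dF <-]; apply: DeriveDef; first exact: (derivableV F0 dF).
exact: (deriveV F0 dF).
Qed.

Lemma dv_dot3 (F G : 'I_3 -> R3 -> R) x v (a b : 'I_3 -> R) :
  (forall i, is_derive x v (F i) (a i)) -> (forall i, is_derive x v (G i) (b i)) ->
  is_derive x v (fun y => dot3 (F ^~ y) (G ^~ y)) (dot3 a (G ^~ x) + dot3 (F ^~ x) b).
Proof.
move=> dF dG; rewrite /dot3; apply: (is_derive_eq (dvD (dvD (dvM (dF 0) (dG 0)) (dvM (dF 1) (dG 1))) (dvM (dF 2) (dG 2)))).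
by ring.
Qed.

(** The square of the positive part is [C^1] and piecewise polynomial. *)
Definition pos2 (t : R) : R := Num.max 0 t ^+ 2.

Lemma is_derive_pos2 (t : R) : is_derive t (1 : R) pos2 (2 * Num.max 0 t).
Proof.
have [t0|t0|->] := ltgtP t 0.
- rewrite mulr0.
  have E : {near t, (fun=> 0) =1 pos2}.
    have : \forall s \near t, s < 0 by exact: lt_nbhsl.
    by apply: filterS => s s0; rewrite /pos2 max_l ?expr0n // ltW.
  by apply: (near_eq_is_derive E); exact: is_derive_cst.
- have E : {near t, (fun s => s * s) =1 pos2}.
    have : \forall s \near t, 0 < s by exact: lt_nbhsr.
    by apply: filterS => s s0; rewrite /pos2 max_r ?ltW // expr2.
  apply: (near_eq_is_derive E); apply: is_derive_eq (is_deriveM (is_derive_id t 1) (is_derive_id t 1)) _.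
  by rewrite -mulr2n [_ *: _]mulr1 mulr_natl.
- rewrite mulr0; apply: (@is_derive_quadratic R R pos2 0 1 1 1 ltr01) => h _.
  rewrite /pos2 maxxx expr0n subr0 addr0 [h *: _]mulr1 mul1r normrX real_normK ?num_real //.
  case: (leP 0 h) => h0; rewrite ?expr0n ?sqr_ge0 //=.
Qed.

Lemma max0_continuous : continuous (fun t : R => Num.max 0 t).
Proof. by move=> t; apply: continuous_max; [exact: cst_continuous|exact: id]. Qed.

Variable a : R.
Hypothesis a0 : 0 < a.

(** A [C^1] cutoff function, equal to [1] for [t <= a] and to [0] for [t >= 2 a]. *)
Definition cut (t : R) : R := pos2 (1 - pos2 (t / a - 1)).
Definition dcut (t : R) : R :=
  2 * Num.max 0 (1 - pos2 (t / a - 1)) * - (2 * Num.max 0 (t / a - 1) / a).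

Lemma is_derive_cut (t : R) : is_derive t (1 : R) cut (dcut t).
Proof.
have d1 : is_derive t (1 : R) (fun s : R => s / a - 1) a^-1.
  apply: (is_derive_eq (is_deriveB (is_deriveM (is_derive_id t (1 : R)) (is_derive_cst a^-1 t (1 : R)))
    (is_derive_cst (1 : R) t (1 : R)))).
  by rewrite scaler0 add0r subr0 [_ *: _]mulr1.
have d2 : is_derive t (1 : R) (pos2 \o (fun s : R => s / a - 1)) (2 * Num.max 0 (t / a - 1) * a^-1).
  by apply: is_derive1_comp; exact: is_derive_pos2.
have d3 : is_derive t (1 : R) (fun s : R => 1 - pos2 (s / a - 1)) (- (2 * Num.max 0 (t / a - 1) / a)).
  apply: (is_derive_eq (is_deriveB (is_derive_cst (1 : R) t (1 : R)) d2)).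
  by rewrite sub0r.
exact: (@is_derive1_comp _ pos2 (fun s : R => 1 - pos2 (s / a - 1)) _ _ _ (is_derive_pos2 _) d3).
Qed.

Lemma dcut_continuous : continuous dcut.
Proof.
have cp : continuous (fun s : R => pos2 s).
  by move=> s; have [/derivable1_diffP/differentiable_continuous] := is_derive_pos2 s.
have c1 : continuous (fun s : R => s / a - 1).
  move=> s; apply: (@continuousB R R R (fun s => s / a) (fun=> 1)); last exact: cst_continuous.
  by apply: (@continuousM R R (fun s => s) (fun=> a^-1)); last exact: cst_continuous.
have c2 : continuous (fun s : R => 1 - pos2 (s / a - 1)).
  move=> s; apply: (@continuousB R R R (fun=> 1) (fun s => pos2 (s / a - 1))).
    exact: cst_continuous.
  exact: (continuous_comp (c1 s) (cp _)).
have cm (f : R -> R) : continuous f -> continuous (fun s : R => 2 * Num.max 0 (f s)).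
  move=> cf s; apply: (@continuousM R R (fun=> 2) (fun s => Num.max 0 (f s))).
    exact: cst_continuous.
  exact: (continuous_comp (cf s) (@max0_continuous _)).
move=> t; apply: (continuousM (cm _ c2 t)).
apply: (@continuousN R R R (fun s => 2 * Num.max 0 (s / a - 1) / a)).
apply: (continuousM (cm _ c1 t)); exact: cst_continuous.
Qed.

Lemma pos2_ge0 t : 0 <= pos2 t. Proof. exact: sqr_ge0. Qed.

Lemma cut_ge0 t : 0 <= cut t. Proof. exact: pos2_ge0. Qed.

Lemma pos2_le0 t : t <= 0 -> pos2 t = 0.
Proof. by move=> t0; rewrite /pos2 max_l // expr0n. Qed.

Lemma cut1 t : t <= a -> cut t = 1.
Proof.
move=> ta; rewrite /cut [pos2 (_ - 1)]pos2_le0 ?subr0; last by rewrite subr_le0 ler_pdivrMr // mul1r.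
by rewrite /pos2 max_r // expr1n.
Qed.

Lemma dcut0 t : t <= a -> dcut t = 0.
Proof.
move=> ta; rewrite /dcut [Num.max 0 (_ / _ - _)]max_l ?mulr0 ?mul0r ?oppr0 ?mulr0 //.
by rewrite subr_le0 ler_pdivrMr // mul1r.
Qed.

Lemma cut_arg_le0 t : 2 * a <= t -> 1 - pos2 (t / a - 1) <= 0.
Proof.
move=> ta; have H : 1 <= t / a - 1 by rewrite lerBrDr ler_pdivlMr //; lra.
by rewrite subr_le0 /pos2 max_r ?exprn_ege1 // (le_trans ler01).
Qed.

Lemma cut0 t : 2 * a <= t -> cut t = 0.
Proof. by move=> ta; rewrite /cut pos2_le0 // cut_arg_le0. Qed.

Lemma dcut_bound t : `|dcut t| <= 4 / a.
Proof.
rewrite /dcut; have [ta|ta] := leP (2 * a) t.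
  by rewrite (max_l (cut_arg_le0 ta)) mulr0 mul0r normr0 divr_ge0 // ltW.
set m1 := Num.max 0 (1 - _); set m2 := Num.max 0 (_ - 1).
have m1b : 0 <= m1 <= 1.
  by rewrite le_max lexx /= ge_max ler01 gerBl pos2_ge0.
have m2b : 0 <= m2 <= 1.
  by rewrite le_max lexx /= ge_max ler01 /= lerBlDr ler_pdivrMr //; lra.
case/andP: m1b => m10 m11; case/andP: m2b => m20 m21.
have ia : 0 <= a^-1 by rewrite invr_ge0 ltW.
rewrite mulrN normrN ger0_norm; last by rewrite !mulr_ge0.
rewrite mulrA ler_wpM2r // (_ : 4 = (2 * 1) * (2 * 1)); last by ring.
by apply: ler_pM; rewrite ?mulr_ge0 //; rewrite ler_pM2l.
Qed.

End DerivationRules.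

(** * Uniqueness near a zero of infinite order *)

Section LocalFlat.
Context {R : realType}.
Local Notation R3 := 'rV[R]_3.
Variables (p : R3) (V : set R3).
Hypotheses (oV : open V) (Vp : V p).
Implicit Types (x y z : R3) (F G : R3 -> R).

(** The local counterpart of [flatC1], for functions that are only known to be [C^1]
near [p]. *)
Definition flatC1on F := [/\ C1on V F, flat p F & forall i, flat p (partial i F)].

Lemma flat_eq_on F G : {in V, F =1 G} -> flat p F -> flat p G.
Proof.
move=> FG fF N; have [C [d d0 [C0 H]]] := fF N.
have [r r0 Hr] := open_ball_norm oV Vp.
exists C, (Num.min d r); first by rewrite lt_min d0.
split=> // x; rewrite le_min => /andP[xd xr].
by rewrite -FG ?H // mem_set //; exact: Hr.
Qed.

Lemma flatC1onD F G : flatC1on F -> flatC1on G -> flatC1on (fun x => F x + G x).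
Proof.
move=> [cF fF dF] [cG fG dG]; split; [exact: (C1D oV cF cG)|exact: flatD|move=> i].
apply: (@flat_eq_on (fun x => partial i F x + partial i G x)); last exact: flatD.
by move=> x /set_mem Vx; rewrite (partialD (C1_derivable cF Vx) (C1_derivable cG Vx)).
Qed.

Lemma flatC1onM F G : flatC1on F -> C1on V G -> flatC1on (fun x => F x * G x).
Proof.
move=> [cF fF dF] cG; have bG := continuous_bigO (C1_continuous cG Vp).
split; [exact: (C1M oV cF cG)|exact: flatM|move=> i].
apply: (@flat_eq_on (fun x => partial i F x * G x + F x * partial i G x)).
  by move=> x /set_mem Vx; rewrite (partialM (C1_derivable cF Vx) (C1_derivable cG Vx)).
apply: flatD; first exact: flatM.
by apply: flatM => //; exact: continuous_bigO (C1_partial_continuous cG Vp).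
Qed.

Lemma flatC1on_smooth F : smooth_on V F -> (forall k, vanish k p F) -> flatC1on F.
Proof.
move=> sF vF; split; first exact: C1_smooth.
  by move=> N; apply: (vanish_bigO oV Vp sF).
move=> i N; apply: (vanish_bigO oV Vp (smooth_on_partial i sF)) => k _.
by have /vanishS/(_ i) := vF k.+1.
Qed.

Lemma flatC1on_extend K F : closed K -> K `<=` V -> flatC1on F ->
  (forall x, ~ K x -> F x = 0) -> flatC1 p F.
Proof. by move=> cK KV [cF fF dF] F0; split=> //; exact: (C1_extend oV cK KV cF F0). Qed.

End LocalFlat.

Section LocalUniqueness.
Context {R : realType}.
Local Notation R3 := 'rV[R]_3.
Variables (p : R3) (U : set R3) (f : R3 -> R) (X : R3 -> R3).
Hypotheses (oU : open U) (sf : smooth_on U f).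
Hypothesis BX : divfree_beltrami_field U f X.
Hypothesis vX : forall k j, vanish k p (component X j).
Variables (a M : R).
Hypotheses (a0 : 0 < a) (a1 : 3 * a <= 1).
Local Notation rho := (rho p).
Local Notation e i := (delta_mx 0 i : R3).
Let u j := component X j.
Let V := [set x | rho x < 3 * a].
Hypothesis VU : V `<=` U.
Hypothesis ub : forall x j, V x -> `|u j x| <= 1.
Hypothesis dub : forall x i j, V x -> `|partial i (u j) x| <= 1.
Hypothesis fb : forall x, V x -> `|f x| <= M.
Implicit Types (x z : R3).

Let y j : R3 -> R := fun x => x 0 j - p 0 j.
Let K := [set x | rho x <= 2 * a].

Let rho_continuous : continuous rho.
Proof. by move=> x; exact: (smooth_on_continuous (rho_smooth p openT) (I : setT x)). Qed.

Let oV : open V.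
Proof. exact: ((continuousP _).1 rho_continuous _ (@open_lt R (3 * a))). Qed.

Let cK : closed K.
Proof. exact: ((continuous_closedP _).1 rho_continuous _ (@closed_le R (2 * a))). Qed.

Let KV : K `<=` V.
Proof. by move=> x; rewrite /K /V /= => H; move: a0; lra. Qed.

Let Vp : V p.
Proof. by rewrite /V /= rho_p mulr_gt0. Qed.

Let su j : smooth_on V (u j).
Proof. by case: BX => H _ _; exact: (smooth_on_sub VU (H j)). Qed.

Let sy j : smooth_on V (y j).
Proof. exact: (smooth_onD oV (smooth_on_coord j oV) (smooth_on_cst (- p 0 j) oV)). Qed.

(** The function [s] of the divergence identity: the relation between weight and [s]
required there forces it once the weight is [(1 + 1/rho)^n]. *)
Definition weight_exponent (n : nat) x : R := 3 / 2 - n%:R / (1 + rho x).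
Definition weight_exponent_slope (n : nat) x : R := 2 * n%:R / (1 + rho x) ^+ 2.
Definition weight (n : nat) x : R := (1 + (rho x)^-1) ^+ n.
Definition weight_slope (n : nat) x : R := - (2 * n%:R * weight n x) / (rho x * (1 + rho x)).

Definition flux n i x : R :=
  flux_val (u ^~ x) (y ^~ x) (fun k j => partial k (u j) x) (weight_exponent n x) i.
Definition dflux n i x : R :=
  dflux_val (u ^~ x) (y ^~ x) (fun k j => partial k (u j) x)
    (fun i k j => partial i (partial k (u j)) x) (weight_exponent n x) (weight_exponent_slope n x) i.

Let r1 x : 1 + rho x != 0.
Proof. by rewrite gt_eqF // ltr_pwDl // rho_ge0. Qed.

Let C1y j : C1on V (y j) := C1_smooth (sy j).
Let C1u j : C1on V (u j) := C1_smooth (su j).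
Let C1du k j : C1on V (partial k (u j)) := C1_smooth (smooth_on_partial k (su j)).
Let C1cst (c : R) : C1on V (fun=> c) := C1_smooth (smooth_on_cst c oV).

Lemma weight_exponent_C1 n : C1on V (weight_exponent n).
Proof.
have C1r : C1on V (fun x => (1 + rho x)^-1).
  apply: (C1V oV) => [|x _]; last exact: r1.
  exact: (C1D oV (C1cst 1) (C1_smooth (rho_smooth p oV))).
have -> : weight_exponent n = fun x => 3 / 2 + - n%:R * (1 + rho x)^-1.
  by apply/funext => x; rewrite /weight_exponent mulNr.
exact: (C1D oV (C1cst _) (C1M oV (C1cst _) C1r)).
Qed.

Lemma euler_C1 j : C1on V (fun x => euler (y ^~ x) (fun k j => partial k (u j) x) j).
Proof.
exact: (C1D oV (C1D oV (C1M oV (C1y 0) (C1du 0 j)) (C1M oV (C1y 1) (C1du 1 j))) (C1M oV (C1y 2) (C1du 2 j))).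
Qed.

Lemma flux_flat n i : flatC1on p V (flux n i).
Proof.
pose E j x := euler (y ^~ x) (fun k j => partial k (u j) x) j.
pose s := weight_exponent n.
have -> : flux n i = fun x =>
   u 0 x * ((s x * u 0 x + E 0 x) * y i x + y 0 x * E i x) +
   u 1 x * ((s x * u 1 x + E 1 x) * y i x + y 1 x * E i x) +
   u 2 x * ((s x * u 2 x + E 2 x) * y i x + y 2 x * E i x) +
   u i x * (-1 * (y 0 x * E 0 x + y 1 x * E 1 x + y 2 x * E 2 x)).
  by apply/funext => x; rewrite /flux /flux_val /sq_u /dot3 /E /s; ring.
have CE j : C1on V (E j) by exact: euler_C1.
have Cs : C1on V s by exact: weight_exponent_C1.
have fu j : flatC1on p V (u j) by apply: (flatC1on_smooth oV Vp (su j)) => k; exact: vX.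
have T j : flatC1on p V (fun x => u j x * ((s x * u j x + E j x) * y i x + y j x * E i x)).
  apply: (flatC1onM oV Vp (fu j)); apply: (C1D oV); last exact: (C1M oV (C1y j) (CE i)).
  exact: (C1M oV (C1D oV (C1M oV Cs (C1u j)) (CE j)) (C1y i)).
apply: (flatC1onD oV Vp (flatC1onD oV Vp (flatC1onD oV Vp (T 0) (T 1)) (T 2))).
apply: (flatC1onM oV Vp (fu i)); apply: (C1M oV (C1cst _)).
exact: (C1D oV (C1D oV (C1M oV (C1y 0) (CE 0)) (C1M oV (C1y 1) (CE 1))) (C1M oV (C1y 2) (CE 2))).
Qed.

Lemma is_derive_rho x i : is_derive x (e i) rho (2 * y i x).
Proof.
rewrite -partial_rho; apply: derivableP.
exact: (smooth_on_derivable (rho_smooth p openT) (I : setT x)).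
Qed.

Lemma is_derive_weight_exponent n x i :
  is_derive x (e i) (weight_exponent n) (weight_exponent_slope n x * y i x).
Proof.
have d1 : is_derive x (e i) (fun x => 1 + rho x) (2 * y i x).
  apply: (is_derive_eq (dvD (is_derive_cst (1 : R) x (e i)) (is_derive_rho x i))); exact: add0r.
have d2 : is_derive x (e i) (fun x => (1 + rho x)^-1) (- (1 + rho x) ^- 2 * (2 * y i x)).
  exact: (dvV (r1 x) d1).
apply: (is_derive_eq (dvB (is_derive_cst (3 / 2 : R) x (e i)) (dvM (is_derive_cst (n%:R : R) x (e i)) d2))).
rewrite /weight_exponent_slope mul0r !add0r; field; exact: r1.
Qed.

Lemma is_derive_weight n x i : x != p -> is_derive x (e i) (weight n) (weight_slope n x * y i x).
Proof.
move=> xp; have r0 : rho x != 0 by rewrite gt_eqF // rho_gt0.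
have d2 : is_derive x (e i) (fun x => 1 + (rho x)^-1) (- (rho x) ^- 2 * (2 * y i x)).
  exact: (is_derive_eq (dvD (is_derive_cst (1 : R) x (e i)) (dvV r0 (is_derive_rho x i))) (add0r _)).
elim: n => [|n IH].
  rewrite /weight_slope mulr0 mul0r oppr0 mul0r mul0r.
  exact: (is_derive_cst (1 : R) x (e i)).
have -> : weight n.+1 = fun x => weight n x * (1 + (rho x)^-1).
  by apply/funext => z; rewrite /weight exprSr.
apply: (is_derive_eq (dvM IH d2)).
rewrite /weight_slope /weight [(1 + _) ^+ n.+1]exprSr -[n.+1%:R]natr1; move: ((1 + (rho x)^-1) ^+ n) => w.
by field; rewrite r0 r1.
Qed.

Lemma is_derive_y x i j : is_derive x (e i) (y j) (i == j)%:R.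
Proof.
have := dvB (is_derive_coord x (e i) j) (is_derive_cst (p 0 j) x (e i)).
by rewrite subr0 mxE eqxx eq_sym.
Qed.

Lemma is_derive_euler x i j : V x ->
  is_derive x (e i) (fun x => euler (y ^~ x) (fun k j => partial k (u j) x) j)
   (deuler (y ^~ x) (fun k j => partial k (u j) x) (fun i k j => partial i (partial k (u j)) x) i j).
Proof.
move=> Vx; have dS k : is_derive x (e i) (partial k (u j)) (partial i (partial k (u j)) x).
  by apply: derivableP; exact: (smooth_on_derivable (smooth_on_partial k (su j)) Vx).
have dy k := is_derive_y x i k.
apply: (is_derive_eq (dv_dot3 dy dS)).
by rewrite dot3_deltal.
Qed.

Lemma is_derive_flux n x i : V x -> is_derive x (e i) (flux n i) (dflux n i x).
Proof.
move=> Vx; have du j : is_derive x (e i) (u j) (partial i (u j) x).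
  by apply: derivableP; exact: (smooth_on_derivable (su j) Vx).
have dE j := is_derive_euler i j Vx.
have dy k := is_derive_y x i k.
have dyi : is_derive x (e i) (y i) 1 by have := dy i; rewrite eqxx.
have ds := is_derive_weight_exponent n x i.
have d1 := dvM (dvD (dvM ds (dv_dot3 du du)) (dv_dot3 du dE)) dyi.
have d2 := dvM (dv_dot3 du dy) (dE i).
have d3 := dvM (dv_dot3 dy dE) (du i).
apply: (is_derive_eq (dvB (dvD d1 d2) d3)).
rewrite dot3_deltal dot3_deltar /dflux /dflux_val.
rewrite -[sq_u _]/(dot3 (u ^~ x) (u ^~ x)) (dot3C (fun j => partial i (u j) x) (u ^~ x)).
move: (dot3 (u ^~ x) (u ^~ x)) (dot3 (u ^~ x) (fun j => partial i (u j) x)) => N2 uD.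
ring.
Qed.

Definition cut_flux n i x : R := cut a (rho x) * flux n i x * weight n x.

Lemma cut_C1 W : open W -> C1on W (fun x => cut a (rho x)).
Proof.
move=> oW; apply: (C1_comp oW (is_derive_cut a) (@dcut_continuous _ a)).
exact: (C1_smooth (rho_smooth p oW)).
Qed.

Lemma cut_flux_flatC1 n i : flatC1 p (cut_flux n i).
Proof.
apply: (@flatC1_weight _ p n (fun x => cut a (rho x) * flux n i x)).
apply: (flatC1on_extend oV cK KV) => [|x].
  have -> : (fun x => cut a (rho x) * flux n i x) = fun x => flux n i x * cut a (rho x).
    by apply/funext => x; rewrite mulrC.
  exact: (flatC1onM oV Vp (flux_flat n i) (cut_C1 oV)).
by rewrite /K /= => /negP; rewrite -ltNge => Kx; rewrite cut0 ?mul0r // ltW.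
Qed.

Lemma is_derive_cut_flux n x i : V x -> x != p ->
  is_derive x (e i) (cut_flux n i)
   (cut a (rho x) * (weight_slope n x * y i x * flux n i x + weight n x * dflux n i x)
    + dcut a (rho x) * (2 * y i x) * (flux n i x * weight n x)).
Proof.
move=> Vx xp.
have d1 : is_derive x (e i) (fun x => cut a (rho x)) (dcut a (rho x) * (2 * y i x)).
  exact: (is_derive_comp (is_derive_cut a _) (is_derive_rho x i)).
apply: (is_derive_eq (dvM (dvM d1 (is_derive_flux n i Vx)) (is_derive_weight n i xp))).
by move: (dflux n i x) (flux n i x) => *; ring.
Qed.

(** The divergence identity for the field at [x], after the second-order terms and the
equations have been put in the form it requires. *)
Lemma beltrami_divergence_ge n x : V x -> x != p ->
  weight n x * ((2 * (weight_exponent_slope n x * rho x) - f x ^+ 2 * rho x) * sq_u (u ^~ x))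
  <= 2 * (\sum_(i < 3) (weight_slope n x * y i x * flux n i x + weight n x * dflux n i x)).
Proof.
move=> Vx xp; have Ux := VU Vx; have Ux' := mem_set Ux.
have sU j : smooth_on U (u j) by case: BX => H _ _; exact: H.
rewrite sum3 /flux /dflux.
have C (i j k : 'I_3) : (i + 1 = j)%R -> (i + 2 = k)%R ->
    partial j (u k) x - partial k (u j) x = f x * u i x.
  by move=> <- <-; exact: (beltrami_curlE BX).
have D (i j k l : 'I_3) : (i + 1 = j)%R -> (i + 2 = k)%R ->
    partial l (partial j (u k)) x - partial l (partial k (u j)) x
    = partial l f x * u i x + f x * partial l (u i) x.
  by move=> ij ik; exact: (beltrami_curl_partial oU sf BX).
have rne : rho x != 0 by rewrite gt_eqF // rho_gt0.
apply: (@flux_divergence_ge R (u ^~ x) (y ^~ x) (fun k j => partial k (u j) x)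
  (fun i k j => partial i (partial k (u j)) x) (f x) (weight_exponent n x)
  (weight_exponent_slope n x) (weight n x) (weight_slope n x) (fun l => partial l f x)).
- by apply: C; exact/val_inj.
- by apply: C; exact/val_inj.
- by apply: C; exact/val_inj.
- by rewrite -(sum3 (fun i => partial i (u i) x)); exact: (beltrami_div BX).
- by move=> i k j; exact: (partialC i k oU (sU j) Ux').
- by move=> k; apply: D; exact/val_inj.
- by move=> k; apply: D; exact/val_inj.
- by move=> k; apply: D; exact/val_inj.
- by move=> k; rewrite -(sum3 (fun i => partial k (partial i (u i)) x)); exact: (beltrami_div_partial oU BX).
- by rewrite /rho sum3 /dot3 /y !expr2.
- by rewrite /weight_slope /weight_exponent; move: (weight n x) => w; field; rewrite rne r1.
- by rewrite exprn_ge0 // addr_ge0 // invr_ge0 rho_ge0.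
Qed.

Lemma partial_cut_flux_center n i : partial i (cut_flux n i) p = 0.
Proof. by have [_ _ /(_ i) /flat0] := cut_flux_flatC1 n i. Qed.

Lemma partial_cut_flux_outside n i x : ~ K x -> partial i (cut_flux n i) x = 0.
Proof.
move=> nKx; have oK : open (~` K) by rewrite openC.
have [] // := @near0_partial R (cut_flux n i) x i.
apply: (near_open oK nKx) => z /negP; rewrite -ltNge => Kz.
by rewrite /cut_flux cut0 ?mul0r // ltW.
Qed.

(** The lower bound of the weighted divergence, with the cutoff as a factor. *)
Definition density n x : R :=
  cut a (rho x) * (weight n x * ((2 * (weight_exponent_slope n x * rho x) - f x ^+ 2 * rho x) * sq_u (u ^~ x))).

Definition flux_bound (n : nat) : R := 48 / a * (3 * (n%:R + 2) + 27) * (1 + a^-1) ^+ n.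

Lemma flux_bound_ge0 n : 0 <= flux_bound n.
Proof.
rewrite /flux_bound !mulr_ge0 ?invr_ge0 ?exprn_ge0 ?addr_ge0 ?mulr_ge0 ?invr_ge0 //; exact: ltW.
Qed.

Let yb x j : V x -> `|y j x| <= 1.
Proof.
move=> Vx; rewrite -(expr_le1 (n := 2)) // real_normK ?num_real //.
apply: le_trans (_ : rho x <= 1); last by apply: le_trans (ltW Vx) a1.
rewrite /rho (bigD1 j) //= lerDl; apply: sumr_ge0 => i _; exact: sqr_ge0.
Qed.

(** The derivative of the cutoff is supported in [a <= rho], where the weight is at most
[(1 + 1/a)^n]. *)
Lemma cutoff_term_bound n x i : V x -> x != p ->
  `|dcut a (rho x) * (2 * y i x) * (flux n i x * weight n x)| <= flux_bound n / 6.
Proof.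
move=> Vx xp; have [ra|ra] := leP (rho x) a.
  by rewrite dcut0 // !mul0r normr0 divr_ge0 // flux_bound_ge0.
have n0 : 0 <= n%:R :> R by [].
have sb : `|weight_exponent n x| <= n%:R + 2.
  rewrite (le_trans (ler_normB _ _)) // addrC lerD //.
    rewrite normrM ger0_norm // normfV ler_pdivrMr ?normr_gt0 ?r1 // ler_peMr //.
    by rewrite ger0_norm ?lerDl ?addr_ge0 ?rho_ge0.
  by rewrite ger0_norm //; lra.
have m0 : 0 <= n%:R + 2 :> R by rewrite addr_ge0.
have fl := @flux_val_bound R (u ^~ x) (y ^~ x) (fun k j => partial k (u j) x) (weight_exponent n x) (n%:R + 2) i m0 sb
  (fun j => ub j Vx) (fun j => yb j Vx) (fun k j => dub k j Vx).
have wb : `|weight n x| <= (1 + a^-1) ^+ n.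
  rewrite ger0_norm; last by rewrite exprn_ge0 // addr_ge0 // invr_ge0 rho_ge0.
  rewrite lerXn2r ?nnegrE ?addr_ge0 ?invr_ge0 ?rho_ge0 //; first exact: ltW.
  by rewrite lerD2l lef_pV2 ?posrE //; [exact: ltW|exact: lt_trans ra].
have h1 := dcut_bound a0 (rho x); have h2 := yb i Vx.
move: (dcut a (rho x)) h1 => dc h1.
rewrite !normrM; apply: le_trans (_ : 4 / a * (2 * 1) * ((3 * (n%:R + 2) + 27) * (1 + a^-1) ^+ n) <= _).
  apply: ler_pM; rewrite ?mulr_ge0 //; last exact: ler_pM.
  apply: ler_pM; rewrite ?mulr_ge0 //; apply: ler_pM => //.
  by rewrite ger0_norm.
rewrite /flux_bound le_eqVlt; apply/orP; left; apply/eqP; field; exact: lt0r_neq0.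
Qed.

Lemma density_le n x :
  density n x <= \sum_(i < 3) partial i (fun z => 2 * cut_flux n i z) x + flux_bound n.
Proof.
have dC i : derivable (cut_flux n i) x (e i).
  by have [cF _ _] := cut_flux_flatC1 n i; exact: (C1_derivable cF (I : setT x)).
under eq_bigr do rewrite (partialZ _ (dC _)); rewrite -mulr_sumr.
have [->|xp] := eqVneq x p.
  rewrite big1 => [|i _]; last exact: partial_cut_flux_center.
  rewrite /density rho_p !mulr0 subrr mul0r !mulr0 add0r; exact: flux_bound_ge0.
have [Kx|nKx] := pselect (K x); last first.
  rewrite big1 => [|i _]; last exact: partial_cut_flux_outside.
  rewrite mulr0 add0r /density cut0 ?mul0r ?flux_bound_ge0 //.
  by move/negP: nKx; rewrite -ltNge => /ltW.
have Vx := KV Kx.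
have pE i : partial i (cut_flux n i) x =
    cut a (rho x) * (weight_slope n x * y i x * flux n i x + weight n x * dflux n i x)
    + dcut a (rho x) * (2 * y i x) * (flux n i x * weight n x).
  by case: (is_derive_cut_flux n i Vx xp).
under eq_bigr do rewrite pE; rewrite big_split /= -mulr_sumr mulrDr.
have H := beltrami_divergence_ge n Vx xp.
have := ler_wpM2l (cut_ge0 a (rho x)) H; rewrite -/(density n x) mulrCA => {}H.
rewrite -addrA; apply: (le_trans H); rewrite lerDl.
rewrite sum3.
have b i := cutoff_term_bound n i Vx xp.
move: (b 0) (b 1) (b 2) => /ler_normlP[b0 _] /ler_normlP[b1 _] /ler_normlP[b2 _].
lra.
Qed.

(** For large [n] the gain [weight_exponent_slope], of order [n], dominates the loss
[f^2]. *)
Lemma density_coef_ge n x : M ^+ 2 + 1 <= n%:R -> V x ->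
  rho x <= 2 * (weight_exponent_slope n x * rho x) - f x ^+ 2 * rho x.
Proof.
move=> nM Vx; have r0 := rho_ge0 p x; have rho1 : rho x <= 1 by apply: le_trans (ltW Vx) a1.
have f2 : f x ^+ 2 <= M ^+ 2.
  by rewrite -[leLHS]real_normK ?num_real // lerXn2r ?nnegrE ?fb // (le_trans _ (fb Vx)).
have s4 : n%:R <= 2 * weight_exponent_slope n x.
  have q0 : 0 < (1 + rho x) ^+ 2 by rewrite exprn_gt0 // ltr_pwDl.
  have q4 : (1 + rho x) ^+ 2 <= 4.
    have : 0 <= (1 - rho x) * (3 + rho x) by rewrite mulr_ge0 ?subr_ge0 ?addr_ge0.
    lra.
  rewrite /weight_exponent_slope; move: ((1 + rho x) ^+ 2) q0 q4 => q q0 q4.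
  rewrite mulrA ler_pdivlMr //; have : 0 <= n%:R * (4 - q) by rewrite mulr_ge0 // subr_ge0.
  lra.
rewrite mulrA -mulrBl -[leLHS]mul1r ler_wpM2r //; lra.
Qed.

Lemma density_ge0 n x : M ^+ 2 + 1 <= n%:R -> 0 <= density n x.
Proof.
move=> nM; rewrite /density; have [Vx|] := ltP (rho x) (3 * a).
  rewrite mulr_ge0 ?cut_ge0 // mulr_ge0 //.
    by rewrite /weight exprn_ge0 // addr_ge0 // invr_ge0 rho_ge0.
  rewrite mulr_ge0 //; first exact: le_trans (rho_ge0 p x) (density_coef_ge nM Vx).
  by rewrite /sq_u -!expr2 !addr_ge0 ?sqr_ge0.
by move=> Vx; rewrite cut0 ?mul0r //; move: a0; lra.
Qed.

(** By the inequality of Bernoulli, [(1 + t)^(2 m)] is at least [(m t)^2]. *)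
Lemma exp_beats_linear (t c D : R) n0 : 0 < t -> 0 < c -> 0 <= D ->
  exists2 n, (n0 <= n)%N & D * (3 * (n%:R + 2) + 27) < c * (1 + t) ^+ n.
Proof.
move=> t0 c0 D0; pose m := (n0 + (Num.truncn (39 * D / (c * t ^+ 2))).+1)%N.
have m1 : (0 < m)%N by rewrite /m addnS.
have mR : 1 <= m%:R :> R by rewrite ler1n.
exists (2 * m)%N; first by rewrite /m; lia.
have bern : 1 + m%:R * t <= (1 + t) ^+ m.
  elim: (m) => [|k IH]; first by rewrite mul0r addr0 expr0.
  rewrite exprS; apply: le_trans (_ : (1 + t) * (1 + k%:R * t) <= _).
    have : 0 <= k%:R * t * t by rewrite !mulr_ge0 // ltW.
    rewrite -[k.+1%:R]natr1; move: (k%:R : R) => q; lra.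
  by rewrite ler_wpM2l // addr_ge0 // ltW.
have mt0 : 0 <= m%:R * t by rewrite mulr_ge0 // ltW.
apply: lt_le_trans (_ : c * (m%:R * t) ^+ 2 <= _); last first.
  rewrite ler_wpM2l ?(ltW c0) // mulnC exprM lerXn2r ?nnegrE ?exprn_ge0 ?addr_ge0 ?(ltW t0) //.
  by rewrite (le_trans _ bern) // lerDr.
have ct : 0 < c * t ^+ 2 by rewrite mulr_gt0 // exprn_gt0.
have mbig : 39 * D < m%:R * (c * t ^+ 2).
  rewrite -ltr_pdivrMr //; apply: (lt_le_trans (truncnS_gt _)).
  by rewrite ler_nat /m leq_addl.
apply: le_lt_trans (_ : 39 * D * m%:R < _).
  rewrite natrM; have : 0 <= D * (m%:R - 1) by rewrite mulr_ge0 // subr_ge0.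
  lra.
rewrite (_ : c * (m%:R * t) ^+ 2 = m%:R * (c * t ^+ 2) * m%:R); last by ring.
by rewrite ltr_pM2r // ltr0n.
Qed.

(** If the field did not vanish at [x], it would be bounded below on a ball contained in
[rho < a'] with [a' < a], where the weight is at least [(1 + 1/a')^n]. The comparison of
the density with a divergence bounds this by the cutoff error, a multiple of [n (1 +
1/a)^n], which is impossible for large [n]. *)
Lemma beltrami_zero_near x j : rho x < a -> u j x = 0.
Proof.
move=> xa; apply/eqP; apply: contraT => ux0.
have Vx : V x by rewrite /V /=; move: a0 xa; lra.
have xp : x != p.
  by apply: contraNneq ux0 => ->; apply/eqP; exact: ((vanish0 _ _).1 (@vX 0%N j)).
have r0 := rho_gt0 xp; pose a' := (rho x + a) / 2.
have aa' : a' < a by rewrite /a'; lra.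
have ra' : rho x < a' by rewrite /a'; lra.
have a'0 : 0 < a' by apply: lt_trans ra'.
pose N2 z := sq_u (u ^~ z).
have N20 : 0 < N2 x.
  have H k : 0 <= u k x * u k x by rewrite -expr2 sqr_ge0.
  have : 0 < u j x * u j x by rewrite -expr2 lt_neqAle eq_sym sqrf_eq0 ux0 sqr_ge0.
  rewrite /N2 /sq_u; move: (H 0) (H 1) (H 2); move: (j); apply: ord3_ind; lra.
have N2c : {for x, continuous N2}.
  apply: (smooth_on_continuous _ Vx).
  exact: (smooth_onD oV (smooth_onD oV (smooth_onM oV (su 0) (su 0)) (smooth_onM oV (su 1) (su 1))) (smooth_onM oV (su 2) (su 2))).
have near : \forall z \near x, [/\ rho z < a', rho x / 2 < rho z & N2 x / 2 < N2 z].
  have n1 : \forall z \near x, rho z < a' by apply: (cvgr_lt (rho x) (@rho_continuous x)).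
  have n2 : \forall z \near x, rho x / 2 < rho z by apply: (cvgr_gt (rho x) (@rho_continuous x)); lra.
  have n3 : \forall z \near x, N2 x / 2 < N2 z by apply: (cvgr_gt (N2 x) N2c); lra.
  by near=> z; split; near: z.
have [d d0 Hd] := near_closed_ball near.
pose r := Num.min (d / 2) 1.
have rpos : 0 < r by rewrite lt_min ltr01 divr_gt0.
have Hr z : `|z - x| <= 2 * r -> [/\ rho z < a', rho x / 2 < rho z & N2 x / 2 < N2 z].
  move=> zx; apply: Hd; rewrite (le_trans zx) //.
  have : r <= d / 2 by rewrite ge_min lexx.
  by move: d0; lra.
pose dl := rho x / 2 * (N2 x / 2).
have dl0 : 0 < dl by rewrite mulr_gt0 ?divr_gt0.
have Vz z : rho z < a' -> V z by rewrite /V /= => za; move: a0 aa' za; lra.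
have lower n z : M ^+ 2 + 1 <= n%:R -> `|z - x| <= 2 * r -> dl * (1 + a'^-1) ^+ n <= density n z.
  move=> nM /Hr[z1 z2 z3]; rewrite /density (cut1 a0 (ltW (lt_trans z1 aa'))) mul1r.
  rewrite mulrC; have z0 : 0 < rho z by apply: lt_trans z2; rewrite divr_gt0.
  apply: ler_pM; first by rewrite exprn_ge0 // addr_ge0 // invr_ge0 ltW.
  - exact: ltW.
  - rewrite /weight lerXn2r ?nnegrE ?addr_ge0 ?invr_ge0 ?(ltW a'0) ?(ltW z0) //.
    by rewrite lerD2l lef_pV2 ?posrE // ltW.
  apply: ler_pM; rewrite ?divr_ge0 ?(ltW r0) ?(ltW N20) //; last exact: ltW.
  exact: le_trans (ltW z2) (density_coef_ge nM (Vz _ z1)).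
pose t := (1 + a'^-1) / (1 + a^-1) - 1.
have ia : 0 < 1 + a^-1 by rewrite addr_gt0 // invr_gt0.
have t0 : 0 < t.
  by rewrite subr_gt0 ltr_pdivlMr // mul1r ltrD2l ltf_pV2.
pose n0 := (Num.truncn (M ^+ 2 + 1)).+1.
have c0 : 0 < dl * (2 * r) ^+ 3 by rewrite mulr_gt0 // exprn_gt0 // mulr_gt0.
have D0 : 0 <= 64 * (48 / a) by rewrite mulr_ge0 // divr_ge0 // ltW.
have [n n0n] := exp_beats_linear n0 t0 c0 D0.
rewrite ltNge => /negP[]; have nM : M ^+ 2 + 1 <= n%:R.
  by apply: ltW; apply: (lt_le_trans (truncnS_gt _)); rewrite ler_nat.
have psiD i : flatC1 p (fun z => 2 * cut_flux n i z).
  have -> : (fun z => 2 * cut_flux n i z) = fun z => cut_flux n i z + cut_flux n i z.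
    by apply/funext => z; ring.
  by apply: flatC1D; exact: cut_flux_flatC1.
have cP i : C1on setT (fun z => 2 * cut_flux n i z) by case: (psiD i).
have := @grid_compare R p 2 ltac:(by []) (density n) (fun i z => 2 * cut_flux n i z) x (flux_bound n) r
  (dl * (1 + a'^-1) ^+ n) (fun i z => C1_derivable (cP i) (I : setT z)).
have -> : (2 * 2 : R) ^+ 3 = 64 by rewrite -natrM -natrX.
move=> /(_ (fun i z => C1_partial_continuous (cP i) (I : setT z))) G.
have {G} : dl * (1 + a'^-1) ^+ n * (2 * r) ^+ 3 <= 64 * flux_bound n.
  apply: G => //.
  - move=> i z zp; rewrite /cut_flux cut0 ?mul0r ?mulr0 //.
    have := rho_ge p z; have : 2 ^+ 2 <= `|z - p| ^+ 2 :> R by rewrite lerXn2r ?nnegrE.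
    by move: a1; lra.
  - exact: density_le.
  - by move=> z; exact: density_ge0.
  - by rewrite mulr_ge0 ?exprn_ge0 ?addr_ge0 ?invr_ge0 // ltW.
  - by move=> z; exact: lower.
  have r1' : r <= 1 by rewrite ge_min lexx orbT.
  suff : `|x - p| <= 1 by move: r1'; lra.
  rewrite -(expr_le1 (n := 2)) //; have := rho_ge p x; move: xa a1; lra.
rewrite /flux_bound => G.
rewrite -(ler_pM2r (exprn_gt0 n ia)).
have E : (1 + t) ^+ n * (1 + a^-1) ^+ n = (1 + a'^-1) ^+ n.
  by rewrite -exprMn /t addrCA subrr addr0 divfK // gt_eqF.
rewrite -[leLHS]mulrA E -[leLHS]mulrA [_ ^+ 3 * _]mulrC [leLHS]mulrA.
by apply: (le_trans G); rewrite !mulrA.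
Unshelve. all: end_near.
Qed.

End LocalUniqueness.

(** * Uniqueness on a connected set *)

Section Unique.
Context {R : realType}.
Local Notation R3 := 'rV[R]_3.
Variables (U : set R3) (f : R3 -> R) (X : R3 -> R3).
Hypotheses (oU : open U) (sf : smooth_on U f).
Hypothesis BX : divfree_beltrami_field U f X.
Implicit Types (p x : R3).

Let sX j : smooth_on U (component X j).
Proof. by case: BX => H _ _; exact: H. Qed.

Lemma near_le (F : R3 -> R) p c : {for p, continuous F} -> `|F p| < c ->
  \forall x \near p, `|F x| <= c.
Proof.
move=> cF Fc; have cN : {for p, continuous (fun x => `|F x|)} by exact: (cvg_norm cF).
have : \forall x \near p, `|F x| < c by exact: (cvgr_lt _ cN).
by apply: filterS => x /ltW.
Qed.

Lemma beltrami_locally_zero p : U p -> (forall k j, vanish k p (component X j)) ->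
  \forall x \near p, X x = 0.
Proof.
move=> Up vX.
have n1 j : \forall x \near p, `|component X j x| <= 1.
  apply: near_le; first exact: (smooth_on_continuous (sX j) Up).
  by rewrite ((vanish0 _ _).1 (vX 0%N j)) normr0.
have n2 i j : \forall x \near p, `|partial i (component X j) x| <= 1.
  apply: near_le; first exact: (smooth_on_continuous (smooth_on_partial i (sX j)) Up).
  by rewrite ((vanish0 _ _).1 ((vanishS _ _ _).1 (vX 1%N j) i)) normr0.
have n3 : \forall x \near p, `|f x| <= `|f p| + 1.
  by apply: (near_le (smooth_on_continuous sf Up)); rewrite ltrDl.
have n4 : \forall x \near p, U x by apply: (near_open oU Up).
have : \forall x \near p, [/\ U x, forall j, `|component X j x| <= 1,
    forall i j, `|partial i (component X j) x| <= 1 & `|f x| <= `|f p| + 1].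
  have n1' : \forall x \near p, forall j, `|component X j x| <= 1.
    by exact: (@filter_forall _ _ (fun j x => `|component X j x| <= 1) (nbhs p) _ n1).
  have n2' : \forall x \near p, forall i j, `|partial i (component X j) x| <= 1.
    apply: (@filter_forall _ _ (fun i x => forall j, `|partial i (component X j) x| <= 1) (nbhs p)) => i.
    exact: (@filter_forall _ _ (fun j x => `|partial i (component X j) x| <= 1) (nbhs p) _ (n2 i)).
  by near=> x; split; near: x.
case/nbhs_normP => d /= d0 Hd.
pose a := Num.min 1 (d ^+ 2) / 3.
have m0 : 0 < Num.min 1 (d ^+ 2) by rewrite lt_min ltr01 exprn_gt0.
have a0 : 0 < a by rewrite divr_gt0.
have a3 : 3 * a = Num.min 1 (d ^+ 2) by rewrite /a mulrC divfK.
have a1 : 3 * a <= 1 by rewrite a3 ge_min lexx.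
have Hx x : rho p x < 3 * a -> [/\ U x, forall j, `|component X j x| <= 1,
    forall i j, `|partial i (component X j) x| <= 1 & `|f x| <= `|f p| + 1].
  rewrite a3 lt_min => /andP[_ xd]; apply: Hd; rewrite /ball_ /= distrC.
  rewrite -(ltr_pXn2r (n := 2)) ?nnegrE ?(ltW d0) //.
  exact: le_lt_trans (rho_ge p x) xd.
have VU : [set x | rho p x < 3 * a] `<=` U by move=> x /Hx[].
have rc : {for p, continuous (rho p)}.
  exact: (smooth_on_continuous (rho_smooth p openT) (I : setT p)).
have : \forall x \near p, rho p x < a by apply: (cvgr_lt (rho p p) rc); rewrite rho_p.
apply: filterS => x xa; apply/rowP => j; rewrite mxE.
apply: (@beltrami_zero_near R p U f X oU sf BX vX a (`|f p| + 1) a0 a1 VU) => //.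
- by move=> z k /Hx[].
- by move=> z i k /Hx[].
- by move=> z /Hx[].
Unshelve. all: end_near.
Qed.

(** The points of [U] at which all derivatives of [X] vanish form a closed subset, by
continuity, and an open one, by local uniqueness. *)
Lemma beltrami_zero_connected p : connected U -> U p ->
  (forall k j, vanish k p (component X j)) -> forall x, U x -> X x = 0.
Proof.
move=> cU Up vp.
pose Z := [set x | U x /\ forall s j, iter_partial s (component X j) x = 0].
have ZX x : Z x -> X x = 0.
  by move=> [_ H]; apply/rowP => j; rewrite mxE; exact: (H [::] j).
suff -> : U = Z by [].
symmetry; apply: cU.
- by exists p; split=> // s j; exact: (vp (size s) j s).
- exists (interior Z); first exact: open_interior.
  rewrite eqEsubset; split=> x; last by move=> [_ /interior_subset].
  move=> [Ux Hx]; split=> //.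
  have X0 : \forall z \near x, X z = 0.
    by apply: beltrami_locally_zero => // k j s _; exact: Hx.
  have : \forall z \near x, U z /\ X z = 0.
    by near=> z; split; near: z => //; exact: (near_open oU Ux).
  pose W : set R3 := interior [set z | U z /\ X z = 0].
  have oW : open W by exact: open_interior.
  move=> Wx; apply: (near_open oW Wx) => z Wz.
  have [Uz _] := interior_subset Wz; split=> // s j.
  have XW : {in W, component X j =1 cst 0}.
    by move=> w /set_mem/interior_subset[_ Xw]; rewrite /component Xw mxE.
  rewrite (iter_partial_eq_on s oW XW) ?mem_set //.
  exact: (vanish_cst0 (k := size s) z).
- exists (closure Z); first exact: closed_closure.
  rewrite eqEsubset; split=> x; first by move=> Zx; split; [case: Zx|exact: subset_closure].
  move=> [Ux cx]; split=> // s j.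
  apply/eqP; apply: contraT => nz.
  have cs : {for x, continuous (iter_partial s (component X j))} := (sX j s Ux).1.
  have [z [[_ Hz]]] := cx _ (cvgr_neq0 _ cs nz).
  by rewrite Hz eqxx.
Unshelve. all: end_near.
Qed.
End Unique.

(** * Nondegenerate critical points *)

Lemma hessian_sym (R : realType) (U : set 'rV[R]_3) f (p : 'rV[R]_3) :
  open U -> U p -> smooth_on U f -> (hessian f p)^T = hessian f p.
Proof.
move=> oU Up sf; apply/matrixP => i j; rewrite !mxE.
exact: (partialC j i oU sf (mem_set Up)).
Qed.

(** [Q H Q^T] is invertible and diagonal. *)
Lemma diagonalized_neq0 (R : realType) (H Q : 'M[R]_3) (lam : 'I_3 -> R) :
  H \in unitmx -> (forall i k, \sum_(j < 3) Q i j * Q k j = (i == k)%:R) ->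
  (forall i k, \sum_(j < 3) \sum_(l < 3) Q i j * Q k l * H j l = lam k * (i == k)%:R) ->
  forall i, lam i != 0.
Proof.
move=> uH Qrow QH i.
have QQt : Q *m Q^T = 1%:M.
  by apply/matrixP => j k; rewrite !mxE -Qrow; apply: eq_bigr => l _; rewrite mxE.
have [uQ uQt] := mulmx1_unit QQt.
have : diag_mx (\row_k lam k) \in unitmx.
  suff <- : Q *m H *m Q^T = diag_mx (\row_k lam k) by rewrite !unitmx_mul uQ uH.
  apply/matrixP => j k; rewrite !mxE -[LHS]/(\sum_l _); transitivity (lam k * (j == k)%:R).
    rewrite -QH exchange_big /=; apply: eq_bigr => l _.
    by rewrite !mxE mulr_suml; apply: eq_bigr => m _; ring.
  by have [->|] := eqVneq j k; rewrite ?mulr1 ?mulr1n ?mulr0 ?mulr0n.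
rewrite unitmxE det_diag unitfE; apply: contra => /eqP l0.
by rewrite (bigD1 i) //= mxE l0 mul0r.
Qed.

Lemma beltrami_zero (R : realType) (U : set 'rV[R]_3) f (X : 'rV[R]_3 -> 'rV[R]_3) :
  open U -> (forall x, U x -> X x = 0) -> divfree_beltrami_field U f X.
Proof.
move=> oU X0.
have E j : {in U, cst 0 =1 component X j}.
  by move=> x /set_mem Ux; rewrite /component X0 // mxE.
have D i j x : U x -> partial i (component X j) x = 0.
  by move=> Ux; rewrite -(partial_eq_on i oU (E j)) ?partial_cst // mem_set.
split=> [j|x Ux|x Ux].
- exact: (smooth_on_eq oU (E j) (smooth_on_cst 0 oU)).
- by apply/rowP => i; rewrite X0 // !mxE !D // subrr mulr0.
- by rewrite /div big1 // => i _; exact: D.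
Qed.

Theorem theorem2 (R : realType) (f : 'rV[R]_3 -> R) (p : 'rV[R]_3)
  (f_smooth : smooth_on setT f)
  (p_crit : nondegenerate_critical_point f p)
  (f3_eq0 : forall h : 'rV[R]_3, taylor_term f p 3 h = 0)
  (f5_eq0 : forall h : 'rV[R]_3, taylor_term f p 5 h = 0)
  (U : set 'rV[R]_3) (U_open : open U) (U_conn : connected U) (Up : U p)
  (X : 'rV[R]_3 -> 'rV[R]_3) :
  divfree_beltrami_field U f X <-> (forall x, U x -> X x = 0).
Proof.
split=> [BX|]; last exact: beltrami_zero.
case: p_crit => df0 uH.
have sf : smooth_on U f by exact: (smooth_on_sub (@subsetT _ U) f_smooth).
have [Q [lam [Qrow Qcross QH]]] := diagonalize (hessian_sym U_open Up sf).
have lam0 := diagonalized_neq0 uH Qrow QH.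
have Qcol j k : \sum_(i < 3) Q i j * Q i k = (j == k)%:R.
  have /mulmx1C/matrixP/(_ j k) : Q *m Q^T = 1%:M.
    by apply/matrixP => i l; rewrite !mxE -Qrow; apply: eq_bigr => m _; rewrite mxE.
  by rewrite !mxE => <-; apply: eq_bigr => i _; rewrite mxE.
have crit i : fd Q i f p = 0.
  by rewrite /fd big1 // => j _; rewrite (diff_eq0_partial _ f_smooth) // mulr0.
have hess i k : fd Q i (fd Q k f) p = lam k * (i == k)%:R.
  rewrite (fd_fdE _ U_open i k sf (mem_set Up)) -QH.
  by apply: eq_bigr => j _; apply: eq_bigr => l _; rewrite mxE.
have f3 := taylor_term_vanish f_smooth f3_eq0.
have f5 := taylor_term_vanish f_smooth f5_eq0.
apply: (beltrami_zero_connected U_open sf BX U_conn Up).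
exact: (component_vanish U_open Up sf BX Qcol Qrow Qcross lam0 crit hess f3 f5).
Qed.
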